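(* Let a compact Lie group $G$ act affinely (not necessarily effectively) on a two-torus $\mathbb{R}^2/\Lambda$ through a homomorphism $\rho: G\to \mathrm{Aff}(\mathbb{R}^2/\Lambda)$, let $H=\ker\rho$, let $\chi\in\mathrm{Irr}(H)$, and let $G_\chi$ be the isotropy subgroup of $G$ at $\chi$. Assume that $\rho(G_\chi)$ is one-dimensional. Then there exists a circle $C$ in $\mathbb{R}^2/\Lambda$ such that the map $$G_\chi\times_{(G_\chi)_C}C\to\mathbb{R}^2/\Lambda,\qquad [g,x]\mapsto gx\quad(g\in G_\chi,\ x\in C)$$ is an equivariant isomorphism, where $(G_\chi)_C$ is the subgroup of $G_\chi$ preserving $C$. Moreover, the restriction map $$\mathrm{Vect}_{G_\chi}(\mathbb{R}^2/\Lambda,\chi)\to\mathrm{Vect}_{(G_\chi)_C}(C,\chi),\qquad E\mapsto E|_C$$ is an isomorphism.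
   Context: For a lattice $\Lambda\subset\mathbb{R}^2$, $\mathrm{Aff}(\mathbb{R}^2/\Lambda)$ is the (Lie) group of all maps $[\bar x]\mapsto[A\bar x+\bar c]$ of $\mathbb{R}^2/\Lambda$ with $\bar c\in\mathbb{R}^2$, $A\in GL(2,\mathbb{R})$, $A(\Lambda)=\Lambda$. $\mathrm{Irr}(H)$ is the set of characters of irreducible complex $H$-representations, with $G$-action $(g\cdot\chi)(h)=\chi(g^{-1}hg)$. For a closed subgroup $K<G$ with $H\lhd K$ and $K\cdot\chi=\chi$, a $K$-representation is $\chi$-isotypical if its restriction to $H$ is a direct sum of copies of the irreducible representation with character $\chi$. For a $K$-invariant subspace $X\subset\mathbb{R}^2/\Lambda$, $\mathrm{Vect}_K(X,\chi)$ is the set (semigroup under Whitney sum) of isomorphism classes of topological complex $K$-vector bundles $E$ over $X$ such that the isotropy $K_x$-representation $E_x$ on the fiber is $\chi$-isotypical for each $x\in X$. ''Equivariant isomorphism'' of spaces means equivariant homeomorphism; ''isomorphism'' for $\mathrm{Vect}$ means isomorphism of semigroups. *)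

(* Defs.v *)
From HB Require Import structures.
From mathcomp Require Import all_boot all_order all_algebra.
From mathcomp Require Import all_classical all_reals all_analysis.
From mathcomp Require Import complex.

Set Implicit Arguments.
Unset Strict Implicit.
Unset Printing Implicit Defensive.

Import Order.TTheory GRing.Theory Num.Theory numFieldNormedType.Exports.

Local Open Scope classical_set_scope.
Local Open Scope ring_scope.
Local Open Scope quotient_scope.

(* Naming R[i] as a numClosedFieldType is what makes the norm topology of
   numFieldNormedType.Exports available on it. *)
Definition Cplx (R : realType) : numClosedFieldType := R[i]%C.

Definition set_elt (T : Type) (A : set T) (x : T) (Ax : A x) : A :=
  exist _ x (mem_set Ax).

Section Homeomorphism.
Variables X Y : topologicalType.

Definition homeomorphism (f : X -> Y) : Prop :=
  continuous f /\
  exists g : Y -> X, [/\ continuous g, cancel f g & cancel g f].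

End Homeomorphism.

Lemma continuous_set_val (X : topologicalType) (A : set X) :
  continuous (\val : A -> X).
Proof. exact: initial_continuous. Qed.

Lemma continuous_to_set_type (X Y : topologicalType) (A : set X) (f : Y -> A) :
  continuous (fun y => \val (f y)) -> continuous f.
Proof. by move=> cf; apply/continuous_comp_initial. Qed.

Lemma fst_cts (X Y : topologicalType) : continuous (@fst X Y).
Proof. by move=> x; apply: cvg_fst. Qed.

Lemma snd_cts (X Y : topologicalType) : continuous (@snd X Y).
Proof. by move=> x; apply: cvg_snd. Qed.

Lemma comp_cts (X Y Z : topologicalType) (f : X -> Y) (g : Y -> Z) :
  continuous f -> continuous g -> continuous (fun x => g (f x)).
Proof. by move=> cf cg x; apply: continuous_comp; [exact: cf|exact: cg]. Qed.

Lemma pair_cts (X Y Z : topologicalType) (f : X -> Y) (g : X -> Z) :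
  continuous f -> continuous g -> continuous (fun x => (f x, g x)).
Proof. by move=> cf cg x; apply: cvg_pair; [exact: cf|exact: cg]. Qed.

HB.mixin Record isTopologicalGroup G & Topological G & Group G := {
  mulg_continuous : continuous (fun p : G * G => (p.1 * p.2)%g);
  invg_continuous : continuous (fun x : G => (x^-1)%g)
}.

#[short(type="topGroupType")]
HB.structure Definition TopGroup :=
  {G of Topological G & Group G & isTopologicalGroup G}.

Section LieGroups.
Variable R : realType.

(* On an open set [D], [Ck k D f] says that [f] is of class C^k on [D]: the
   values of [f] outside [D] are irrelevant. *)
Fixpoint Ck (V W : normedModType R) (k : nat) (D : set V) (f : V -> W) : Prop :=
  {within D, continuous f} /\
  if k is k'.+1 then
    forall v, (forall x, D x -> derivable f x v) /\ Ck k' D (fun x => 'D_v f x)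
  else True.

Definition smooth (V W : normedModType R) (D : set V) (f : V -> W) : Prop :=
  forall k, Ck k D f.

(* Charts are total maps, meaningful only on [chart_dom] and its image. *)
Record chart (X : topologicalType) (n : nat) := Chart {
  chart_dom : set X;
  chart_map : X -> 'rV[R]_n;
  chart_inv : 'rV[R]_n -> X;
  chart_dom_open : open chart_dom;
  chart_img_open : open (chart_map @` chart_dom);
  chart_map_cts : {within chart_dom, continuous chart_map};
  chart_inv_cts : {within chart_map @` chart_dom, continuous chart_inv};
  chart_mapK : forall x, chart_dom x -> chart_inv (chart_map x) = x
}.

Definition chart_img X n (c : chart X n) : set 'rV[R]_n :=
  chart_map c @` chart_dom c.

(* The dimension of a Lie group is that of its underlying manifold. *)
Definition locally_euclidean (X : topologicalType) (n : nat) : Prop :=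
  forall x : X, exists c : chart X n, chart_dom c x.

Definition smooth_atlas (X : topologicalType) n (A : chart X n -> Prop) : Prop :=
  (forall x, exists2 c, A c & chart_dom c x) /\
  forall a b, A a -> A b ->
    smooth (chart_map a @` (chart_dom a `&` chart_dom b))
           (fun u => chart_map b (chart_inv a u)).

Definition lie_group (G : topGroupType) (n : nat) : Prop :=
  [/\ hausdorff_space G, @second_countable G &
   exists A : chart G n -> Prop,
   [/\ smooth_atlas A,
       forall a b c, A a -> A b -> A c ->
         smooth [set p : 'rV[R]_n * 'rV[R]_n |
                  [/\ chart_img a p.1, chart_img b p.2 &
                      chart_dom c (chart_inv a p.1 * chart_inv b p.2)%g]]
                (fun p => chart_map c (chart_inv a p.1 * chart_inv b p.2)%g) &
       forall a b, A a -> A b ->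
         smooth [set u | chart_img a u /\ chart_dom b (chart_inv a u)^-1%g]
                (fun u => chart_map b (chart_inv a u)^-1%g)]].

Definition compact_lie_group (G : topGroupType) : Prop :=
  compact [set: G] /\ exists n, lie_group G n.

End LieGroups.

Section Torus.
Variable R : realType.

Definition is_lattice (L : set 'cV[R]_2) : Prop :=
  exists2 B : 'M[R]_2, B \in unitmx &
    L = [set B *m map_mx intr z | z in [set: 'cV[int]_2]].

Record lattice := Lattice {
  lattice_set :> set 'cV[R]_2;
  latticeP : is_lattice lattice_set
}.

Variable L : lattice.

Definition lattice_rel (x y : 'cV[R]_2) : bool := `[< lattice_set L (x - y) >].

Lemma lattice_rel_equiv : equiv_class_of lattice_rel.
Proof.
have [B _ LE] := latticeP L.
split=> [x|x y|y x z].
- by apply/asboolP; rewrite subrr LE; exists 0 => //; rewrite map_mx0 mulmx0.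
- have sym u v : lattice_rel u v -> lattice_rel v u.
    move=> /asboolP; rewrite LE => -[z _ zE]; apply/asboolP; rewrite LE.
    by exists (- z) => //; rewrite map_mxN mulmxN zE opprB.
  by apply/idP/idP; exact: sym.
- move=> /asboolP + /asboolP; rewrite LE => -[u _ uE] [v _ vE].
  apply/asboolP; rewrite LE; exists (u + v) => //.
  by rewrite map_mxD mulmxDr uE vE addrA subrK.
Qed.

Definition lattice_equiv : equiv_rel 'cV[R]_2 :=
  EquivRelPack lattice_rel_equiv.

Definition torus : topologicalType :=
  quotient_topology {eq_quot lattice_equiv}.

Definition torus_pi (x : 'cV[R]_2) : torus := \pi_({eq_quot lattice_equiv}) x.

Definition Aff : set (torus -> torus) :=
  [set f | exists (A : 'M[R]_2) (c : 'cV[R]_2),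
    [/\ A \in unitmx, [set A *m x | x in L] = L &
        forall x, f (torus_pi x) = torus_pi (A *m x + c)]].

Definition unit_circle : set (R * R) := [set p | p.1 ^+ 2 + p.2 ^+ 2 = 1].

Definition is_circle (X : topologicalType) (C : set X) : Prop :=
  exists f : unit_circle -> C, homeomorphism f.

End Torus.

Arguments Aff {R} L.

Record subgrp (G : topGroupType) := Subgrp {
  subgrp_set :> set G;
  subgrp1 : subgrp_set 1%g;
  subgrpM : forall g h, subgrp_set g -> subgrp_set h -> subgrp_set (g * h)%g;
  subgrpV : forall g, subgrp_set g -> subgrp_set (g^-1)%g
}.

Section SubgroupElements.
Variables (G : topGroupType) (K : subgrp G).

Lemma sgP (k : K) : subgrp_set K (\val k).
Proof. by have := valP k; rewrite inE. Qed.

Definition sg_one : K := set_elt (subgrp1 K).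

Definition sg_mul (g h : K) : K :=
  set_elt (subgrpM (sgP g) (sgP h)).

End SubgroupElements.

(* Continuity of the action map G x M -> M amounts, for M compact Hausdorff, to
   continuity of G -> (M -> M) for the compact-open topology. *)
Record gaction (G : topGroupType) (M : topologicalType) := GAction {
  gact :> G -> M -> M;
  gact1 : forall x, gact 1%g x = x;
  gactM : forall g h x, gact (g * h)%g x = gact g (gact h x);
  gact_cts : continuous (fun p : G * M => gact p.1 p.2)
}.

Section Actions.
Variables (G : topGroupType) (M : topologicalType) (rho : gaction G M).

Lemma gactK g x : rho (g^-1)%g (rho g x) = x.
Proof. by rewrite -gactM mulVg gact1. Qed.

Lemma gactVK g x : rho g (rho (g^-1)%g x) = x.
Proof. by rewrite -gactM mulgV gact1. Qed.

Definition gker : set G := [set g | forall x, rho g x = x].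

Lemma gkerJ g h : gker h -> gker (g^-1 * h * g)%g.
Proof. by move=> kh x; rewrite !gactM kh gactK. Qed.

Section Isotropy.
Variables (T : Type) (chi : G -> T).

(* A character of [H = gker rho] is represented by a function on [G] of which
   only the restriction to [H] matters. *)
Definition isotropy_set : set G :=
  [set g | forall h, gker h -> chi (g^-1 * h * g)%g = chi h].

Lemma isotropy_set1 : isotropy_set 1%g.
Proof. by move=> h _; rewrite invg1 mul1g mulg1. Qed.

Lemma isotropy_setM g g' :
  isotropy_set g -> isotropy_set g' -> isotropy_set (g * g')%g.
Proof.
move=> ig ig' h kh; rewrite invgM !mulgA -(ig _ kh) -(ig' _ (gkerJ g kh)).
by rewrite !mulgA.
Qed.

Lemma isotropy_setV g : isotropy_set g -> isotropy_set (g^-1)%g.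
Proof.
move=> ig h kh.
have kh' : gker ((g^-1)^-1 * h * g^-1)%g by exact: gkerJ.
by rewrite -(ig _ kh') invgK !mulgA mulVg mul1g -mulgA mulVg mulg1.
Qed.

Definition isotropy : subgrp G :=
  Subgrp isotropy_set1 isotropy_setM isotropy_setV.

End Isotropy.

Section SetStabilizer.
Variables (K : subgrp G) (C : set M).

Definition stab_set : set G := [set g | subgrp_set K g /\ rho g @` C = C].

Lemma stab_set1 : stab_set 1%g.
Proof.
split; first exact: subgrp1.
apply/seteqP; split=> [_ [x Cx <-]|x Cx]; first by rewrite gact1.
by exists x => //; rewrite gact1.
Qed.

Lemma stab_setM g h : stab_set g -> stab_set h -> stab_set (g * h)%g.
Proof.
move=> [Kg gC] [Kh hC]; split; first exact: subgrpM.
rewrite -[RHS]gC -[in RHS]hC image_comp.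
by apply: eq_imagel => x _; rewrite gactM.
Qed.

Lemma stab_setV g : stab_set g -> stab_set (g^-1)%g.
Proof.
move=> [Kg gC]; split; first exact: subgrpV.
rewrite -[in LHS]gC image_comp -[RHS]image_id.
by apply: eq_imagel => x _ /=; rewrite gactK.
Qed.

Definition set_stab : subgrp G := Subgrp stab_set1 stab_setM stab_setV.

End SetStabilizer.

Section TwistedProduct.
Variables (Gam K : subgrp G) (C : set M).

(* [gk, x] = [g, kx] for k in K *)
Definition twist_rel (p q : Gam * C) : bool :=
  `[< exists k : G, [/\ subgrp_set K k, \val p.1 = (\val q.1 * k)%g &
                       \val q.2 = rho k (\val p.2)] >].

Lemma twist_rel_equiv : equiv_class_of twist_rel.
Proof.
split=> [p|p q|q p r].
- apply/asboolP; exists 1%g; split; [exact: subgrp1|by rewrite mulg1|].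
  by rewrite gact1.
- have sym a b : twist_rel a b -> twist_rel b a.
    move=> /asboolP[k [Kk ab1 ab2]]; apply/asboolP; exists (k^-1)%g.
    by split; [exact: subgrpV|rewrite ab1 mulgK|rewrite ab2 gactK].
  by apply/idP/idP; exact: sym.
- move=> /asboolP[k [Kk pq1 pq2]] /asboolP[l [Kl qr1 qr2]].
  apply/asboolP; exists (l * k)%g; split; first exact: subgrpM.
  + by rewrite pq1 qr1 mulgA.
  + by rewrite qr2 pq2 gactM.
Qed.

Definition twist_equiv : equiv_rel (Gam * C)%type :=
  EquivRelPack twist_rel_equiv.

Definition twist : topologicalType :=
  quotient_topology {eq_quot twist_equiv}.

Definition twist_pi (g : Gam) (x : C) : twist :=
  \pi_({eq_quot twist_equiv}) (g, x).

Definition twist_rep (q : twist) : Gam * C :=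
  repr (q : {eq_quot twist_equiv}).

Definition twist_act (g : Gam) (q : twist) : twist :=
  twist_pi (sg_mul g (twist_rep q).1) (twist_rep q).2.

Definition twist_map (q : twist) : M :=
  rho (\val (twist_rep q).1) (\val (twist_rep q).2).

(* Independence of the representative chosen in [twist_map] and [twist_act] is
   [twist_mapE] and [twist_actE] below. *)
Lemma twist_repP g x : twist_rel (twist_rep (twist_pi g x)) (g, x).
Proof.
have : \pi_({eq_quot twist_equiv}) (twist_rep (twist_pi g x))
       = \pi_({eq_quot twist_equiv}) (g, x) by rewrite /twist_rep reprK.
by move/eqmodP.
Qed.

Lemma twist_mapE g x : twist_map (twist_pi g x) = rho (\val g) (\val x).
Proof.
have /asboolP[k [_ g1 x2]] := twist_repP g x.
by rewrite /twist_map g1 gactM -x2.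
Qed.

Lemma twist_actE g h x :
  twist_act g (twist_pi h x) = twist_pi (sg_mul g h) x.
Proof.
have /asboolP[k [Kk g1 x2]] := twist_repP h x.
apply/eqmodP/asboolP; exists k; split=> //=.
by rewrite g1 /= mulgA.
Qed.

End TwistedProduct.

End Actions.

Arguments twist {G M} rho Gam K C.
Arguments twist_map {G M} rho Gam K C q.

Section Representations.
Variables (R : realType) (G : topGroupType) (H : set G).
Local Notation C := (Cplx R).

Definition representation d (r : G -> 'M[C]_d) : Prop :=
  [/\ r 1%g = 1%:M,
      forall g h, H g -> H h -> r (g * h)%g = r g *m r h &
      continuous (fun h : H => r (\val h))].

Definition irreducible d (r : G -> 'M[C]_d) : Prop :=
  [/\ representation r, (0 < d)%N &
      forall W : {vspace 'cV[C]_d},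
        (forall h v, H h -> v \in W -> r h *m v \in W) ->
        W = 0%VS \/ W = fullv].

Definition affords d (r : G -> 'M[C]_d) (chi : G -> C) : Prop :=
  forall h, H h -> chi h = \tr (r h).

Definition Irr : set (G -> C) :=
  [set chi | exists d (r : G -> 'M[C]_d), irreducible r /\ affords r chi].

End Representations.

Arguments Irr R {G} H.

Section Bundles.
Variables (R : realType) (G : topGroupType) (M : topologicalType).
Variable rho : gaction G M.
Local Notation C := (Cplx R).

(* A trivialization of p : E -> X over U, where the fibre over x is the image
   of the vector space V x under the injection i x. *)
Definition trivialization (E : topologicalType) (X : set M) (p : E -> X)
    (V : X -> lmodType C) (i : forall x, V x -> E) (U : set X) (n : nat)
    (phi : U * 'cV[C]_n -> p @^-1` U) : Prop :=
  homeomorphism phi /\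
  forall y : U, exists l : 'cV[C]_n -> V (\val y),
    linear l /\ forall w, \val (phi (y, w)) = i (\val y) (l w).

(* Topological complex K-vector bundles over a K-invariant subspace X.  The
   vector space structure of the fibre over x is that of [fib x], which
   [fib_in x] identifies with the subset [proj^-1 (x)] of the total space. *)
Record vbundle (K : subgrp G) (X : set M) := VBundle {
  tot : topologicalType;
  proj : tot -> X;
  fib : X -> lmodType C;
  fib_in : forall x, fib x -> tot;
  vact : K -> tot -> tot;
  proj_cts : continuous proj;
  fib_in_inj : forall x, injective (fib_in (x := x));
  proj_in : forall x v, proj (fib_in (x := x) v) = x;
  fib_in_surj : forall e, exists v, fib_in (x := proj e) v = e;
  loc_triv : forall x, exists (U : set X) (n : nat)
    (phi : U * 'cV[C]_n -> proj @^-1` U),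
    [/\ open U, U x & trivialization fib_in phi];
  vact1 : forall e, vact (sg_one K) e = e;
  vactM : forall g h e, vact (sg_mul g h) e = vact g (vact h e);
  vact_cts : continuous (fun q : K * tot => vact q.1 q.2);
  vact_proj : forall g e, \val (proj (vact g e)) = rho (\val g) (\val (proj e));
  vact_lin : forall (g : K) (x y : X), \val y = rho (\val g) (\val x) ->
    exists l : fib x -> fib y,
      linear l /\ forall v, vact g (fib_in v) = fib_in (l v)
}.

Section OverX.
Variables (K : subgrp G) (X : set M).
Implicit Types E F : vbundle K X.

Definition vb_iso E F : Prop := exists f : tot E -> tot F,
  [/\ homeomorphism f,
      forall g e, f (vact g e) = vact g (f e) &
      forall x, exists l : fib E x -> fib F x,
        linear l /\ forall v, f (fib_in v) = fib_in (l v)].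

(* 'M_(d, m), acted upon by left multiplication, is the direct sum of m copies
   of the column space.  Representations affording the same irreducible
   character are isomorphic, so the quantification over [r] means "for the
   irreducible representation with character [chi]". *)
Definition isotypical (chi : G -> C) E : Prop :=
  forall d (r : G -> 'M[C]_d), irreducible (gker rho) r ->
    affords (gker rho) r chi ->
  forall x, exists m (l : 'M[C]_(d, m) -> fib E x),
    [/\ linear l, bijective l &
        forall (h : K) u, gker rho (\val h) ->
          vact h (fib_in (l u)) = fib_in (l (r (\val h) *m u))].

End OverX.
End Bundles.


Section LinearHelpers.
Variables (K : pzRingType) (U V W : lmodType K).

Lemma linear_comp (f : U -> V) (g : V -> W) :
  linear f -> linear g -> linear (g \o f).
Proof. by move=> lf lg a u v /=; rewrite lf lg. Qed.

Lemma linear_id : linear (@id U).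
Proof. by []. Qed.

Lemma linear_cancel (f : U -> V) (g : V -> U) :
  linear f -> cancel f g -> cancel g f -> linear g.
Proof.
move=> lf fK gK a u v; apply: (can_inj fK).
by rewrite lf !gK.
Qed.

End LinearHelpers.

Section ContinuousMatrix.
Variable K : numFieldType.

Lemma mx_cts (X : topologicalType) m n (f : X -> 'M[K]_(m, n)) :
  (forall i j, continuous (fun x => f x i j)) -> continuous f.
Proof.
move=> cf x; apply/cvg_ballP => e e0.
have H : \forall y \near x, forall i j, ball (f x i j) e (f y i j).
  apply: filter_forall => i; apply: filter_forall => j.
  by have /cvg_ballP/(_ e e0) := cf i j x.
by apply: filterS H => y yH; split.
Qed.
End ContinuousMatrix.

Section BundleOperations.
Variables (R : realType) (G : topGroupType) (M : topologicalType).
Variable rho : gaction G M.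
Local Notation C := (Cplx R).

Section Isomorphisms.
Variables (K : subgrp G) (X : set M).
Implicit Types E F D : vbundle R rho K X.

Lemma vb_iso_refl E : vb_iso E E.
Proof.
exists id; split=> //.
  by split; [move=> x; exact: cvg_id|exists id; split=> // x; exact: cvg_id].
by move=> x; exists id; split=> //; exact: linear_id.
Qed.

Lemma vb_iso_proj E F (f : tot E -> tot F) :
  (forall x, exists l : fib E x -> fib F x,
    linear l /\ forall v, f (fib_in v) = fib_in (l v)) ->
  forall e, proj (f e) = proj e.
Proof.
move=> fl e; have [l [_ fE]] := fl (proj e).
by have [v <-] := fib_in_surj e; rewrite fE !proj_in.
Qed.

Lemma vb_iso_sym E F : vb_iso E F -> vb_iso F E.
Proof.
move=> [f [[fc [g [gc fK gK]]] fa fl]]; exists g; split.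
- by split=> //; exists f.
- by move=> k e; apply: (can_inj fK); rewrite gK fa gK.
- move=> x; have [l [ll lE]] := fl x.
  have gin (w : fib F x) : exists v : fib E x, fib_in v = g (fib_in w).
    have := fib_in_surj (g (fib_in w)).
    have -> : proj (g (fib_in w)) = x.
      by rewrite -[RHS](proj_in w) -[in RHS](gK (fib_in w)) (vb_iso_proj fl).
    by [].
  have [l' l'E] := choice gin.
  exists l'; split; last by move=> v; rewrite l'E.
  apply: (@linear_cancel _ _ _ l) => // v.
    by apply: fib_in_inj; rewrite l'E -lE fK.
  by apply: fib_in_inj; rewrite -lE l'E gK.
Qed.

Lemma vb_iso_trans E F D : vb_iso E F -> vb_iso F D -> vb_iso E D.
Proof.
move=> [f [[fc [f' [fc' fK f'K]]] fa fl]] [g [[gc [g' [gc' gK g'K]]] ga gl]].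
exists (g \o f); split.
- split; first exact: comp_cts.
  exists (f' \o g'); split; first exact: comp_cts.
    exact: can_comp.
  exact: can_comp.
- by move=> k e /=; rewrite fa ga.
- move=> x; have [l [ll lE]] := fl x; have [m [lm mE]] := gl x.
  exists (m \o l); split; first exact: linear_comp.
  by move=> v /=; rewrite lE mE.
Qed.

End Isomorphisms.

Section Whitney.
Variables (K : subgrp G) (X : set M) (E F : vbundle R rho K X).

Definition wh_set : set (tot E * tot F) := [set p | proj p.1 = proj p.2].

Definition wh_tot : topologicalType := wh_set.

Lemma wh_totP (e : wh_tot) : proj (\val e).1 = proj (\val e).2.
Proof. by have := valP e; rewrite inE. Qed.

Definition wh_pair e f (ef : proj e = proj f) : wh_tot :=
  set_elt (ef : wh_set (e, f)).

Lemma wh_eq (p q : wh_tot) :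
  (\val p).1 = (\val q).1 -> (\val p).2 = (\val q).2 -> p = q.
Proof.
by move=> h1 h2; apply: val_inj; rewrite [LHS]surjective_pairing h1 h2 -surjective_pairing.
Qed.

Definition wh_proj (e : wh_tot) : X := proj (\val e).1.

Definition wh_fib (x : X) : lmodType C := (fib E x * fib F x)%type.

Definition wh_in (x : X) (v : wh_fib x) : wh_tot :=
  wh_pair (etrans (proj_in v.1) (esym (proj_in v.2))).

Lemma wh_act_subproof (k : K) (e : wh_tot) :
  proj (vact k (\val e).1) = proj (vact k (\val e).2).
Proof. by apply: val_inj; rewrite !vact_proj wh_totP. Qed.

Definition wh_act (k : K) (e : wh_tot) : wh_tot :=
  wh_pair (wh_act_subproof k e).

Lemma wh_fst_cts : continuous (fun e : wh_tot => (\val e).1).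
Proof.
apply: (@comp_cts wh_tot _ _ \val fst); last exact: fst_cts.
exact: continuous_set_val.
Qed.

Lemma wh_snd_cts : continuous (fun e : wh_tot => (\val e).2).
Proof.
apply: (@comp_cts wh_tot _ _ \val snd); last exact: snd_cts.
exact: continuous_set_val.
Qed.

Lemma wh_proj_cts : continuous wh_proj.
Proof.
by apply: (@comp_cts _ _ _ (fun e : wh_tot => (\val e).1) (@proj _ _ _ _ _ _ E));
  [exact: wh_fst_cts|exact: proj_cts].
Qed.

Lemma wh_in_inj x : injective (@wh_in x).
Proof.
move=> [v w] [v' w'] /(congr1 \val) /= [/fib_in_inj h1 /fib_in_inj h2].
by congr pair.
Qed.

Lemma wh_proj_in x (v : wh_fib x) : wh_proj (wh_in v) = x.
Proof. exact: proj_in. Qed.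

Lemma wh_in_surj e : exists v, wh_in (x := wh_proj e) v = e.
Proof.
have [v vE] := fib_in_surj (\val e).1.
have := fib_in_surj (\val e).2; rewrite -wh_totP => -[w wE].
by exists (v, w); apply: wh_eq.
Qed.

Lemma wh_act1 e : wh_act (sg_one K) e = e.
Proof. by apply: wh_eq => /=; rewrite vact1. Qed.

Lemma wh_actM g h e : wh_act (sg_mul g h) e = wh_act g (wh_act h e).
Proof. by apply: wh_eq => /=; rewrite vactM. Qed.

Lemma wh_act_cts : continuous (fun q : K * wh_tot => wh_act q.1 q.2).
Proof.
apply: continuous_to_set_type; apply: pair_cts => /=.
- apply: (@comp_cts _ _ _ (fun q : K * wh_tot => (q.1, (\val q.2).1))
      (fun q : K * tot E => vact q.1 q.2)); last exact: vact_cts.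
  apply: pair_cts; first exact: fst_cts.
  apply: (@comp_cts _ _ _ snd (fun e : wh_tot => (\val e).1));
    [exact: snd_cts|exact: wh_fst_cts].
- apply: (@comp_cts _ _ _ (fun q : K * wh_tot => (q.1, (\val q.2).2))
      (fun q : K * tot F => vact q.1 q.2)); last exact: vact_cts.
  apply: pair_cts; first exact: fst_cts.
  apply: (@comp_cts _ _ _ snd (fun e : wh_tot => (\val e).2));
    [exact: snd_cts|exact: wh_snd_cts].
Qed.

Lemma wh_act_proj g e :
  \val (wh_proj (wh_act g e)) = rho (\val g) (\val (wh_proj e)).
Proof. exact: vact_proj. Qed.

Lemma wh_act_lin (g : K) (x y : X) : \val y = rho (\val g) (\val x) ->
  exists l : wh_fib x -> wh_fib y,
    linear l /\ forall v, wh_act g (wh_in v) = wh_in (l v).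
Proof.
move=> yx; have [l [ll lE]] := vact_lin E yx; have [m [lm mE]] := vact_lin F yx.
exists (fun v => (l v.1, m v.2)); split.
  by move=> a u v; congr pair; [exact: ll|exact: lm].
by move=> v; apply: wh_eq => /=.
Qed.

Lemma wh_loc_triv x : exists (U : set X) (n : nat)
  (phi : U * 'cV[C]_n -> wh_proj @^-1` U),
  [/\ open U, U x & trivialization wh_in phi].
Proof.
have [U [m [phi [oU Ux [[phc [phi' [phc' phK phK']]] phl]]]]] := loc_triv E x.
have [V [n [psi [oV Vx [[psc [psi' [psc' psK psK']]] psl]]]]] := loc_triv F x.
have phP (y : U) w : proj (\val (phi (y, w))) = \val y.
  by have [l [_ ->]] := phl y; rewrite proj_in.
have psP (y : V) w : proj (\val (psi (y, w))) = \val y.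
  by have [l [_ ->]] := psl y; rewrite proj_in.
pose W := U `&` V.
pose iU (y : W) : U := set_elt (set_mem (valP y)).1.
pose iV (y : W) : V := set_elt (set_mem (valP y)).2.
have iUc : continuous iU by apply: continuous_to_set_type; exact: continuous_set_val.
have iVc : continuous iV by apply: continuous_to_set_type; exact: continuous_set_val.
have ex (q : W * 'cV[C]_(m + n)) :
    proj (\val (phi (iU q.1, usubmx q.2))) = proj (\val (psi (iV q.1, dsubmx q.2))).
  by rewrite phP psP.
have exW (q : W * 'cV[C]_(m + n)) : (wh_proj @^-1` W) (wh_pair (ex q)).
  by rewrite /preimage /= /wh_proj /= phP; exact: (set_mem (valP q.1)).
pose chi (q : W * 'cV[C]_(m + n)) : wh_proj @^-1` W :=
  set_elt (exW q).
have eU (e : wh_proj @^-1` W) : ((@proj _ _ _ _ _ _ E) @^-1` U) (\val (\val e)).1.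
  by have /set_mem[] := valP e.
have eV (e : wh_proj @^-1` W) : ((@proj _ _ _ _ _ _ F) @^-1` V) (\val (\val e)).2.
  by have /set_mem[_] := valP e; rewrite /wh_proj wh_totP.
pose pU (e : wh_proj @^-1` W) : (@proj _ _ _ _ _ _ E) @^-1` U := set_elt (eU e).
pose pV (e : wh_proj @^-1` W) : (@proj _ _ _ _ _ _ F) @^-1` V := set_elt (eV e).
have pUc : continuous pU.
  apply: continuous_to_set_type => /=.
  exact: (@comp_cts (wh_proj @^-1` W) wh_tot (tot E) \val (fun e => (\val e).1)
    (@continuous_set_val _ _) wh_fst_cts).
have pVc : continuous pV.
  apply: continuous_to_set_type => /=.
  exact: (@comp_cts (wh_proj @^-1` W) wh_tot (tot F) \val (fun e => (\val e).2)
    (@continuous_set_val _ _) wh_snd_cts).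
pose pW (e : wh_proj @^-1` W) : W :=
  set_elt (set_mem (valP e) : W (wh_proj (\val e))).
have pWc : continuous pW.
  apply: continuous_to_set_type => /=.
  exact: (@comp_cts (wh_proj @^-1` W) wh_tot X \val wh_proj
    (@continuous_set_val _ _) wh_proj_cts).
pose chi' (e : wh_proj @^-1` W) : W * 'cV[C]_(m + n) :=
  (pW e, col_mx (phi' (pU e)).2 (psi' (pV e)).2).
exists W, (m + n)%N, chi; split.
- exact: openI.
- by split.
- split; last first.
    move=> y; have [l [ll lE]] := phl (iU y); have [k [lk kE]] := psl (iV y).
    exists (fun w => (l (usubmx w), k (dsubmx w))); split.
      by move=> a u v; rewrite !linearP; congr pair; [exact: ll|exact: lk].
    by move=> w; apply: wh_eq => /=; [exact: lE|exact: kE].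
  split.
    apply: continuous_to_set_type => /=.
    apply: (@continuous_to_set_type _ _ (wh_set) (fun q => wh_pair (ex q))) => /=.
    have uc : continuous (fun q : W * 'cV[C]_(m + n) => usubmx q.2 : 'cV[C]_m).
      apply: mx_cts => i j.
      under [X in continuous X]eq_fun do rewrite mxE.
      exact: (@comp_cts _ _ _ snd (fun w : 'cV[C]_(m + n) => w (lshift n i) j)
        (@snd_cts _ _) (@coord_continuous _ _ _ _ _)).
    have dc : continuous (fun q : W * 'cV[C]_(m + n) => dsubmx q.2 : 'cV[C]_n).
      apply: mx_cts => i j.
      under [X in continuous X]eq_fun do rewrite mxE.
      exact: (@comp_cts _ _ _ snd (fun w : 'cV[C]_(m + n) => w (rshift m i) j)
        (@snd_cts _ _) (@coord_continuous _ _ _ _ _)).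
    have h1 := comp_cts (comp_cts (pair_cts (comp_cts (@fst_cts W 'cV[C]_(m + n)) iUc) uc) phc) (@continuous_set_val _ _).
    have h2 := comp_cts (comp_cts (pair_cts (comp_cts (@fst_cts W 'cV[C]_(m + n)) iVc) dc) psc) (@continuous_set_val _ _).
    exact: (pair_cts h1 h2).
  exists chi'; split.
  + apply: pair_cts => //; apply: mx_cts => i j.
    under [X in continuous X]eq_fun do rewrite mxE.
    case: (fintype.split i) => k.
      exact: (comp_cts (comp_cts (comp_cts pUc phc') (@snd_cts _ _))
        (@coord_continuous _ _ _ k j)).
    exact: (comp_cts (comp_cts (comp_cts pVc psc') (@snd_cts _ _))
      (@coord_continuous _ _ _ k j)).
  + move=> [y w]; rewrite /chi'; congr pair.
      by apply: val_inj => /=; rewrite /wh_proj /= phP.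
    have -> : pU (chi (y, w)) = phi (iU y, usubmx w) by exact: val_inj.
    have -> : pV (chi (y, w)) = psi (iV y, dsubmx w) by exact: val_inj.
    by rewrite phK psK vsubmxK.
  + move=> e; apply: val_inj; apply: wh_eq => /=.
    * rewrite col_mxKu.
      have -> : iU (pW e) = (phi' (pU e)).1.
        apply: val_inj => /=; rewrite -(phP _ (phi' (pU e)).2) -surjective_pairing phK'.
        by [].
      by rewrite -surjective_pairing phK'.
    * rewrite col_mxKd.
      have -> : iV (pW e) = (psi' (pV e)).1.
        apply: val_inj => /=; rewrite -(psP _ (psi' (pV e)).2) -surjective_pairing psK'.
        by rewrite /wh_proj wh_totP.
      by rewrite -surjective_pairing psK'.
Qed.

Definition whitney_sum : vbundle R rho K X :=
  VBundle wh_proj_cts wh_in_inj wh_proj_in wh_in_surj wh_loc_triv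
    wh_act1 wh_actM wh_act_cts wh_act_proj wh_act_lin.

End Whitney.

Section Restriction.
Variables (K K' : subgrp G) (X X' : set M) (E : vbundle R rho K X).
Hypotheses (KK : subgrp_set K' `<=` subgrp_set K) (XX : X' `<=` X).
Hypothesis KX : forall k x, subgrp_set K' k -> X' x -> X' (rho k x).

Definition incl_grp (k : K') : K := set_elt (KK (sgP k)).

Definition incl_base (x : X') : X := set_elt (XX (set_mem (valP x))).

Lemma incl_grp_cts : continuous incl_grp.
Proof. by apply: continuous_to_set_type; exact: continuous_set_val. Qed.

Lemma incl_base_cts : continuous incl_base.
Proof. by apply: continuous_to_set_type; exact: continuous_set_val. Qed.

Definition rs_set : set (tot E) := [set e | X' (\val (proj e))].

Definition rs_tot : topologicalType := rs_set.

Lemma rs_totP (e : rs_tot) : X' (\val (proj (\val e))).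
Proof. exact: set_mem (valP e). Qed.

Definition rs_proj (e : rs_tot) : X' := set_elt (rs_totP e).

Lemma rs_projE e : incl_base (rs_proj e) = proj (\val e).
Proof. exact: val_inj. Qed.

Definition rs_fib (x : X') : lmodType C := fib E (incl_base x).

Lemma rs_in_subproof (x : X') (v : rs_fib x) : rs_set (fib_in v).
Proof. by rewrite /rs_set /= proj_in; exact: set_mem (valP x). Qed.

Definition rs_in (x : X') (v : rs_fib x) : rs_tot := set_elt (rs_in_subproof v).

Lemma rs_act_subproof (k : K') (e : rs_tot) :
  rs_set (vact (incl_grp k) (\val e)).
Proof. by rewrite /rs_set /= vact_proj; apply: KX; [exact: sgP|exact: rs_totP]. Qed.

Definition rs_act (k : K') (e : rs_tot) : rs_tot :=
  set_elt (rs_act_subproof k e).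

Lemma rs_proj_cts : continuous rs_proj.
Proof.
apply: continuous_to_set_type => /=.
exact: (comp_cts (comp_cts (@continuous_set_val _ rs_set) (@proj_cts _ _ _ _ _ _ E))
  (@continuous_set_val _ _)).
Qed.

Lemma rs_in_inj x : injective (@rs_in x).
Proof. by move=> v w /(congr1 \val) /fib_in_inj. Qed.

Lemma rs_proj_in x (v : rs_fib x) : rs_proj (rs_in v) = x.
Proof. by apply: val_inj; rewrite /= proj_in. Qed.

Lemma rs_in_surj e : exists v, rs_in (x := rs_proj e) v = e.
Proof.
have := fib_in_surj (\val e); rewrite -rs_projE => -[v vE].
by exists v; apply: val_inj.
Qed.

Lemma rs_loc_triv x : exists (U : set X') (n : nat)
  (phi : U * 'cV[C]_n -> rs_proj @^-1` U),
  [/\ open U, U x & trivialization rs_in phi].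
Proof.
have [U [n [phi [oU Ux [[phc [phi' [phc' phK phK']]] phl]]]]] :=
  loc_triv E (incl_base x).
have phP (y : U) w : proj (\val (phi (y, w))) = \val y.
  by have [l [_ ->]] := phl y; rewrite proj_in.
pose W : set X' := incl_base @^-1` U.
pose iU (y : W) : U := set_elt (set_mem (valP y) : U (incl_base (\val y))).
have iUc : continuous iU.
  apply: continuous_to_set_type => /=.
  exact: (comp_cts (@continuous_set_val _ W) incl_base_cts).
have ex (q : W * 'cV[C]_n) : rs_set (\val (phi (iU q.1, q.2))).
  by rewrite /rs_set /= phP /=; exact: set_mem (valP (\val q.1)).
have exW (q : W * 'cV[C]_n) : (rs_proj @^-1` W) (set_elt (ex q)).
  by rewrite /preimage /= /W /= rs_projE /= phP; exact: set_mem (valP (iU q.1)).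
pose chi (q : W * 'cV[C]_n) : rs_proj @^-1` W := set_elt (exW q).
have eU (e : rs_proj @^-1` W) : ((@proj _ _ _ _ _ _ E) @^-1` U) (\val (\val e)).
  by have /set_mem := valP e; rewrite /W /preimage /= rs_projE.
pose pU (e : rs_proj @^-1` W) : (@proj _ _ _ _ _ _ E) @^-1` U := set_elt (eU e).
have pUc : continuous pU.
  apply: continuous_to_set_type => /=.
  exact: (comp_cts (@continuous_set_val _ (rs_proj @^-1` W))
    (@continuous_set_val _ rs_set)).
pose pW (e : rs_proj @^-1` W) : W :=
  set_elt (set_mem (valP e) : W (rs_proj (\val e))).
have pWc : continuous pW.
  apply: continuous_to_set_type => /=.
  exact: (comp_cts (@continuous_set_val _ (rs_proj @^-1` W)) rs_proj_cts).
exists W, n, chi; split.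
- by move/continuousP: incl_base_cts; apply.
- by [].
- split; last first.
    move=> y; have [l [ll lE]] := phl (iU y).
    by exists l; split=> // w; apply: val_inj => /=; exact: lE.
  split.
    apply: continuous_to_set_type => /=.
    apply: (@continuous_to_set_type _ _ rs_set (fun q => set_elt (ex q))) => /=.
    exact: (comp_cts (comp_cts (pair_cts
      (comp_cts (@fst_cts W 'cV[C]_n) iUc) (@snd_cts _ _)) phc)
      (@continuous_set_val _ _)).
  exists (fun e => (pW e, (phi' (pU e)).2)); split.
  + exact: (pair_cts pWc (comp_cts (comp_cts pUc phc') (@snd_cts _ _))).
  + move=> [y w]; congr pair.
      by apply: val_inj; apply: val_inj; rewrite /= phP.
    have -> : pU (chi (y, w)) = phi (iU y, w) by exact: val_inj.
    by rewrite phK.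
  + move=> e; apply: val_inj; apply: val_inj => /=.
    have -> : iU (pW e) = (phi' (pU e)).1.
      apply: val_inj => /=.
      by rewrite -(phP _ (phi' (pU e)).2) -surjective_pairing phK' rs_projE.
    by rewrite -surjective_pairing phK'.
Qed.

Lemma rs_act1 e : rs_act (sg_one K') e = e.
Proof.
apply: val_inj => /=; rewrite (_ : incl_grp _ = sg_one K) ?vact1 //.
exact: val_inj.
Qed.

Lemma rs_actM g h e : rs_act (sg_mul g h) e = rs_act g (rs_act h e).
Proof.
apply: val_inj => /=.
rewrite (_ : incl_grp _ = sg_mul (incl_grp g) (incl_grp h)) ?vactM //.
exact: val_inj.
Qed.

Lemma rs_act_cts : continuous (fun q : K' * rs_tot => rs_act q.1 q.2).
Proof.
apply: continuous_to_set_type => /=.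
exact: (comp_cts (pair_cts (comp_cts (@fst_cts K' rs_tot) incl_grp_cts)
  (comp_cts (@snd_cts K' rs_tot) (@continuous_set_val _ rs_set)))
  (@vact_cts _ _ _ _ _ _ E)).
Qed.

Lemma rs_act_proj g e :
  \val (rs_proj (rs_act g e)) = rho (\val g) (\val (rs_proj e)).
Proof. by rewrite /= vact_proj. Qed.

Lemma rs_act_lin (g : K') (x y : X') : \val y = rho (\val g) (\val x) ->
  exists l : rs_fib x -> rs_fib y,
    linear l /\ forall v, rs_act g (rs_in v) = rs_in (l v).
Proof.
move=> yx.
have yx' : \val (incl_base y) = rho (\val (incl_grp g)) (\val (incl_base x)) by [].
have [l [ll lE]] := vact_lin E yx'.
by exists l; split=> // v; apply: val_inj => /=.
Qed.

Definition restriction : vbundle R rho K' X' :=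
  VBundle rs_proj_cts rs_in_inj rs_proj_in rs_in_surj rs_loc_triv
    rs_act1 rs_actM rs_act_cts rs_act_proj rs_act_lin.

End Restriction.

Lemma vb_iso_whitney K X (E E' F F' : vbundle R rho K X) :
  vb_iso E E' -> vb_iso F F' -> vb_iso (whitney_sum E F) (whitney_sum E' F').
Proof.
move=> [f [[fc [f' [fc' fK f'K]]] fa fl]] [g [[gc [g' [gc' gK g'K]]] ga gl]].
have fp := vb_iso_proj fl; have gp := vb_iso_proj gl.
have fp' e : proj (f' e) = proj e by rewrite -fp f'K.
have gp' e : proj (g' e) = proj e by rewrite -gp g'K.
have hP (e : wh_tot E F) : proj (f (\val e).1) = proj (g (\val e).2).
  by rewrite fp gp wh_totP.
have hP' (e : wh_tot E' F') : proj (f' (\val e).1) = proj (g' (\val e).2).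
  by rewrite fp' gp' wh_totP.
exists (fun e => wh_pair (hP e)); split.
- have c0 : continuous (fun e : wh_tot E F => \val (wh_pair (hP e))).
    exact: (pair_cts (comp_cts (@wh_fst_cts _ _ E F) fc)
      (comp_cts (@wh_snd_cts _ _ E F) gc)).
  have c1 : continuous (fun e : wh_tot E F => wh_pair (hP e)).
    exact: (continuous_to_set_type c0).
  split; first exact: c1.
  exists (fun e => wh_pair (hP' e)); split.
  + have c0' : continuous (fun e : wh_tot E' F' => \val (wh_pair (hP' e))).
      exact: (pair_cts (comp_cts (@wh_fst_cts _ _ E' F') fc')
        (comp_cts (@wh_snd_cts _ _ E' F') gc')).
    exact: (continuous_to_set_type c0').
  + by move=> e; apply: wh_eq => /=; rewrite ?fK ?gK.
  + by move=> e; apply: wh_eq => /=; rewrite ?f'K ?g'K.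
- by move=> k e; apply: wh_eq => /=; rewrite ?fa ?ga.
- move=> x; have [l [ll lE]] := fl x; have [m [lm mE]] := gl x.
  exists (fun v => (l v.1, m v.2)); split.
    by move=> a u v; congr pair; [exact: ll|exact: lm].
  by move=> v; apply: wh_eq => /=.
Qed.

Lemma vb_iso_restriction (K K' : subgrp G) (X X' : set M)
    (KK : subgrp_set K' `<=` subgrp_set K) (XX : X' `<=` X)
    (KX : forall k x, subgrp_set K' k -> X' x -> X' (rho k x))
    (E F : vbundle R rho K X) :
  vb_iso E F -> vb_iso (restriction E KK XX KX) (restriction F KK XX KX).
Proof.
move=> [f [[fc [f' [fc' fK f'K]]] fa fl]].
have fp := vb_iso_proj fl.
have fp' e : proj (f' e) = proj e by rewrite -fp f'K.
have hP (e : rs_tot X' E) : @rs_set K X X' F (f (\val e)).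
  by rewrite /rs_set /= fp; exact: rs_totP.
have hP' (e : rs_tot X' F) : @rs_set K X X' E (f' (\val e)).
  by rewrite /rs_set /= fp'; exact: rs_totP.
exists (fun e => set_elt (hP e)); split.
- have c0 : continuous (fun e : rs_tot X' E => \val (set_elt (hP e))).
    exact: (comp_cts (@continuous_set_val _ (@rs_set K X X' E)) fc).
  split; first exact: (continuous_to_set_type c0).
  exists (fun e => set_elt (hP' e)); split.
  + have c0' : continuous (fun e : rs_tot X' F => \val (set_elt (hP' e))).
      exact: (comp_cts (@continuous_set_val _ (@rs_set K X X' F)) fc').
    exact: (continuous_to_set_type c0').
  + by move=> e; apply: val_inj => /=; rewrite fK.
  + by move=> e; apply: val_inj => /=; rewrite f'K.
- by move=> k e; apply: val_inj => /=; rewrite fa.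
- move=> x; have [l [ll lE]] := fl (incl_base XX x).
  by exists l; split=> // v; apply: val_inj => /=.
Qed.

Section Isotypical.
Variable chi : G -> C.

Lemma isotypical_whitney K X (E F : vbundle R rho K X) :
  isotypical chi E -> isotypical chi F -> isotypical chi (whitney_sum E F).
Proof.
move=> iE iF d r ir rc x.
have [m [l [ll [l' lK l'K] lE]]] := iE d r ir rc x.
have [n [k [lk [k' kK k'K] kE]]] := iF d r ir rc x.
exists (m + n)%N, (fun u => (l (lsubmx u), k (rsubmx u)) : fib (whitney_sum E F) x).
split.
- by move=> a u v; rewrite !linearP; congr pair; [exact: ll|exact: lk].
- exists (fun v : wh_fib E F x => row_mx (l' v.1) (k' v.2)).
    by move=> u; rewrite lK kK hsubmxK.
  by move=> [v w]; rewrite /= row_mxKl row_mxKr l'K k'K.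
- move=> h u hk; apply: wh_eq => /=; rewrite ?lE ?kE //.
  + by congr (fib_in (l _)); rewrite -[in LHS](hsubmxK u) -[in RHS](hsubmxK u) mul_mx_row !row_mxKl.
  + by congr (fib_in (k _)); rewrite -[in LHS](hsubmxK u) -[in RHS](hsubmxK u) mul_mx_row !row_mxKr.
Qed.

Lemma isotypical_restriction (K K' : subgrp G) (X X' : set M)
    (KK : subgrp_set K' `<=` subgrp_set K) (XX : X' `<=` X)
    (KX : forall k x, subgrp_set K' k -> X' x -> X' (rho k x))
    (E : vbundle R rho K X) :
  isotypical chi E -> isotypical chi (restriction E KK XX KX).
Proof.
move=> iE d r ir rc x.
have [m [l [ll lb lE]]] := iE d r ir rc (incl_base XX x).
exists m, l; split=> // h u hk; apply: val_inj => /=.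
exact: lE.
Qed.

(* An element of Vect is an isomorphism class, as a predicate on bundles. *)
Record Vect (K : subgrp G) (X : set M) := MkVect {
  vclass : vbundle R rho K X -> Prop;
  vclassP : exists2 E, isotypical chi E & vclass = vb_iso E
}.

Definition Vect_class K X (E : vbundle R rho K X) (iE : isotypical chi E) : Vect K X :=
  MkVect (ex_intro2 _ _ E iE erefl).

Lemma Vect_add_subproof K X (a b : Vect K X) :
  exists2 E, isotypical chi E &
  (fun F => exists E1 E2, [/\ vclass a E1, vclass b E2 &
                              vb_iso (whitney_sum E1 E2) F]) = vb_iso E.
Proof.
have [E iE ->] := vclassP a; have [F iF ->] := vclassP b.
exists (whitney_sum E F); first exact: isotypical_whitney.
apply/funext => D; apply/propext; split; last first.
  by move=> h; exists E, F; split=> //; exact: vb_iso_refl.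
move=> [E1 [F1 [h1 h2 h3]]].
by apply: vb_iso_trans h3; exact: vb_iso_whitney.
Qed.

Definition Vect_add K X (a b : Vect K X) : Vect K X :=
  MkVect (Vect_add_subproof a b).

Section RestrictionMap.
Variables (K K' : subgrp G) (X X' : set M).
Hypotheses (KK : subgrp_set K' `<=` subgrp_set K) (XX : X' `<=` X).
Hypothesis KX : forall k x, subgrp_set K' k -> X' x -> X' (rho k x).

Lemma Vect_res_subproof (a : Vect K X) :
  exists2 E, isotypical chi E &
  (fun F => exists2 D, vclass a D & vb_iso (restriction D KK XX KX) F)
    = vb_iso E.
Proof.
have [E iE ->] := vclassP a.
exists (restriction E KK XX KX); first exact: isotypical_restriction.
apply/funext => D; apply/propext; split.
  by move=> [E1 h1 h2]; apply: vb_iso_trans h2; exact: vb_iso_restriction.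
by move=> h; exists E => //; exact: vb_iso_refl.
Qed.

Definition Vect_res (a : Vect K X) : Vect K' X' :=
  MkVect (Vect_res_subproof a).

End RestrictionMap.

End Isotypical.

End BundleOperations.

Section MainNotions.
Variables (R : realType) (G : topGroupType) (M : topologicalType).
Variable rho : gaction G M.

(* rho(K), as a subspace of the self-maps of M. On the affine group of a torus
   the compact-open topology is the Lie group topology. *)
Definition action_image (K : subgrp G) : set {compact-open, M -> M} :=
  [set (rho g : {compact-open, M -> M}) | g in subgrp_set K].

Definition one_dimensional (K : subgrp G) : Prop :=
  locally_euclidean R (action_image K) 1.

Lemma set_stab_sub (K : subgrp G) (C : set M) :
  subgrp_set (set_stab rho K C) `<=` subgrp_set K.
Proof. by move=> g []. Qed.

Lemma set_stab_act (K : subgrp G) (C : set M) k x :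
  subgrp_set (set_stab rho K C) k -> C x -> C (rho k x).
Proof. by move=> [_ kC] Cx; rewrite -kC; exists x. Qed.

Definition restrict_to (chi : G -> Cplx R) (K : subgrp G) (C : set M) :
    Vect rho chi K setT -> Vect rho chi (set_stab rho K C) C :=
  Vect_res (@set_stab_sub K C) (@subsetT M C) (@set_stab_act K C).

Definition Vect_isomorphism (chi : G -> Cplx R) (K K' : subgrp G) (X X' : set M)
    (f : Vect rho chi K X -> Vect rho chi K' X') : Prop :=
  bijective f /\ forall a b, f (Vect_add a b) = Vect_add (f a) (f b).

End MainNotions.

Arguments restrict_to {R G M} rho chi K C.

(* Main.v *)
(** The translations in the image of G_chi form a closed subgroup of R^2
    containing the lattice.  Since the image is one-dimensional, this subgroup is
    neither discrete nor everything, so it contains a line Rv and is discrete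
    transversally to it.  The linear parts form a finite group preserving Rv;
    each of them is an involution and they commute, so they preserve a
    complementary line Rw, which can be chosen rational.  Any circle C of
    direction w meets every orbit, and a translate gC that meets C equals C,
    because all gC are parallel.

    Bundles extend from C by induction, E -> G_chi x_K E with K the stabilizer
    of C.  Local triviality of the induced bundle reduces to the following: near
    a point, the representation of the compact group H = ker(rho) on the fibres
    extends to a continuous matrix-valued function F on G with
    F(g h^-1) = h F(g).  Neither Haar measure nor local sections are needed for
    that.  Start from a Tietze extension f of the representation, and let F(g) be
    the centre of the orbit {h^-1 f(g h^-1)} for the H-invariant norm
    sup_k |k c|: it is unique by strict convexity, hence continuous and
    equivariant. *)

Require Import Defs.
From HB Require Import structures.
From mathcomp Require Import all_boot all_order all_algebra.
From mathcomp Require Import all_classical all_reals all_analysis.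
From mathcomp Require Import perm complex zify lra ring.
(* [all_analysis] shadows some names of [Defs], such as [proj]. *)
Import Defs.

Set Implicit Arguments.
Unset Strict Implicit.
Unset Printing Implicit Defensive.

Import Order.TTheory GRing.Theory Num.Theory numFieldNormedType.Exports.

Local Open Scope classical_set_scope.
Local Open Scope ring_scope.

(** * Topological preliminaries *)

(** The reduction to ker(rho) rests on the stabilizer K of C being discrete modulo ker(rho). An
    element of K near 1 is the translation by a small vector c; the gap transversal to v makes c
    parallel to v, and preservation of C makes det(w, c) an integer of absolute value less than 1,
    so c = 0. Hence two nearby points of G x C with the same image in the torus differ by the kernel
    only, and a local frame descends to the induced bundle once it is compatible with the kernel.

    The topological obstacle is that a quotient map times an identity need not be a quotient map,
    and that total spaces need not be compact. Continuity is therefore only descended along open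
    maps, which come from group orbits, or along closed maps, which come from compactness of the
    group.

    A centre need not exist for every parameter. At the base point the orbit is the single matrix 1,
    so a centre of radius zero exists there, and strict quasi-convexity carries existence to nearby
    parameters. *)

Lemma nbhs_preim (X Y : topologicalType) (f : X -> Y) (x : X) (B : set Y) :
  {for x, continuous f} -> nbhs (f x) B -> nbhs x (f @^-1` B).
Proof. by move=> cf; exact: cf. Qed.

Lemma cts_at (X Y : topologicalType) (f : X -> Y) (x : X) :
  (forall B, nbhs (f x) B -> nbhs x (f @^-1` B)) -> {for x, continuous f}.
Proof. by []. Qed.

Lemma nbhsI (X : topologicalType) (x : X) (A B : set X) :
  nbhs x A -> nbhs x B -> nbhs x (A `&` B).
Proof. exact: filterI. Qed.

Lemma nbhs_sub (X : topologicalType) (A : set X) (x : A) (B : set A) :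
  nbhs x B <-> exists2 N : set X, nbhs (\val x) N & forall y : A, N (\val y) -> B y.
Proof.
split.
  move=> nB; rewrite nbhsE in nB; case: nB => U [[V oV VU] Ux] UB.
  exists V; first by apply: open_nbhs_nbhs; split=> //; rewrite -VU in Ux.
  by move=> y Vy; apply: UB; rewrite -VU.
move=> [N Nx NB].
have h : nbhs x (\val @^-1` N) := @continuous_set_val X A x N Nx.
by apply: filterS h => y; exact: NB.
Qed.

Lemma compact_sub (X : topologicalType) (A : set X) :
  compact A -> compact [set: A].
Proof.
move=> /compact_near_coveringP cA; apply/compact_near_coveringP => I F P FF h.
have : \near F, A `<=` (fun x => forall y : A, \val y = x -> P F y).
  apply: cA => x Ax.
  have [[U V] /= [Ux FV] UVP] := h (set_elt Ax) Logic.I.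
  have [N Nx NU] := (nbhs_sub _ _).1 Ux.
  exists (N, V) => // -[x' i] /= [Nx' Vi] y yx.
  by apply: (UVP (y, i)); split=> //=; apply: NU; move: Nx'; rewrite -yx.
by apply: filterS => i h' y _; apply: (h' (\val y)) => //; exact: set_mem (valP y).
Qed.

Lemma hausdorff_inj (X Y : topologicalType) (f : X -> Y) :
  hausdorff_space Y -> continuous f -> injective f -> hausdorff_space X.
Proof.
move=> hY cf fI x y xy; apply/fI/hY => A B nA nB.
by have [z [Az Bz]] := xy _ _ (cf _ _ nA) (cf _ _ nB); exists (f z).
Qed.

Lemma closed_preim (X Y : topologicalType) (f : X -> Y) (A : set Y) :
  continuous f -> closed A -> closed (f @^-1` A).
Proof. by move=> cf; apply: preimage_closed => x _; exact: cf. Qed.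

Lemma open_preim (X Y : topologicalType) (f : X -> Y) (A : set Y) :
  continuous f -> open A -> open (f @^-1` A).
Proof. by move=> /continuousP; apply. Qed.

Lemma closed_eq_fun (X Y : topologicalType) (f g : X -> Y) :
  hausdorff_space Y -> continuous f -> continuous g ->
  closed [set x | f x = g x].
Proof.
move=> hY cf cg x h; apply: hY => A B nA nB.
have [y [fy [Ay By]]] := h _ (nbhsI (nbhs_preim (cf x) nA) (nbhs_preim (cg x) nB)).
by exists (f y); split=> //; rewrite fy.
Qed.

Definition open_map (X Y : topologicalType) (f : X -> Y) :=
  forall x A, nbhs x A -> nbhs (f x) (f @` A).

Lemma open_map_open (X Y : topologicalType) (f : X -> Y) A :
  open_map f -> open A -> open (f @` A).
Proof.
move=> fo oA; rewrite openE => _ [x Ax <-]; rewrite /interior.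
by apply: fo; exact: open_nbhs_nbhs.
Qed.

Lemma open_mapP (X Y : topologicalType) (f : X -> Y) :
  (forall A, open A -> open (f @` A)) -> open_map f.
Proof.
move=> h x A; rewrite nbhsE => -[U [oU Ux] UA].
apply: filterS (image_subset _ UA) _; apply: open_nbhs_nbhs; split; first exact: h.
by exists x.
Qed.

Lemma open_map_id (X : topologicalType) : open_map (@id X).
Proof. by move=> x A; rewrite image_id. Qed.

Lemma open_map_prod (X Y X' Y' : topologicalType) (f : X -> Y) (g : X' -> Y') :
  open_map f -> open_map g -> open_map (fun p : X * X' => (f p.1, g p.2)).
Proof.
move=> fo go [x x'] A [[U V] /= [Ux Vx] UVA].
exists (f @` U, g @` V); first by split; [exact: fo|exact: go].
by move=> [_ _] /= [[u Uu <-] [v Vv <-]]; exists (u, v) => //; exact: UVA.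
Qed.

Lemma open_map_val (X : topologicalType) (U : set X) : open U -> open_map (\val : U -> X).
Proof.
move=> oU x A /nbhs_sub[N Nx NA].
have nU : nbhs (\val x) U by apply: open_nbhs_nbhs; split=> //; exact: set_mem (valP x).
by apply: (filterS _ (nbhsI Nx nU)) => y [Ny Uy]; exists (set_elt Uy) => //; exact: NA.
Qed.

(** A pointwise substitute for the universal property of a quotient: openness survives products with
    an identity map, whereas being a quotient map does not. *)
Lemma open_map_descend (X Y W : topologicalType) (p : X -> Y) (f : Y -> W) (x : X) :
  open_map p -> {for x, continuous (fun x => f (p x))} -> {for p x, continuous f}.
Proof.
move=> po cfp B /= nB; have := po _ _ (nbhs_preim cfp nB).
by apply: filterS => _ [x' + <-].
Qed.

(** The saturation of an open set is the union of its preimages under the maps [a i], hence open. *)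
Lemma open_map_orbits (X Y : topologicalType) (p : X -> Y) (I : Type) (a : I -> X -> X) :
  (forall A, open (p @^-1` A) -> open A) -> (forall i, continuous (a i)) ->
  (forall x y, p x = p y <-> exists i, x = a i y) -> open_map p.
Proof.
move=> po ca h; apply: open_mapP => A oA; apply: po.
rewrite (_ : _ @^-1` _ = \bigcup_i (a i @^-1` A)); last first.
  apply/seteqP; split=> [y [x Ax /(h x y).1 [i xE]]|y [i _ Ay]].
    by exists i => //; rewrite /preimage /= -xE.
  by exists (a i y) => //; apply: (h _ _).2; exists i.
by apply: bigcup_open => i _; exact: open_preim.
Qed.

(** Closed counterpart of [open_map_descend]: the preimage of a closed set under [f] is the image
    under [p] of a closed set. *)
Lemma closed_map_descend (X Y W : topologicalType) (p : X -> Y) (f : Y -> W) :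
  (forall A, closed A -> closed (p @` A)) -> (forall y, exists x, p x = y) ->
  continuous (fun x => f (p x)) -> continuous f.
Proof.
move=> pc ps cfp; apply/continuous_closedP => B cB.
rewrite (_ : f @^-1` B = p @` ((fun x => f (p x)) @^-1` B)).
  by apply: pc; exact: closed_preim.
apply/seteqP; split=> [y By|_ [x Bx <-]] //.
by have [x xy] := ps y; exists x => //; rewrite /preimage /= xy.
Qed.

Lemma compact_closed_map (X Y : topologicalType) (f : X -> Y) :
  compact [set: X] -> hausdorff_space Y -> continuous f ->
  forall A, closed A -> closed (f @` A).
Proof.
move=> cX hY cf A cA; apply: compact_closed => //.
apply: continuous_compact; first by apply: continuous_subspaceT.
exact: (subclosed_compact cA cX).
Qed.

Lemma closed_map_homeo (X Y : topologicalType) (f : X -> Y) :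
  (forall A, closed A -> closed (f @` A)) -> continuous f -> injective f ->
  (forall y, exists x, f x = y) -> homeomorphism f.
Proof.
move=> fc cf fI fs; split=> //.
have [g gK] := choice fs.
have fK : cancel f g by move=> x; apply: fI; rewrite gK.
exists g; split=> //; apply: (closed_map_descend fc fs).
rewrite (_ : (fun x => _) = id); first by move=> x; exact: cvg_id.
by apply/funext => x; rewrite fK.
Qed.

(** The tube lemma, in terms of filters. *)
Lemma near_forall_compact (X Y : topologicalType) (K : set Y) (x : X) (P : X -> Y -> Prop) :
  compact K -> (forall y, K y -> \forall p \near (x, y), P p.1 p.2) ->
  \forall x' \near x, forall y, K y -> P x' y.
Proof.
move=> /compact_near_coveringP cK h; apply: (cK _ _ _ _) => y Ky.
have [[U V] /= [Ux Vy] UVP] := h y Ky.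
by exists (V, U) => // -[y' x'] /= [? ?]; exact: (UVP (x', y')).
Qed.

Lemma open_ext_cts (X W : topologicalType) (U : set X) (f : U -> W) (g : X -> W) (x : U) :
  open U -> {for x, continuous f} -> (forall y : U, g (\val y) = f y) ->
  {for \val x, continuous g}.
Proof.
move=> oU cf gE B; rewrite gE => /cf /nbhs_sub[N Nx NB].
have nU : nbhs (\val x) U by apply: open_nbhs_nbhs; split=> //; exact: set_mem (valP x).
apply: filterS (filterI Nx nU) => y [Ny Uy].
by have := NB (set_elt Uy) Ny; rewrite /preimage /= -gE.
Qed.

(** Both maps are closed, hence quotient maps with the same fibres, and each factors continuously
    through the other. *)
Lemma homeo_compact_quot (X Y Z : topologicalType) (f : X -> Y) (g : X -> Z) :
  compact [set: X] -> hausdorff_space Y -> hausdorff_space Z ->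
  continuous f -> continuous g ->
  (forall y, exists x, f x = y) -> (forall z, exists x, g x = z) ->
  (forall x x', f x = f x' <-> g x = g x') ->
  exists h : Y -> Z, homeomorphism h.
Proof.
move=> cX hY hZ cf cg fs gs fg.
have [s sK] := choice fs; have [t tK] := choice gs.
exists (fun y => g (s y)); split.
  apply: (closed_map_descend (compact_closed_map cX hY cf) fs).
  rewrite (_ : (fun x => _) = g) //; apply/funext => x.
  by apply/fg; rewrite sK.
exists (fun z => f (t z)); split.
- apply: (closed_map_descend (compact_closed_map cX hZ cg) gs).
  rewrite (_ : (fun x => _) = f) //; apply/funext => x.
  by apply/fg; rewrite tK.
- by move=> y; rewrite -[RHS]sK; apply/fg; rewrite tK.
- by move=> z; rewrite -[RHS]tK; apply/fg; rewrite sK.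
Qed.

(** * Complex matrices *)

Lemma sum_cts (K : numFieldType) (X : topologicalType) (V : normedModType K) (I : finType)
    (f : I -> X -> V) :
  (forall i, continuous (f i)) -> continuous (fun x => \sum_i f i x).
Proof.
by move=> cf x; apply: cvg_big => [|i _]; [exact: add_continuous|exact: cf].
Qed.

Lemma sub_cts (K : numFieldType) (V : normedModType K) (X : topologicalType) (f g : X -> V) :
  continuous f -> continuous g -> continuous (fun x => f x - g x).
Proof. by move=> cf cg x; exact: cvgB (cf x) (cg x). Qed.

Lemma id_cts (X : topologicalType) : continuous (fun x : X => x).
Proof. by move=> x; exact: cvg_id. Qed.

Lemma const_cts (X Y : topologicalType) (y : Y) : continuous (fun _ : X => y).
Proof. by move=> x; exact: cvg_cst. Qed.

Lemma mx_entry_cts (K : numFieldType) (X : topologicalType) m n (f : X -> 'M[K]_(m, n)) i j :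
  continuous f -> continuous (fun x => f x i j).
Proof.
move=> cf.
exact: (@comp_cts _ _ _ f (fun A : 'M[K]_(m, n) => A i j) cf (@coord_continuous _ _ _ i j)).
Qed.

Lemma mulmx_cts (K : numFieldType) (X : topologicalType) m n p (f : X -> 'M[K]_(m, n)) (g : X -> 'M[K]_(n, p)) :
  continuous f -> continuous g -> continuous (fun x => f x *m g x).
Proof.
move=> cf cg; apply: mx_cts => i j.
rewrite (_ : (fun x => _) = fun x => \sum_k (f x i k * g x k j : K)).
  apply: (@sum_cts K X K^o 'I_n (fun k x => f x i k * g x k j)) => k x.
  by apply: cvgM; exact: mx_entry_cts.
by apply/funext => x; rewrite mxE.
Qed.

Section ComplexMatrices.
Variable R : realType.
Local Notation C := (Cplx R).

Local Notation Re := (@complex.Re R).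
Local Notation Im := (@complex.Im R).

Lemma Re_cts : continuous (Re : C -> R).
Proof.
move=> z; apply: cts_at => B /nbhs_ballP[e /= e0 eB].
have e0' : (0 : C) < e%:C%C by rewrite ltcR.
have : nbhs z (ball z (e%:C%C : C)) by apply/nbhs_ballP; exists (e%:C%C : C).
apply: filterS => w; rewrite -ball_normE /= => zw.
apply: eB; rewrite -ball_normE /= -ltcR; apply: le_lt_trans zw.
by rewrite -raddfB; exact: normc_ge_Re.
Qed.

Lemma Im_cts : continuous (Im : C -> R).
Proof.
move=> z; apply: cts_at => B /nbhs_ballP[e /= e0 eB].
have e0' : (0 : C) < e%:C%C by rewrite ltcR.
have : nbhs z (ball z (e%:C%C : C)) by apply/nbhs_ballP; exists (e%:C%C : C).
apply: filterS => w; rewrite -ball_normE /= => zw.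
apply: eB; rewrite -ball_normE /= -ltcR; apply: le_lt_trans zw.
rewrite -raddfB; case: (z - w) => a b /=; rewrite normc_def /= lecR.
by rewrite -sqrtr_sqr ler_sqrt ?addr_ge0 ?sqr_ge0// lerDr sqr_ge0.
Qed.

Lemma complex_cts (X : topologicalType) (f g : X -> R) :
  continuous f -> continuous g -> continuous (fun x => (f x +i* g x)%C : C).
Proof.
move=> cf cg x; apply: cts_at => B /nbhs_ballP[[e e'] /= e0 eB].
(* In the order of the complex numbers, a positive radius has zero imaginary part. *)
have [/eqP e'0 e00] : (e' == 0) /\ 0 < e by move: e0; rewrite ltcE /= => /andP[/eqP-> ?]; rewrite eqxx.
subst e'.
have e2 : 0 < e / 2 by rewrite divr_gt0.
have h1 : nbhs (f x) (ball (f x) (e / 2)) by apply/nbhs_ballP; exists (e / 2).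
have h2 : nbhs (g x) (ball (g x) (e / 2)) by apply/nbhs_ballP; exists (e / 2).
have h := nbhsI (nbhs_preim (cf x) h1) (nbhs_preim (cg x) h2).
apply: (filterS _ h) => y []; rewrite -!ball_normE /preimage /= => H1 H2.
apply: eB; rewrite -ball_normE /=.
have -> : (f x +i* g x)%C - (f y +i* g y)%C = (f x - f y)%:C%C + 'i%C * (g x - g y)%:C%C :> C.
  by simpc.
apply: le_lt_trans (ler_normD _ _) _.
rewrite normrM !normc_def /= !expr0n expr1n /= !addr0 add0r sqrtr1 mul1r !sqrtr_sqr.
by rewrite -[X in X < _]rmorphD /= ltcR [ltRHS](splitr e) ltrD.
Qed.

Lemma submx_cts (X : topologicalType) m n (f g : X -> 'M[C]_(m, n)) :
  continuous f -> continuous g -> continuous (fun x => f x - g x).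
Proof.
move=> cf cg; apply: mx_cts => i j.
rewrite (_ : (fun x => _) = fun x => f x i j - g x i j :> C^o).
  exact: (@sub_cts C C^o X _ _ (mx_entry_cts cf) (mx_entry_cts cg)).
by apply/funext => x; rewrite !mxE.
Qed.

(** The squared Frobenius norm: unlike the maximum norm that defines the topology of matrices, it is
    strictly convex. *)
Definition sqnorm m n (A : 'M[C]_(m, n)) : R :=
  \sum_i \sum_j (Re (A i j) ^+ 2 + Im (A i j) ^+ 2).

Lemma sqnorm_ge0 m n (A : 'M[C]_(m, n)) : 0 <= sqnorm A.
Proof. by do 2 (apply: sumr_ge0 => ? _); rewrite addr_ge0 ?sqr_ge0. Qed.

Lemma sqnorm_eq0 m n (A : 'M[C]_(m, n)) : sqnorm A = 0 -> A = 0.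
Proof.
move=> h; apply/matrixP => i j; rewrite mxE.
have h1 k : 0 <= \sum_l (Re (A k l) ^+ 2 + Im (A k l) ^+ 2).
  by apply: sumr_ge0 => ? _; rewrite addr_ge0 ?sqr_ge0.
have hi : \sum_l (Re (A i l) ^+ 2 + Im (A i l) ^+ 2) = 0.
  exact: (psumr_eq0P (fun k _ => h1 k) h isT).
have h2 l : 0 <= Re (A i l) ^+ 2 + Im (A i l) ^+ 2 by rewrite addr_ge0 ?sqr_ge0.
have /eqP : Re (A i j) ^+ 2 + Im (A i j) ^+ 2 = 0.
  exact: (psumr_eq0P (fun l _ => h2 l) hi isT).
rewrite paddr_eq0 ?sqr_ge0 // !sqrf_eq0; case: (A i j) => a b /= /andP[/eqP-> /eqP->].
by [].
Qed.

Lemma sqnorm0 m n : sqnorm (0 : 'M[C]_(m, n)) = 0.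
Proof. by rewrite /sqnorm big1 // => i _; rewrite big1 // => j _; rewrite !mxE /= expr0n addr0. Qed.

(** The negative last term is the quantitative form of strict convexity; uniqueness of centres comes
    from it. *)
Lemma sqnorm_conv m n (A B : 'M[C]_(m, n)) (t : R) :
  sqnorm ((1 - t)%:C%C *: A + t%:C%C *: B) =
  (1 - t) * sqnorm A + t * sqnorm B - t * (1 - t) * sqnorm (A - B).
Proof.
rewrite /sqnorm !mulr_sumr -sumrN -!big_split /=; apply: eq_bigr => i _.
rewrite !mulr_sumr -sumrN -!big_split /=; apply: eq_bigr => j _.
rewrite !mxE; case: (A i j) => a b; case: (B i j) => c d /=; ring.
Qed.

Lemma sqnorm_cts (X : topologicalType) m n (f : X -> 'M[C]_(m, n)) :
  continuous f -> continuous (fun x => sqnorm (f x)).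
Proof.
have sq (g : X -> R) : continuous g -> continuous (fun y => g y ^+ 2).
  by move=> cg y; under eq_fun do rewrite expr2; apply: cvgM; exact: cg.
move=> cf; apply: (@sum_cts R X R^o 'I_m) => i; apply: (@sum_cts R X R^o 'I_n) => j x.
have h1 := sq _ (comp_cts (mx_entry_cts (i := i) (j := j) cf) Re_cts).
have h2 := sq _ (comp_cts (mx_entry_cts (i := i) (j := j) cf) Im_cts).
exact: (cvgD (h1 x) (h2 x)).
Qed.

End ComplexMatrices.

(** * Minimizers of strictly quasi-convex functions *)

Section SupCompact.
Variables (R : realType) (Y Z : topologicalType) (phi : Y -> Z -> R) (z0 : Z).
Hypothesis cZ : compact [set: Z].
Hypothesis phic : continuous (fun q : Y * Z => phi q.1 q.2).

Definition supf (y : Y) : R := sup (range (phi y)).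

Lemma slice_cts (y : Y) : continuous (phi y).
Proof.
apply: (@comp_cts Z (Y * Z)%type R (fun z => (y, z))) phic.
by apply: pair_cts; [exact: const_cts|exact: id_cts].
Qed.

Lemma supfP y : exists2 z, supf y = phi y z & forall z', phi y z' <= phi y z.
Proof.
have [] := @compact_EVT_max Z R (phi y) setT _ cZ _; first by exists z0.
  by apply: continuous_subspaceT; exact: slice_cts.
move=> z _ zP; have zP' z' : phi y z' <= phi y z by apply: zP; rewrite in_setT.
exists z => //; apply/eqP; rewrite eq_le; apply/andP; split.
  by apply: ge_sup => [|_ [z' _ <-]] //; exists (phi y z); exists z.
by apply: ub_le_sup; [exists (phi y z) => _ [z' _ <-]|exists z].
Qed.

Lemma supf_ge y z : phi y z <= supf y.
Proof. by have [z1 ->] := supfP y. Qed.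

(** By the tube lemma [phi y'] is uniformly close to [phi y] for [y'] near [y]; comparison at the
    two maximizers then bounds the difference of the suprema. *)
Lemma supf_cts : continuous supf.
Proof.
move=> y; apply: cts_at => B /nbhs_ballP[e /= e0 eB].
have h : \forall y' \near y, forall z, setT z -> `|phi y z - phi y' z| < e.
  apply: (near_forall_compact (P := fun y' z => `|phi y z - phi y' z| < e)) => // z _.
  have dc : continuous (fun q : Y * Z => phi y q.2 - phi q.1 q.2).
    exact: (@sub_cts R R^o _ _ _ (comp_cts (@snd_cts Y Z) (@slice_cts y)) phic).
  have n0 : nbhs (phi y z - phi y z) [set x : R | `|x| < e].
    rewrite subrr; apply/nbhs_ballP; exists e => //= x.
    by rewrite -ball_normE /= sub0r normrN.
  exact: (nbhs_preim (dc (y, z)) n0).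
apply: (filterS _ h) => y' yy'; apply: eB; rewrite -ball_normE /=.
have [z1 -> h1] := supfP y; have [z2 -> h2] := supfP y'.
have := yy' z1 I; have := yy' z2 I; have := h1 z2; have := h2 z1.
by rewrite !ltr_norml => ? ? /andP[? ?] /andP[? ?]; apply/andP; split; lra.
Qed.

End SupCompact.

Section Minimizer.
Variables (R : realType) (P : topologicalType) (N : nat).
Local Notation V := 'rV[R]_N.
Variable Phi : P -> V -> R.
Hypothesis Phic : continuous (fun q : P * V => Phi q.1 q.2).
Hypothesis Phi_qconv : forall p u v t, u != v -> 0 < t < 1 ->
  Phi p ((1 - t) *: u + t *: v) < Num.max (Phi p u) (Phi p v).

Definition is_min p c := forall c', Phi p c <= Phi p c'.

Lemma is_min_lt p c c' : is_min p c -> c' != c -> Phi p c < Phi p c'.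
Proof.
move=> mc cc'; rewrite ltNge; apply/negP => h.
have h2 : 0 < (2^-1 : R) < 1 by apply/andP; split; lra.
have := Phi_qconv p cc' h2.
have -> : Num.max (Phi p c') (Phi p c) = Phi p c by apply/max_idPr.
by rewrite ltNge mc.
Qed.

Lemma is_min_uniq p c c' : is_min p c -> is_min p c' -> c = c'.
Proof.
move=> mc mc'; apply/eqP/negPn/negP => /(is_min_lt mc').
by rewrite ltNge mc.
Qed.

Lemma Phi_cts p : continuous (Phi p).
Proof.
apply: (@comp_cts V (P * V)%type R (fun z => (p, z))) Phic.
by apply: pair_cts; [exact: const_cts|exact: id_cts].
Qed.

Lemma dist_cts (c0 : V) : continuous (fun c : V => `|c - c0|).
Proof.
have h := @sub_cts R V V _ _ (@id_cts V) (@const_cts _ _ c0).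
by move=> c; exact: cvg_norm (h c).
Qed.

Lemma compact_dist (c0 : V) (A : set R) (e : R) :
  closed A -> (forall x, A x -> x <= e) -> compact [set c : V | A `|c - c0|].
Proof.
move=> cA Ae; apply: bounded_closed_compact; last exact: (closed_preim (@dist_cts c0) cA).
exists (e + `|c0|); split; first exact: num_real.
move=> x ex c /Ae h; apply: le_trans (ltW ex).
by rewrite -[c](subrK c0); apply: le_trans (ler_normD _ _) _; rewrite lerD2r.
Qed.

(** Existence of a minimizer at [p0] alone suffices. For [p] near [p0], [Phi p] is larger on the
    sphere of radius [e] about [c0] than at [c0]. By quasi-convexity no point outside the ball can
    then do better than [c0], so a minimizer over the compact ball is a global one. *)
Lemma is_min_near p0 c0 e : is_min p0 c0 -> 0 < e ->
  \forall p \near p0, exists2 c, is_min p c & `|c - c0| <= e.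
Proof.
move=> m0 e0; pose S := [set c : V | [set e] `|c - c0|].
have cS : compact S by apply: (compact_dist (e := e)) => [|x ->] //; exact: closed_eq.
have h : \forall p \near p0, forall c, S c -> Phi p c0 < Phi p c.
  apply: (near_forall_compact (P := fun p c => Phi p c0 < Phi p c)) => // c Sc.
  have dc : continuous (fun q : P * V => Phi q.1 q.2 - Phi q.1 c0).
    apply: (@sub_cts R R^o _ _ _ Phic).
    apply: (@comp_cts (P * V)%type (P * V)%type R (fun q => (q.1, c0))) Phic.
    by apply: pair_cts; [exact: fst_cts|exact: const_cts].
  have cc0 : c != c0.
    by apply/eqP => cc0; move: Sc e0; rewrite /S /= cc0 subrr normr0 => <-; rewrite ltxx.
  have pos : 0 < Phi p0 c - Phi p0 c0 by rewrite subr_gt0 is_min_lt.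
  have npos : nbhs (Phi p0 c - Phi p0 c0) [set x : R | 0 < x].
    by apply: open_nbhs_nbhs; split=> //; exact: open_gt.
  by apply: (filterS _ (nbhs_preim (dc (p0, c)) npos)) => q; rewrite /preimage /= subr_gt0.
apply: (filterS _ h) => p Sp.
pose B := [set c : V | [set x | x <= e] `|c - c0|].
have cB : compact B by apply: (compact_dist (e := e)) => //; exact: closed_le.
have Bc0 : B c0 by rewrite /B /= subrr normr0 ltW.
have [] := @compact_EVT_min _ R (Phi p) B _ cB _; first by exists c0.
  by apply: continuous_subspaceT; exact: Phi_cts.
move=> c /set_mem Bc cmin; exists c => // c'.
have [c'B|c'B] := leP `|c' - c0| e; first by apply: cmin; rewrite inE.
apply: le_trans (cmin _ (mem_set Bc0)) _.
have d0 : 0 < `|c' - c0| := lt_trans e0 c'B.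
(* With this [t], the convex combination [s] of [c0] and [c'] lies on the sphere [S]. *)
pose t := e / `|c' - c0|.
have t01 : 0 < t < 1 by rewrite /t divr_gt0 //= ltr_pdivrMr // mul1r.
have c0c' : c0 != c' by apply: contraTneq d0 => ->; rewrite subrr normr0 ltxx.
have := Phi_qconv p c0c' t01; set s := _ + _ => hs.
have : S s.
  rewrite /S /= /s (_ : _ - c0 = t *: (c' - c0)).
    by rewrite normrZ /t normf_div normr_id divfK ?gt_eqF // gtr0_norm.
  by rewrite scalerBl scale1r scalerBr addrAC [c0 - _ - _]addrAC subrr sub0r addrC.
move=> /Sp hs'; rewrite leNgt; apply/negP => hc.
by move: (lt_trans hs' hs); rewrite max_l ?ltxx // ltW.
Qed.

(** A minimizer is only known to exist near a parameter that has one; elsewhere the value may be the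
    default 0. *)
Definition min_sel p : V := xget 0 (is_min p).

Lemma min_selP p c : is_min p c -> min_sel p = c.
Proof.
by move=> mc; rewrite /min_sel; case: xgetP => [c' -> /is_min_uniq /(_ mc)|/(_ c)].
Qed.

Lemma min_sel_near p0 c0 : is_min p0 c0 -> \forall p \near p0, is_min p (min_sel p).
Proof.
move=> m0; have := is_min_near m0 ltr01.
by apply: filterS => p [c mc _]; rewrite (min_selP mc).
Qed.

Lemma min_sel_cts p0 c0 : is_min p0 c0 -> {for p0, continuous min_sel}.
Proof.
move=> m0; apply: cts_at => B /nbhs_ballP[e /= e0 eB].
have e2 : 0 < e / 2 by rewrite divr_gt0.
have h := is_min_near m0 e2.
apply: (filterS _ h) => p [c mc ce]; apply: eB; rewrite -ball_normE /=.
rewrite (min_selP m0) (min_selP mc) distrC; apply: le_lt_trans ce _.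
by rewrite ltr_pdivrMr // mulr_natr mulr2n ltrDl.
Qed.

End Minimizer.

Lemma conv_lt_max (R : realType) (a b x y t d : R) :
  0 < t -> 0 < 1 - t -> 0 < d -> a <= x -> b <= y ->
  (1 - t) * a + t * b - t * (1 - t) * d < Num.max x y.
Proof.
move=> t0 t1 d0 ax byy; set M := Num.max x y.
have aM : (1 - t) * a <= (1 - t) * M by rewrite ler_pM2l // le_max ax.
have bM : t * b <= t * M by rewrite ler_pM2l // le_max byy orbT.
by have := mulr_gt0 (mulr_gt0 t0 t1) d0; lra.
Qed.

(** * Centres of orbits of matrices *)

Section RealCoordinates.
Variables (R : realType) (n : nat).
Local Notation C := (Cplx R).
Local Notation V := 'rV[R]_(n * n + n * n).

(** The minimization takes place in a real coordinate space, whose closed bounded sets are compact;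
    these coordinates carry it over to complex matrices. *)
Definition cmx_of_rV (v : V) : 'M[C]_n :=
  \matrix_(i, j) (v 0 (lshift _ (mxvec_index i j)) +i* v 0 (rshift _ (mxvec_index i j)))%C.

Definition rV_of_cmx (A : 'M[C]_n) : V :=
  row_mx (mxvec (map_mx (@complex.Re R) A)) (mxvec (map_mx (@complex.Im R) A)).

Lemma rV_of_cmxK : cancel rV_of_cmx cmx_of_rV.
Proof.
move=> A; apply/matrixP => i j; rewrite mxE row_mxEl row_mxEr !mxvecE !mxE.
by case: (A i j).
Qed.

Lemma cmx_of_rVK : cancel cmx_of_rV rV_of_cmx.
Proof.
move=> v; apply/rowP => k; case: (split_ordP k) => l ->.
  by rewrite row_mxEl; case/mxvec_indexP: l => i j; rewrite mxvecE !mxE.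
by rewrite row_mxEr; case/mxvec_indexP: l => i j; rewrite mxvecE !mxE.
Qed.

Lemma cmx_of_rV_conv u v (t : R) :
  cmx_of_rV ((1 - t) *: u + t *: v) =
  (1 - t)%:C%C *: cmx_of_rV u + t%:C%C *: cmx_of_rV v.
Proof.
apply/matrixP => i j; rewrite !mxE; apply/eqP; rewrite eq_complex /=.
by rewrite !mul0r !subr0 !addr0 !eqxx.
Qed.

Lemma cmx_of_rV_cts : continuous cmx_of_rV.
Proof.
apply: mx_cts => i j; under [X in continuous X]eq_fun do rewrite mxE.
by apply: complex_cts; exact: coord_continuous.
Qed.

End RealCoordinates.

Section Center.
Variables (R : realType) (P Z : topologicalType) (z0 : Z) (n : nat).
Local Notation C := (Cplx R).
Local Notation V := 'rV[R]_(n * n + n * n).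
Variables T b : P -> Z -> 'M[C]_n.
Hypothesis cZ : compact [set: Z].
Hypothesis Tc : continuous (fun q : P * Z => T q.1 q.2).
Hypothesis bc : continuous (fun q : P * Z => b q.1 q.2).
Hypothesis Tu : forall p z, T p z \in unitmx.

(* In [equivariant_extension], where [z = (h, k)], [T p z] is the action of [k] and
   [b p z] that of [k h] on [f (p h)], so [crad p A] is the squared distance from [A]
   to the farthest point of a kernel orbit, in a kernel-invariant norm. *)
Definition crad (p : P) (A : 'M[C]_n) : R :=
  sup (range (fun z => sqnorm (T p z *m A - b p z))).

Let phi (q : P * V) (z : Z) : R := sqnorm (T q.1 z *m cmx_of_rV q.2 - b q.1 z).

Let Phi (p : P) (v : V) : R := supf phi (p, v).

Let phic : continuous (fun q : (P * V) * Z => phi q.1 q.2).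
Proof.
apply: sqnorm_cts; apply: submx_cts.
  apply: mulmx_cts.
    apply: (@comp_cts ((P * V) * Z)%type (P * Z)%type _ (fun q => (q.1.1, q.2))) Tc.
    by apply: pair_cts; [exact: (comp_cts (@fst_cts _ _) (@fst_cts _ _))|exact: snd_cts].
  exact: (comp_cts (comp_cts (@fst_cts (P * V)%type Z) (@snd_cts P V)) (@cmx_of_rV_cts R n)).
apply: (@comp_cts ((P * V) * Z)%type (P * Z)%type _ (fun q => (q.1.1, q.2))) bc.
by apply: pair_cts; [exact: (comp_cts (@fst_cts _ _) (@fst_cts _ _))|exact: snd_cts].
Qed.

Let Phic : continuous (fun q : P * V => Phi q.1 q.2).
Proof.
rewrite (_ : (fun q => _) = supf phi); first exact: (@supf_cts R _ _ phi z0 cZ phic).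
by apply/funext => -[p v].
Qed.

(** The supremum at the intermediate point is attained at some [z]. Since [T p z] is invertible, the
    two differences measured there are distinct, and the defect in [sqnorm_conv] is positive. *)
Let Phi_qconv p u v t : u != v -> 0 < t < 1 ->
  Phi p ((1 - t) *: u + t *: v) < Num.max (Phi p u) (Phi p v).
Proof.
move=> uv /andP[t0 t1]; have t1' : 0 < 1 - t by rewrite subr_gt0.
have [z E _] := @supfP R _ _ phi z0 cZ phic (p, (1 - t) *: u + t *: v).
have -> : Phi p ((1 - t) *: u + t *: v) =
  sqnorm (T p z *m cmx_of_rV ((1 - t) *: u + t *: v) - b p z) := E.
rewrite cmx_of_rV_conv.
have -> : T p z *m ((1 - t)%:C%C *: cmx_of_rV u + t%:C%C *: cmx_of_rV v) - b p z =
    (1 - t)%:C%C *: (T p z *m cmx_of_rV u - b p z) +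
    t%:C%C *: (T p z *m cmx_of_rV v - b p z).
  rewrite mulmxDr -!scalemxAr !scalerBr addrACA; congr (_ + _).
  by rewrite -opprD -scalerDl -rmorphD /= subrK scale1r.
rewrite sqnorm_conv.
have hu : sqnorm (T p z *m cmx_of_rV u - b p z) <= Phi p u.
  exact: (@supf_ge R _ _ phi z0 cZ phic (p, u) z).
have hv : sqnorm (T p z *m cmx_of_rV v - b p z) <= Phi p v.
  exact: (@supf_ge R _ _ phi z0 cZ phic (p, v) z).
have pos : 0 < sqnorm ((T p z *m cmx_of_rV u - b p z) - (T p z *m cmx_of_rV v - b p z)).
  rewrite lt_def sqnorm_ge0 andbT; apply/eqP => /sqnorm_eq0 /eqP.
  rewrite opprB addrA subrK -mulmxBr => /eqP h; move: uv.
  have /eqP : cmx_of_rV u - cmx_of_rV v = 0 by rewrite -[LHS](mulKmx (Tu p z)) h mulmx0.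
  by rewrite subr_eq0 => /eqP /(can_inj (@cmx_of_rVK R n)) ->; rewrite eqxx.
exact: conv_lt_max.
Qed.

Let PhiE p A : Phi p (rV_of_cmx A) = crad p A.
Proof. by rewrite /Phi /supf /phi /= rV_of_cmxK. Qed.

Let PhiE' p v : Phi p v = crad p (cmx_of_rV v).
Proof. by rewrite -PhiE cmx_of_rVK. Qed.

Definition is_center p A := forall A', crad p A <= crad p A'.

Let is_centerE p A : is_center p A <-> is_min Phi p (rV_of_cmx A).
Proof. by split=> h A'; [rewrite PhiE PhiE'|rewrite -!PhiE]. Qed.

Definition mx_center (p : P) : 'M[C]_n := cmx_of_rV (min_sel Phi p).

Lemma centerP p A : is_center p A -> mx_center p = A.
Proof. by move/is_centerE => h; rewrite /mx_center (min_selP Phi_qconv h) rV_of_cmxK. Qed.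

Lemma center_near p A : is_center p A -> \forall p' \near p, is_center p' (mx_center p').
Proof.
move=> /is_centerE h; apply: (filterS _ (min_sel_near Phic Phi_qconv h)) => p' h'.
by apply/is_centerE; rewrite cmx_of_rVK.
Qed.

Lemma center_cts p A : is_center p A -> {for p, continuous mx_center}.
Proof.
move=> /is_centerE h.
exact: (continuous_comp (min_sel_cts Phic Phi_qconv h) (@cmx_of_rV_cts R n _)).
Qed.

(** Radius zero: this provides the first centre, from which [center_near] and [center_cts] start. *)
Lemma is_center_exact p A : (forall z, T p z *m A = b p z) -> is_center p A.
Proof.
move=> TA A'; have [z E _] := @supfP R _ _ phi z0 cZ phic (p, rV_of_cmx A').
have -> : crad p A' = phi (p, rV_of_cmx A') z by rewrite -PhiE; exact: E.
have -> : crad p A = 0; last exact: sqnorm_ge0.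
rewrite /crad; have -> : range (fun z => sqnorm (T p z *m A - b p z)) = [set 0]; last exact: sup1.
apply/seteqP; split=> [_ [z' _ <-]|_ ->]; first by rewrite /= TA subrr sqnorm0.
by exists z => //; rewrite TA subrr sqnorm0.
Qed.

End Center.

(** Equivariance of centres comes from reindexing the supremum; [s'] only serves to make [s]
    surjective. *)
Lemma crad_reparam (R : realType) (P Z : topologicalType) n (T b : P -> Z -> 'M[Cplx R]_n)
    (s s' : Z -> Z) p p' A A' :
  cancel s' s -> (forall z, T p' z *m A' - b p' z = T p (s z) *m A - b p (s z)) ->
  crad T b p' A' = crad T b p A.
Proof.
move=> sK h; congr (sup _); apply/seteqP; split=> _ [z _ <-].
  by exists (s z) => //; rewrite h.
by exists (s' z) => //; rewrite h sK.
Qed.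

(** * Continuity of the matrix inverse *)

Section MatrixInverse.
Variable R : realType.
Local Notation C := (Cplx R).

Lemma prod_cts (X : topologicalType) (I : finType) (f : I -> X -> C) :
  (forall i, continuous (f i)) -> continuous (fun x => \prod_i f i x).
Proof.
by move=> cf x; apply: cvg_big => [|i _]; [exact: mul_continuous|exact: cf].
Qed.

Lemma mulC_cts (X : topologicalType) (f g : X -> C) :
  continuous f -> continuous g -> continuous (fun x => f x * g x).
Proof. by move=> cf cg x; exact: cvgM (cf x) (cg x). Qed.

Lemma det_cts (X : topologicalType) n (f : X -> 'M[C]_n) :
  continuous f -> continuous (fun x => \det (f x)).
Proof.
move=> cf.
apply: (@sum_cts C X C^o _ (fun (s : {perm 'I_n}) x => (-1) ^+ s * \prod_i f x i (s i) : C)) => s.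
apply: mulC_cts; first exact: const_cts.
apply: (@prod_cts X _ (fun i x => f x i (s i))) => i.
exact: mx_entry_cts.
Qed.

Lemma adj_cts (X : topologicalType) n (f : X -> 'M[C]_n) :
  continuous f -> continuous (fun x => \adj (f x)).
Proof.
move=> cf; apply: mx_cts => i j; under [X in continuous X]eq_fun do rewrite mxE /cofactor.
apply: mulC_cts; first exact: const_cts.
apply: det_cts; apply: mx_cts => k l; under [X in continuous X]eq_fun do rewrite !mxE.
exact: mx_entry_cts.
Qed.

(** The adjugate formula without the case distinction of [invmx]: its continuity at an invertible
    matrix follows from that of determinant and adjugate. *)
Definition minv n (A : 'M[C]_n) : 'M[C]_n := (\det A)^-1 *: \adj A.

Lemma mul_minv_mx n (A : 'M[C]_n) : A \in unitmx -> minv A *m A = 1%:M.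
Proof.
rewrite unitmxE unitfE => dA.
by rewrite /minv -scalemxAl mul_adj_mx scale_scalar_mx mulVf.
Qed.

Lemma mul_mx_minv n (A : 'M[C]_n) : A \in unitmx -> A *m minv A = 1%:M.
Proof.
rewrite unitmxE unitfE => dA.
by rewrite /minv -scalemxAr mul_mx_adj scale_scalar_mx mulVf.
Qed.

Lemma mulmx_at (X : topologicalType) m n p (f : X -> 'M[C]_(m, n)) (g : X -> 'M[C]_(n, p)) x :
  {for x, continuous f} -> {for x, continuous g} ->
  {for x, continuous (fun x => f x *m g x)}.
Proof.
move=> cf cg.
have h := @mulmx_cts C ('M[C]_(m, n) * 'M[C]_(n, p))%type m n p fst snd
  (@fst_cts _ _) (@snd_cts _ _).
exact: (@continuous_comp _ _ _ (fun x => (f x, g x)) (fun q => q.1 *m q.2) x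
  (cvg_pair cf cg) (h _)).
Qed.

Lemma minv_cts n (A : 'M[C]_n) : A \in unitmx -> {for A, continuous (@minv n)}.
Proof.
rewrite unitmxE unitfE => dA.
have h : {for A, continuous (fun A : 'M[C]_n => (\det A)^-1)}.
  by apply: continuousV => //; exact: (det_cts (@id_cts _)).
have -> : @minv n = fun A => (\det A)^-1%:M *m \adj A.
  by apply/funext => B; rewrite mul_scalar_mx.
apply: mulmx_at; last exact: (adj_cts (@id_cts _)).
apply: (continuous_comp h).
apply: mx_cts => i j; under [X in continuous X]eq_fun do rewrite mxE.
case: (i == j); last exact: const_cts.
by under [X in continuous X]eq_fun do rewrite mulr1n; exact: id_cts.
Qed.

Lemma unitmx_near n (A : 'M[C]_n) : A \in unitmx -> \forall B \near A, B \in unitmx.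
Proof.
rewrite unitmxE unitfE => dA.
have c0 : closed [set (0 : C)].
  by apply: compact_closed; [exact: (@norm_hausdorff C C^o)|exact: compact_set1].
have : nbhs (\det A) (~` [set (0 : C)]).
  by apply: open_nbhs_nbhs; split; [exact: closed_openC|apply/eqP].
move=> /(nbhs_preim (@det_cts _ n id (@id_cts _) A)) h.
apply: (filterS _ h) => B /eqP; rewrite unitmxE unitfE; exact.
Qed.

End MatrixInverse.

(** * Tietze extension of matrix-valued maps *)

Section TietzeMatrix.
Variables (R : realType) (X : topologicalType) (A : set X).
Local Notation C := (Cplx R).
Hypothesis cX : compact [set: X].
Hypothesis hX : hausdorff_space X.
Hypothesis clA : closed A.

Lemma tietze_real (r : A -> R) : continuous r ->
  exists2 f : X -> R, continuous f & forall a : A, f (\val a) = r a.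
Proof.
move=> cr; pose g (x : X) : R := if pselect (A x) is left Ax then r (set_elt Ax) else 0.
have gE (a : A) : g (\val a) = r a.
  rewrite /g; case: pselect => [Aa|]; last by case; exact: set_mem (valP a).
  by congr r; apply: val_inj.
have cA : compact A := subclosed_compact clA cX (@subsetT _ _).
have cg : {within A, continuous g}.
  apply/subspace_sigL_continuousP.
  by rewrite (_ : sigL A g = r) //; apply/funext => a; exact: gE.
have [M [Mr hM]] := compact_bounded (continuous_compact cg cA).
(* [hM] gives a bound for each number above [M]; [|M| + 1] is one of them, and it is positive. *)
have gM x : A x -> `|g x| <= `|M| + 1.
  move=> Ax; apply: (hM (`|M| + 1)); last by exists x.
  by rewrite (le_lt_trans (ler_norm M)) // ltrDl.
have M0 : 0 < `|M| + 1 by rewrite ltr_wpDl.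
have [f [fg cf _]] := continuous_bounded_extension (compact_normal hX cX) clA M0 cg gM.
exists f => // a; rewrite -fg ?gE //; exact: valP.
Qed.

Lemma tietze_mx n (r : A -> 'M[C]_n) : continuous r ->
  exists2 f : X -> 'M[C]_n, continuous f & forall a : A, f (\val a) = r a.
Proof.
move=> cr.
have hr (q : 'I_n * 'I_n) := tietze_real (comp_cts (mx_entry_cts (i := q.1) (j := q.2) cr) (@Re_cts R)).
have hi (q : 'I_n * 'I_n) := tietze_real (comp_cts (mx_entry_cts (i := q.1) (j := q.2) cr) (@Im_cts R)).
have [fr frP] := choice (fun q => (exists2P _ _).1 (hr q)).
have [fi fiP] := choice (fun q => (exists2P _ _).1 (hi q)).
exists (fun x => \matrix_(i, j) (fr (i, j) x +i* fi (i, j) x)%C).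
  apply: mx_cts => i j; under [X in continuous X]eq_fun do rewrite mxE.
  by apply: complex_cts; [exact: (frP _).1|exact: (fiP _).1].
move=> a; apply/matrixP => i j; rewrite mxE (frP (i, j)).2 (fiP (i, j)).2 /=.
by case: (r a i j).
Qed.

End TietzeMatrix.

(** * Local frames of equivariant bundles *)

Section TotalTrivialization.
Variables (R : realType) (G : topGroupType) (M : topologicalType).
Variables (rho : gaction G M) (K : subgrp G) (X : set M).
Local Notation C := (Cplx R).
Variable E : vbundle R rho K X.

(* A local trivialization over [U], as a pair of total maps [t], [t'] of which
   only the values over [U] matter. *)
Definition frame_on (U : set X) n (t : X -> 'cV[C]_n -> tot E) (t' : tot E -> 'cV[C]_n) :=
  [/\ forall x, U x -> exists2 l : 'cV[C]_n -> fib E x,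
        linear l & forall w, t x w = fib_in (l w),
      forall x w, U x -> {for (x, w), continuous (fun q => t q.1 q.2)},
      forall e, U (proj e) -> {for e, continuous t'},
      forall x w, U x -> t' (t x w) = w &
      forall e, U (proj e) -> t (proj e) (t' e) = e].

Lemma frame_at (x0 : X) : exists (U : set X) n t t', 
  [/\ open U, U x0 & @frame_on U n t t'].
Proof.
have [U [n [phi [oU Ux [[phc [phi' [phc' phK phK']]] phl]]]]] := loc_triv E x0.
have phP (y : U) w : proj (\val (phi (y, w))) = \val y.
  by have [l [_ ->]] := phl y; rewrite proj_in.
pose t (x : X) (w : 'cV[C]_n) : tot E :=
  if pselect (U x) is left Ux then \val (phi (set_elt Ux, w)) else fib_in (0 : fib E x).
pose t' (e : tot E) : 'cV[C]_n :=
  if pselect (((@proj _ _ _ _ _ _ E) @^-1` U) e) is left Ue then (phi' (set_elt Ue)).2 else 0.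
have tE (y : U) w : t (\val y) w = \val (phi (y, w)).
  rewrite /t; case: pselect => [Uy|]; last by case; exact: set_mem (valP y).
  by congr (\val (phi (_, w))); apply: val_inj.
have t'E e : t' (\val e) = (phi' e).2.
  rewrite /t'; case: pselect => [Uy|]; last by case; exact: set_mem (valP e).
  by congr (phi' _).2; apply: val_inj.
have oV : open ((@proj _ _ _ _ _ _ E) @^-1` U).
  exact: (open_preim (@proj_cts _ _ _ _ _ _ E) oU).
exists U, n, t, t'; split=> //; split.
- move=> x Ux'; have [l [ll lE]] := phl (set_elt Ux').
  by exists l => // w; rewrite -lE -tE.
- move=> x w Ux'.
  pose j (q : U * 'cV[C]_n) := (\val q.1, q.2).
  have jo : open_map j.
    exact: (@open_map_prod _ _ _ _ (\val : U -> X) (@id 'cV[C]_n) (open_map_val oU) (@open_map_id _)).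
  apply: (@open_map_descend _ _ _ j (fun q => t q.1 q.2) (set_elt Ux', w) jo).
  rewrite (_ : (fun q => _) = fun q => \val (phi q)).
    exact: (comp_cts phc (@continuous_set_val _ _)).
  by apply/funext => -[y v]; rewrite -tE.
- move=> e Ue.
  apply: (@open_ext_cts _ _ _ (fun e => (phi' e).2) t' (set_elt (Ue : (_ @^-1` U) e)) oV).
    exact: (comp_cts phc' (@snd_cts _ _)).
  exact: t'E.
- by move=> x w Ux'; rewrite -[x]/(\val (set_elt Ux')) tE t'E phK.
- move=> e Ue; pose e' := set_elt (Ue : (_ @^-1` U) e).
  rewrite -[e]/(\val e') t'E.
  have -> : proj (\val e') = \val (phi' e').1.
    by rewrite -(phP _ (phi' e').2) -surjective_pairing phK'.
  by rewrite tE -surjective_pairing phK'.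
Qed.

Lemma frame_proj (U : set X) n t t' : @frame_on U n t t' ->
  forall x w, U x -> proj (t x w) = x.
Proof. by move=> [h _ _ _ _] x w /h[l _ ->]; rewrite proj_in. Qed.

End TotalTrivialization.

(** * Subgroups and the kernel of the action *)

Section SubgroupInverse.
Variables (G : topGroupType) (K : subgrp G).

Definition sg_inv (g : K) : K := set_elt (subgrpV (sgP g)).

Lemma sg_mulA (g h k : K) : sg_mul g (sg_mul h k) = sg_mul (sg_mul g h) k.
Proof. by apply: val_inj; rewrite /= mulgA. Qed.

Lemma sg_mulV (g : K) : sg_mul g (sg_inv g) = sg_one K.
Proof. by apply: val_inj; rewrite /= mulgV. Qed.

Lemma sg_Vmul (g : K) : sg_mul (sg_inv g) g = sg_one K.
Proof. by apply: val_inj; rewrite /= mulVg. Qed.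

Lemma mulg_cts (X : topologicalType) (f g : X -> G) :
  continuous f -> continuous g -> continuous (fun x => f x * g x)%g.
Proof.
move=> cf cg; exact: (@comp_cts X (G * G)%type G _ (fun p => p.1 * p.2)%g (pair_cts cf cg) (@mulg_continuous G)).
Qed.

Lemma invg_cts (X : topologicalType) (f : X -> G) :
  continuous f -> continuous (fun x => (f x)^-1)%g.
Proof. by move=> cf; exact: (comp_cts cf (@invg_continuous G)). Qed.

Lemma sg_mul_cts (X : topologicalType) (f g : X -> K) :
  continuous f -> continuous g -> continuous (fun x => sg_mul (f x) (g x)).
Proof.
move=> cf cg; apply: continuous_to_set_type.
by apply: mulg_cts; [exact: (comp_cts cf (@continuous_set_val _ _))|exact: (comp_cts cg (@continuous_set_val _ _))].
Qed.

Lemma sg_inv_cts (X : topologicalType) (f : X -> K) :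
  continuous f -> continuous (fun x => sg_inv (f x)).
Proof.
move=> cf; apply: continuous_to_set_type.
by apply: invg_cts; exact: (comp_cts cf (@continuous_set_val _ _)).
Qed.

End SubgroupInverse.

Section Kernel.
Variables (G : topGroupType) (M : topologicalType) (rho : gaction G M).

Lemma gker1 : gker rho 1%g.
Proof. by move=> x; rewrite gact1. Qed.

Lemma gkerM g h : gker rho g -> gker rho h -> gker rho (g * h)%g.
Proof. by move=> kg kh x; rewrite gactM kh kg. Qed.

Lemma gkerV g : gker rho g -> gker rho (g^-1)%g.
Proof. by move=> kg x; rewrite -{1}(kg x) gactK. Qed.

Definition gker_subgrp : subgrp G := Subgrp gker1 gkerM gkerV.

Lemma gact_cts2 (X : topologicalType) (f : X -> G) (g : X -> M) :
  continuous f -> continuous g -> continuous (fun x => rho (f x) (g x)).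
Proof.
move=> cf cg; exact: (@comp_cts X (G * M)%type M _ (fun p => rho p.1 p.2) (pair_cts cf cg) (@gact_cts _ _ rho)).
Qed.

Lemma gker_closed : hausdorff_space M -> closed (gker rho).
Proof.
move=> hM; rewrite (_ : gker rho = \bigcap_x [set g | rho g x = x]).
  apply: closed_bigI => x _; apply: closed_eq_fun => //; last exact: const_cts.
  by apply: gact_cts2; [exact: id_cts|exact: const_cts].
by apply/seteqP; split=> [g h x _|g h x]; exact: h.
Qed.

End Kernel.

Section LocalFrame.
Variables (R : realType) (G : topGroupType) (M : topologicalType).
Variables (rho : gaction G M) (K : subgrp G) (X : set M).
Local Notation C := (Cplx R).
Variable E : vbundle R rho K X.
Hypothesis HK : gker rho `<=` subgrp_set K.
Local Notation H := (gker_subgrp rho).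

Definition ker_elt (h : H) : K := set_elt (HK (sgP h)).

Section KernelMatrix.
Variables (U : set X) (n : nat) (t : X -> 'cV[C]_n -> tot E) (t' : tot E -> 'cV[C]_n).
Hypothesis oU : open U.
Hypothesis fr : frame_on U t t'.

(** The kernel fixes every base point, hence acts on each fibre; this is its representation over
    [x], read in the frame. *)
Definition ker_mx (x : X) (h : H) : 'M[C]_n :=
  \matrix_(i, j) t' (vact (ker_elt h) (t x (delta_mx j 0))) i 0.

Lemma ker_proj h (e : tot E) : proj (vact (ker_elt h) e) = proj e.
Proof. by apply: val_inj; rewrite vact_proj; exact: (sgP h). Qed.

Lemma frame_inj x w w' : U x -> t x w = t x w' -> w = w'.
Proof. by have [_ _ _ tK _] := fr => Ux /(congr1 t'); rewrite !tK. Qed.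

Lemma ker_mxE x h w : U x -> vact (ker_elt h) (t x w) = t x (ker_mx x h *m w).
Proof.
have [tl _ _ tK t'K] := fr => Ux; have [l ll lE] := tl x Ux.
have xx : \val x = rho (\val (ker_elt h)) (\val x) by rewrite (sgP h).
have [a [al aE]] := vact_lin E xx.
pose L w := t' (vact (ker_elt h) (t x w)).
have LE v : t x (L v) = vact (ker_elt h) (t x v).
  have px : proj (vact (ker_elt h) (t x v)) = x by rewrite ker_proj (frame_proj fr).
  by rewrite -[in LHS]px t'K // px.
have mL v : l (L v) = a (l v).
  by apply: fib_in_inj; rewrite -lE LE lE aE.
have Ll : linear L.
  move=> c u v; apply: (frame_inj Ux); rewrite !lE; congr fib_in.
  by rewrite mL ll al ll !mL.
rewrite -LE; congr (t x _).
pose Lm : {linear 'cV[C]_n -> 'cV[C]_n} := HB.pack L (GRing.isLinear.Build _ _ _ _ L Ll).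
have -> : L w = Lm w by [].
rewrite {1}(matrix_sum_delta w) linear_sum; apply/colP => i.
rewrite summxE mxE; apply: eq_bigr => j _.
rewrite big_ord1 linearZ !mxE mulrC; congr (_ * _); exact: mulrC.
Qed.

Lemma mulmx_eq (A B : 'M[C]_n) : (forall w : 'cV[C]_n, A *m w = B *m w) -> A = B.
Proof.
by move=> AB; apply/matrixP => i j; have := AB (delta_mx j 0); rewrite -!colE => /colP/(_ i); rewrite !mxE.
Qed.

Lemma ker_mxM x h k : U x -> ker_mx x (sg_mul h k) = ker_mx x h *m ker_mx x k.
Proof.
move=> Ux; apply: mulmx_eq => w; apply: (frame_inj Ux).
rewrite -mulmxA -!ker_mxE // -vactM; congr (vact _ _); exact: val_inj.
Qed.

Lemma ker_mx1 x : U x -> ker_mx x (sg_one H) = 1%:M.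
Proof.
move=> Ux; apply: mulmx_eq => w; apply: (frame_inj Ux).
rewrite -ker_mxE // mul1mx -[RHS]vact1; congr (vact _ _); exact: val_inj.
Qed.

Lemma ker_elt_cts : continuous ker_elt.
Proof. by apply: continuous_to_set_type; exact: continuous_set_val. Qed.

Lemma vact_cts2 (Y : topologicalType) (f : Y -> K) (g : Y -> tot E) :
  continuous f -> continuous g -> continuous (fun y => vact (f y) (g y)).
Proof.
move=> cf cg; exact: (@comp_cts Y (K * tot E)%type (tot E) _ (fun p => vact p.1 p.2) (pair_cts cf cg) (@vact_cts _ _ _ _ _ _ E)).
Qed.

Lemma ker_mx_cts : continuous (fun q : U * H => ker_mx (\val q.1) q.2).
Proof.
have [_ tc t'c tK t'K] := fr.
apply: mx_cts => i j; under [X in continuous X]eq_fun do rewrite mxE.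
have c1 : continuous (fun q : U * H => t (\val q.1) (delta_mx j 0)).
  move=> q; have Ux := set_mem (valP q.1).
  have h : {for q, continuous (fun q : U * H => (\val q.1, delta_mx j 0 : 'cV[C]_n))}.
    by apply: pair_cts; [exact: (comp_cts (@fst_cts _ _) (@continuous_set_val _ _))|exact: const_cts].
  exact: (continuous_comp h (tc _ _ Ux)).
have c2 := vact_cts2 (comp_cts (@snd_cts U H) ker_elt_cts) c1.
move=> q; have Ux := set_mem (valP q.1).
have Ue : U (proj (vact (ker_elt q.2) (t (\val q.1) (delta_mx j 0)))).
  by rewrite ker_proj (frame_proj fr).
have h := continuous_comp (c2 q) (t'c _ Ue).
exact: (continuous_comp h (@coord_continuous _ _ _ i 0 _)).
Qed.

End KernelMatrix.

End LocalFrame.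

(** * Equivariant extension of the kernel representation *)

Section EquivariantExtension.
Variables (R : realType) (G : topGroupType) (M : topologicalType) (rho : gaction G M).
Local Notation C := (Cplx R).
Local Notation H := (gker_subgrp rho).
Hypothesis cG : compact [set: G].
Hypothesis hG : hausdorff_space G.
Hypothesis hM : hausdorff_space M.

Lemma compact_kernel_pairs : compact [set: H * H].
Proof.
have cH : compact [set: H].
  apply: compact_sub; exact: (subclosed_compact (gker_closed (rho := rho) hM) cG (@subsetT _ _)).
by rewrite -setXTT; apply: compact_setX.
Qed.

Variables (U : topologicalType) (n : nat) (km : U -> H -> 'M[C]_n).
Hypothesis kmM : forall x h k, km x (sg_mul h k) = km x h *m km x k.
Hypothesis km1 : forall x, km x (sg_one H) = 1%:M.
Hypothesis kmc : continuous (fun q : U * H => km q.1 q.2).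

Lemma km_unit x h : km x h \in unitmx.
Proof.
suff /mulmx1_unit[] : km x h *m km x (sg_inv h) = 1%:M by [].
by rewrite -kmM // sg_mulV km1.
Qed.

(** The representation [km y] varies with the base point [y]. Only the one at [y0] is extended to
    [G]; orbits and invariant norms are formed with [km y] for all [y], which makes the centre
    equivariant at every nearby point. *)
Lemma equivariant_extension (g0 : G) (y0 : U) :
  exists2 F : G * U -> 'M[C]_n,
    \forall p \near (g0, y0), {for p, continuous F} /\ F p \in unitmx &
    \forall p \near (g0, y0), forall (h : H) g, p.1 = (g * \val h)%g ->
      F (g, p.2) = km p.2 h *m F p.
Proof.
have cH : closed (gker rho) := gker_closed hM.
have rc : continuous (fun h : H => km y0 (sg_inv h)).
  apply: (@comp_cts H (U * H)%type _ (fun h => (y0, sg_inv h)) _ _ kmc).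
  by apply: pair_cts; [exact: const_cts|apply: sg_inv_cts; exact: id_cts].
(* If [F (g0, y0)] is to be 1, then equivariance forces [F (g0 * h, y0)] to be the matrix of the
   inverse of [h]. *)
have [f fc fE] := tietze_mx cG hG cH rc.
pose T (p : G * U) (z : H * H) := km p.2 z.2.
pose b (p : G * U) (z : H * H) :=
  km p.2 (sg_mul z.2 z.1) *m f (g0^-1 * (p.1 * \val z.1))%g.
have Tc : continuous (fun q : (G * U) * (H * H) => T q.1 q.2).
  apply: (@comp_cts _ (U * H)%type _ (fun q : (G * U) * (H * H) => (q.1.2, q.2.2)) _ _ kmc).
  by apply: pair_cts; [exact: (comp_cts (@fst_cts _ _) (@snd_cts _ _))|exact: (comp_cts (@snd_cts _ _) (@snd_cts _ _))].
have bc : continuous (fun q : (G * U) * (H * H) => b q.1 q.2).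
  apply: mulmx_cts.
    apply: (@comp_cts _ (U * H)%type _ (fun q : (G * U) * (H * H) => (q.1.2, sg_mul q.2.2 q.2.1)) _ _ kmc).
    apply: pair_cts; first exact: (comp_cts (@fst_cts _ _) (@snd_cts _ _)).
    by apply: sg_mul_cts; [exact: (comp_cts (@snd_cts _ _) (@snd_cts _ _))|exact: (comp_cts (@snd_cts _ _) (@fst_cts _ _))].
  apply: (@comp_cts _ G _ (fun q : (G * U) * (H * H) => (g0^-1 * (q.1.1 * \val q.2.1))%g) _ _ fc).
  apply: mulg_cts; first exact: const_cts.
  apply: mulg_cts; first exact: (comp_cts (@fst_cts _ _) (@fst_cts _ _)).
  exact: (comp_cts (comp_cts (@snd_cts (G * U)%type (H * H)%type) (@fst_cts _ _)) (@continuous_set_val _ _)).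
have Tu p z : T p z \in unitmx by apply: km_unit.
have cZ := compact_kernel_pairs.
pose z0 : H * H := (sg_one H, sg_one H).
(* At [(g0, y0)] the values of [f] on the kernel are exactly equivariant, so the orbit reduces to
   the identity matrix. *)
have good0 : is_center T b (g0, y0) 1%:M.
  apply: (is_center_exact z0 cZ Tc bc) => -[h k]; rewrite mulmx1 /T /b /= mulgA mulVg mul1g.
  rewrite fE -kmM //; congr (km _ _); apply: val_inj => /=.
  by rewrite mulgK.
have F0 := centerP z0 cZ Tc bc Tu good0.
have nC := center_near z0 cZ Tc bc Tu good0.
exists (mx_center T b).
  have u0 : mx_center T b (g0, y0) \in unitmx by rewrite F0 unitmx1.
  have h2 := nbhs_preim (center_cts z0 cZ Tc bc Tu good0) (unitmx_near u0).
  apply: (filterS _ (nbhsI nC h2)) => p [gd u]; split=> //.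
  exact: (center_cts z0 cZ Tc bc Tu gd).
apply: (filterS _ nC) => -[g y] gd h g' /= gg'.
apply: (centerP z0 cZ Tc bc Tu) => A'.
(* Replacing [g] by [g'] shifts the orbit variable by the inverse of [h] and the norm variable by
   [h], which permutes the pairs over which the supremum is taken. *)
have red B : crad T b (g', y) (km y h *m B) = crad T b (g, y) B.
  apply: (@crad_reparam R _ _ n T b
    (fun z => (sg_mul (sg_inv h) z.1, sg_mul z.2 h))
    (fun z => (sg_mul h z.1, sg_mul z.2 (sg_inv h)))).
    by move=> [z1 z2] /=; apply: f_equal2; apply: val_inj => /=; [exact: mulKg|exact: mulgVK].
  move=> [z1 z2]; rewrite /T /b /= mulmxA -kmM; congr (_ - km _ _ *m f _).
    by apply: val_inj; rewrite /= !mulgA mulgK.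
  by rewrite gg' -!mulgA mulVKg.
have -> : A' = km y h *m (invmx (km y h) *m A') by rewrite mulKVmx // km_unit.
by rewrite !red; exact: gd.
Qed.

End EquivariantExtension.

Section LocalFrame2.
Variables (R : realType) (G : topGroupType) (M : topologicalType).
Variables (rho : gaction G M) (K : subgrp G) (X : set M).
Local Notation C := (Cplx R).
Variable E : vbundle R rho K X.
Hypothesis cG : compact [set: G].
Hypothesis hG : hausdorff_space G.
Hypothesis hM : hausdorff_space M.
Hypothesis HK : gker rho `<=` subgrp_set K.
Variable N0 : set G.
Hypothesis N01 : nbhs 1%g N0.
Hypothesis N0K : forall g, N0 g -> subgrp_set K g -> gker rho g.
Local Notation H := (gker_subgrp rho).

(** A local frame of the pullback of [E] to [G * X]. The last clause is compatibility with the
    relation [(g, x) ~ (g k^-1, k x)], which allows the frame to descend to the induced bundle. *)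
Definition gframe (A : set (G * X)) n (t : G * X -> 'cV[C]_n -> tot E)
    (t' : G * tot E -> 'cV[C]_n) :=
  [/\ forall q, A q -> exists2 l : 'cV[C]_n -> fib E q.2,
        linear l & forall w, t q w = fib_in (l w),
      forall q w, A q -> {for (q, w), continuous (fun z => t z.1 z.2)},
      forall q, A (q.1, proj q.2) -> {for q, continuous t'},
      (forall q w, A q -> t' (q.1, t q w) = w) /\
      (forall q, A (q.1, proj q.2) -> t (q.1, proj q.2) (t' q) = q.2) &
      forall (k : K) q q' w, A q -> A q' -> q.1 = (q'.1 * \val k)%g ->
        \val q'.2 = rho (\val k) (\val q.2) -> t q' w = vact k (t q w)].

Lemma nbhs_small : exists2 N1 : set G, nbhs 1%g N1 &
  forall g g', N1 g -> N1 g' -> N0 (g^-1 * g')%g.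
Proof.
have c : continuous (fun q : G * G => q.1^-1 * q.2)%g.
  by apply: mulg_cts; [apply: invg_cts; exact: fst_cts|exact: snd_cts].
have h : nbhs ((1 : G)^-1 * 1)%g N0 by rewrite invg1 mulg1.
have [[U V] /= [U1 V1] UV] := nbhs_preim (c (1%g, 1%g)) h.
exists (U `&` V); first exact: nbhsI.
by move=> g g' [Ug _] [_ Vg']; exact: (UV (g, g')).
Qed.

(** A frame of [E] near [x0] is twisted by the equivariant matrix function [Fh]. Over a small set,
    only elements [k] of the kernel relate two points, and for them compatibility is the
    equivariance of [Fh]. *)
Lemma local_frame (g0 : G) (x0 : X) :
  exists (A : set (G * X)) n t t', [/\ open A, A (g0, x0) & @gframe A n t t'].
Proof.
have [U [n [t0 [t0' [oU Ux0 fr]]]]] := frame_at E x0.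
have [tl tc t'c tK t'K] := fr.
pose km (x : U) (h : H) := ker_mx HK t0 t0' (\val x) h.
have Uv (y : U) : U (\val y) := set_mem (valP y).
have [F Fn Feq] := @equivariant_extension R G M rho cG hG hM U n km
  (fun x h k => ker_mxM HK fr h k (Uv x)) (fun x => ker_mx1 HK fr (Uv x))
  (ker_mx_cts (HK := HK) fr) g0 (set_elt Ux0).
have [N1 N11 N1N0] := nbhs_small.
pose p0 : G * U := (g0, set_elt Ux0).
pose W : set (G * U) := [set p | [/\ {for p, continuous F}, F p \in unitmx, N1 (g0^-1 * p.1)%g &
  forall (h : H) g, p.1 = (g * \val h)%g -> F (g, p.2) = km p.2 h *m F p]].
have nW : nbhs p0 W.
  have c3 : continuous (fun p : G * U => g0^-1 * p.1)%g.
    by apply: mulg_cts; [exact: const_cts|exact: fst_cts].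
  have n3 : nbhs (g0^-1 * p0.1)%g N1 by rewrite /= mulVg.
  have h3 := nbhs_preim (c3 p0) n3.
  by apply: (filterS _ (nbhsI Fn (nbhsI Feq h3))) => p [[? ?] [? ?]]; split.
pose J (p : G * U) : G * X := (p.1, \val p.2).
have Jo : open_map J := @open_map_prod _ _ _ _ id (\val : U -> X) (@open_map_id _) (open_map_val oU).
pose A := J @` W°.
have oA : open A by apply: (open_map_open Jo); exact: open_interior.
pose Fh (q : G * X) : 'M[C]_n := if pselect (U q.2) is left Ux then F (q.1, set_elt Ux) else 0.
have FhJ p : Fh (J p) = F p.
  rewrite /Fh; case: pselect => [Up|]; last by case; exact: Uv.
  by case: p Up => g y Up /=; congr (F (_, _)); exact: val_inj.
have AP q : A q -> exists2 p, q = J p & W p.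
  by move=> [p /interior_subset Wp <-]; exists p.
have AU q : A q -> U q.2 by move=> /AP[p -> _]; exact: Uv.
have Fhc q : A q -> {for q, continuous Fh}.
  move=> /AP[p -> [Fp _ _ _]]; apply: (@open_map_descend _ _ _ J Fh p Jo).
  have -> : (fun p => Fh (J p)) = F by apply/funext => p'; exact: FhJ.
  exact: Fp.
exists A, n, (fun q w => t0 q.2 (Fh q *m w)),
  (fun q => minv (Fh (q.1, proj q.2)) *m t0' q.2); split; first exact: oA.
  by exists p0 => //; exact: nbhs_interior.
split.
- move=> q Aq; have [l ll lE] := tl _ (AU _ Aq).
  exists (fun w => l (Fh q *m w)) => // c u v.
  by rewrite mulmxDr -scalemxAr ll.
- move=> q w Aq.
  have h1 : {for (q, w), continuous (fun z : (G * X) * 'cV[C]_n => Fh z.1 *m z.2)}.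
    apply: mulmx_at; last exact: snd_cts.
    exact: (continuous_comp (@fst_cts _ _ (q, w)) (Fhc _ Aq)).
  have h2 : {for (q, w), continuous (fun z : (G * X) * 'cV[C]_n => z.1.2)}.
    exact: (comp_cts (@fst_cts _ _) (@snd_cts _ _)).
  exact: (@continuous_comp _ _ _ (fun z : (G * X) * 'cV[C]_n => (z.1.2, Fh z.1 *m z.2))
    (fun z => t0 z.1 z.2) (q, w) (cvg_pair h2 h1) (tc _ _ (AU _ Aq))).
- move=> q Aq.
  have h1 : {for q, continuous (fun q : G * tot E => (q.1, proj q.2))}.
    apply: pair_cts; first exact: fst_cts.
    exact: (comp_cts (@snd_cts _ _) (@proj_cts _ _ _ _ _ _ E)).
  have h2 := continuous_comp h1 (Fhc _ Aq).
  have u : Fh (q.1, proj q.2) \in unitmx by have [p -> [_ ? _ _]] := AP _ Aq; rewrite FhJ.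
  apply: mulmx_at; first exact: (continuous_comp h2 (minv_cts u)).
  exact: (continuous_comp (@snd_cts _ _ q) (t'c _ (AU _ Aq))).
- have u q : A q -> Fh q \in unitmx by move=> /AP[p -> [_ ? _ _]]; rewrite FhJ.
  split=> [q w Aq|q Aq] /=.
    rewrite (frame_proj fr _ (AU _ Aq)) -surjective_pairing tK; last exact: AU.
    by rewrite mulmxA mul_minv_mx ?mul1mx //; exact: u.
  rewrite mulmxA mul_mx_minv; last exact: u.
  by rewrite mul1mx t'K //; exact: (AU _ Aq).
- move=> k q q' w /AP[[g y] -> [_ _ N1g eqg]] /AP[[g' y'] -> [_ _ N1g' _]] /= gg' yy'.
  (* Here [k] is the quotient of two elements of [g0 * N1], hence lies in [N0]. *)
  have Hk : gker rho (\val k).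
    apply: N0K (sgP k); have := N1N0 _ _ N1g' N1g.
    by rewrite /= gg' invgM invgK !mulgA mulgK mulVg mul1g.
  have yE : y' = y by apply: val_inj; apply: val_inj; exact: (etrans yy' (Hk _)).
  rewrite {}yE {yy' N1g'} in N1g' *.
  pose h : H := set_elt Hk.
  rewrite !FhJ (eqg h g' gg') -mulmxA -[LHS](ker_mxE HK fr h (F (g, y) *m w) (Uv y)).
  by congr (vact _ _); exact: val_inj.
Qed.

End LocalFrame2.

(** * The twisted product over a slice *)

Lemma cts_on_open (X Y : topologicalType) (A : set X) (f g : X -> Y) (x : X) :
  open A -> A x -> (forall y, A y -> f y = g y) -> {for x, continuous g} ->
  {for x, continuous f}.
Proof.
move=> oA Ax fg cg; apply: cts_at => B; rewrite fg // => /(nbhs_preim cg) h.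
have nA : nbhs x A by apply: open_nbhs_nbhs.
by apply: (filterS _ (nbhsI h nA)) => y [gB Ay]; rewrite /preimage /= fg.
Qed.

Lemma homeo_open_map (X Y : topologicalType) (f : X -> Y) : homeomorphism f -> open_map f.
Proof.
move=> [cf [g [cg fK gK]]]; apply: open_mapP => A oA.
rewrite (_ : f @` A = g @^-1` A); first exact: open_preim.
apply/seteqP; split=> [_ [x Ax <-]|y Ay]; first by rewrite /preimage /= fK.
by exists (g y).
Qed.

Section TrivializationOfTotal.
Variables (R : realType) (M E : topologicalType) (X : set M) (p : E -> X).
Local Notation C := (Cplx R).
Variables (V : X -> lmodType C) (i : forall x, V x -> E).
Hypothesis pi : forall x (v : V x), p (i v) = x.

Lemma trivialization_of_total (U : set X) n (t : X -> 'cV[C]_n -> E) (t' : E -> 'cV[C]_n) :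
  continuous p ->
  (forall x, U x -> exists2 l : 'cV[C]_n -> V x, linear l & forall w, t x w = i (l w)) ->
  (forall x w, U x -> {for (x, w), continuous (fun q => t q.1 q.2)}) ->
  (forall e, U (p e) -> {for e, continuous t'}) ->
  (forall x w, U x -> t' (t x w) = w) ->
  (forall e, U (p e) -> t (p e) (t' e) = e) ->
  exists phi : U * 'cV[C]_n -> p @^-1` U, trivialization i phi.
Proof.
move=> cp tl tc t'c tK t'K.
have Uv (y : U) : U (\val y) := set_mem (valP y).
have tp x w : U x -> p (t x w) = x by move=> /tl[l _ ->]; rewrite pi.
have tU (q : U * 'cV[C]_n) : (p @^-1` U) (t (\val q.1) q.2).
  by rewrite /preimage /= tp; exact: Uv.
have Up (e : p @^-1` U) : U (p (\val e)) := set_mem (valP e).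
exists (fun q => set_elt (tU q)); split; last first.
  by move=> y; have [l ll lE] := tl _ (Uv y); exists l.
split.
  apply: continuous_to_set_type => q.
  have h : {for q, continuous (fun q : U * 'cV[C]_n => (\val q.1, q.2))}.
    apply: pair_cts; last exact: snd_cts.
    exact: (comp_cts (@fst_cts _ _) (@continuous_set_val _ _)).
  exact: (continuous_comp h (tc _ q.2 (Uv q.1))).
exists (fun e => (set_elt (Up e), t' (\val e))); split.
- apply: pair_cts.
    apply: continuous_to_set_type => /=.
    exact: (comp_cts (@continuous_set_val _ _) cp).
  move=> e; exact: (continuous_comp (@continuous_set_val _ _ e) (t'c _ (Up e))).
- move=> [y w]; apply: f_equal2; last exact: tK.
  by apply: val_inj; exact: tp.
- by move=> e; apply: val_inj; exact: t'K.
Qed.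

End TrivializationOfTotal.

Lemma twist_repK (G : topGroupType) (M : topologicalType) (rho : gaction G M)
    (Gam K : subgrp G) (C : set M) (q : twist rho Gam K C) :
  twist_pi rho K (twist_rep q).1 (twist_rep q).2 = q.
Proof. by rewrite /twist_pi -surjective_pairing /twist_rep reprK. Qed.

Section Slice.
Variables (G : topGroupType) (M : topologicalType).
Variables (rho : gaction G M) (Gam : subgrp G) (C : set M).
Local Notation K := (set_stab rho Gam C).
Hypothesis cG : compact [set: G].
Hypothesis clGam : closed Gam.
Hypothesis cM : compact [set: M].
Hypothesis hM : hausdorff_space M.
Hypothesis clC : closed C.
Hypothesis cover : forall x, exists g : Gam, exists c : C, rho (\val g) (\val c) = x.
Hypothesis slice : forall g x, subgrp_set Gam g -> C x -> C (rho g x) -> rho g @` C = C.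

(** The slice property turns one common value into membership in the stabilizer; this gives
    injectivity of the twisted product and uniqueness of representatives up to [K]. *)
Lemma sliceK (g h : Gam) (x y : C) : rho (\val g) (\val x) = rho (\val h) (\val y) ->
  exists2 k : K, \val g = (\val h * \val k)%g & \val y = rho (\val k) (\val x).
Proof.
move=> gxhy; pose k := ((\val h)^-1 * \val g)%g.
have kx : rho k (\val x) = \val y by rewrite gactM gxhy gactK.
have Gk : subgrp_set Gam k by apply: subgrpM; [apply: subgrpV|]; exact: sgP.
have Kk : subgrp_set K k.
  split=> //; apply: (slice Gk (set_mem (valP x))); rewrite kx.
  exact: set_mem (valP y).
by exists (set_elt Kk); rewrite //= mulVKg.
Qed.

(** The inclusion of [g C] in [C] is a closed condition on [g], and by the slice property it already
    implies equality. *)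
Lemma stab_closed : closed K.
Proof.
rewrite (_ : K = Gam `&` \bigcap_(x in C) [set g | C (rho g x)] :> set G).
  apply: closedI => //; apply: closed_bigI => x _.
  apply: (closed_preim (f := fun g => rho g x)) clC.
  by apply: gact_cts2; [exact: id_cts|exact: const_cts].
apply/seteqP; split=> [g [Gg gC]|g [Gg gC]]; split=> //.
  by move=> x Cx; rewrite /= -gC; exists x.
(* The slice property requires a point of [C]; the empty set equals its image under any [g]. *)
have [[x Cx]|C0] := pselect (C !=set0); first exact: (slice Gg Cx (gC x Cx)).
have -> : C = set0 by apply/seteqP; split=> // x Cx; apply: C0; exists x.
exact: image_set0.
Qed.

Lemma twist_pi_open :
  open_map (fun p : Gam * C => twist_pi rho K p.1 p.2).
Proof.
pose a (k : K) (p : Gam * C) : Gam * C :=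
  (sg_mul p.1 (sg_inv (set_elt (sgP k).1)),
   set_elt (set_stab_act (sgP k) (set_mem (valP p.2)))).
apply: (@open_map_orbits _ (twist rho Gam K C) _ K a) => [A|k|p q].
- rewrite (_ : (fun p => _) = \pi_({eq_quot twist_equiv rho Gam K C})%qT).
    exact.
  by apply/funext => p; rewrite /twist_pi -surjective_pairing.
- apply: pair_cts.
    by apply: sg_mul_cts; [exact: fst_cts|exact: const_cts].
  apply: continuous_to_set_type => /=.
  apply: gact_cts2; first exact: const_cts.
  exact: (comp_cts (@snd_cts _ _) (@continuous_set_val _ _)).
- have twE (u v : Gam * C) : twist_pi rho K u.1 u.2 = twist_pi rho K v.1 v.2 <->
      twist_rel rho K u v.
    rewrite /twist_pi -!surjective_pairing; split; first by move/eqmodP.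
    by move=> h; apply/eqmodP.
  rewrite twE; split.
    move=> /asboolP[k [Kk pq1 pq2]].
    have Kk' : subgrp_set K (k^-1)%g := subgrpV Kk.
    exists (set_elt Kk'); case: p q pq1 pq2 => [g x] [h y] /= gh yx.
    apply: f_equal2; apply: val_inj; first by rewrite /= invgK.
    by rewrite /= yx gactK.
  move=> [k ->]; apply/asboolP; exists (\val k)^-1%g; split.
  + by apply: subgrpV; exact: sgP.
  + by [].
  + by rewrite /= gactK.
Qed.

Lemma twist_map_homeo : homeomorphism (twist_map rho Gam K C).
Proof.
have ex (q : twist rho Gam K C) : exists (g : Gam) (x : C), q = twist_pi rho K g x.
  by exists (twist_rep q).1, (twist_rep q).2; rewrite twist_repK.
have tc : continuous (twist_map rho Gam K C).
  apply/quotient_continuous.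
  rewrite (_ : _ \o _ = fun p : Gam * C => rho (\val p.1) (\val p.2)).
    apply: gact_cts2; first exact: (comp_cts (@fst_cts _ _) (@continuous_set_val _ _)).
    exact: (comp_cts (@snd_cts _ _) (@continuous_set_val _ _)).
  by apply/funext => -[g x]; exact: twist_mapE.
apply: closed_map_homeo => //.
- apply: compact_closed_map => //.
  have cT : compact [set: Gam * C].
    rewrite -setXTT; apply: compact_setX; apply: compact_sub.
      exact: (subclosed_compact clGam cG (@subsetT _ _)).
    exact: (subclosed_compact clC cM (@subsetT _ _)).
  rewrite (_ : setT = (fun p : Gam * C => twist_pi rho K p.1 p.2) @` setT).
    apply: continuous_compact cT; apply: continuous_subspaceT.
    rewrite (_ : (fun p => _) = \pi_({eq_quot twist_equiv rho Gam K C})%qT).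
      exact: pi_continuous.
    by apply/funext => p; rewrite /twist_pi -surjective_pairing.
  by apply/seteqP; split=> // q _; have [g [x ->]] := ex q; exists (g, x).
- move=> q q'; have [g [x ->]] := ex q; have [h [y ->]] := ex q'.
  rewrite !twist_mapE => /sliceK[k gh yx].
  by apply/eqmodP/asboolP; exists (\val k); split=> //; exact: sgP.
- move=> x; have [g [c <-]] := cover x.
  by exists (twist_pi rho K g c); rewrite twist_mapE.
Qed.

(** The action map factors into the open quotient map and a homeomorphism. Frames of the induced
    bundle are descended to the base along it. *)
Lemma act_open : open_map (fun p : Gam * C => rho (\val p.1) (\val p.2)).
Proof.
have h := homeo_open_map twist_map_homeo.
move=> p A nA; have := h _ _ (twist_pi_open nA).
rewrite twist_mapE image_comp; apply: filterS => _ [q Aq <-].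
by exists q => //=; rewrite twist_mapE.
Qed.

End Slice.

(** * Induced bundles *)

Section Induced.
Variables (R : realType) (G : topGroupType) (M : topologicalType).
Variables (rho : gaction G M) (Gam : subgrp G) (C : set M).
Local Notation CC := (Cplx R).
Local Notation K := (set_stab rho Gam C).
Hypothesis cG : compact [set: G].
Hypothesis hG : hausdorff_space G.
Hypothesis clGam : closed Gam.
Hypothesis cM : compact [set: M].
Hypothesis hM : hausdorff_space M.
Hypothesis clC : closed C.
Hypothesis cover : forall x, exists g : Gam, exists c : C, rho (\val g) (\val c) = x.
Hypothesis slice : forall g x, subgrp_set Gam g -> C x -> C (rho g x) -> rho g @` C = C.
Hypothesis HK : gker rho `<=` K.
Variable N0 : set G.
Hypothesis N01 : nbhs 1%g N0.
Hypothesis N0K : forall g, N0 g -> subgrp_set K g -> gker rho g.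
Variable E : vbundle R rho K C.

(** The analogue of [twist_rel] with the total space in place of [C]; the quotient is the balanced
    product of [Gam] and [E] over [K]. *)
Definition ind_rel (p q : Gam * tot E) : bool :=
  `[< exists k : K, \val p.1 = (\val q.1 * \val k)%g /\ q.2 = vact k p.2 >].

Lemma ind_rel_equiv : equiv_class_of ind_rel.
Proof.
split=> [p|p q|q p r].
- by apply/asboolP; exists (sg_one K); rewrite /= mulg1 vact1.
- have sym a b : ind_rel a b -> ind_rel b a.
    move=> /asboolP[k [ab1 ab2]]; apply/asboolP; exists (sg_inv k).
    by rewrite /= ab1 mulgK ab2 -vactM sg_Vmul vact1.
  by apply/idP/idP; exact: sym.
- move=> /asboolP[k [pq1 pq2]] /asboolP[l [qr1 qr2]].
  apply/asboolP; exists (sg_mul l k).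
  by rewrite /= pq1 qr1 mulgA qr2 pq2 vactM.
Qed.

Definition ind_equiv : equiv_rel (Gam * tot E)%type := EquivRelPack ind_rel_equiv.

Definition ind_tot : topologicalType := quotient_topology {eq_quot ind_equiv}%qT.

Definition ind_pi (g : Gam) (e : tot E) : ind_tot := \pi_({eq_quot ind_equiv})%qT (g, e).

Definition ind_rep (q : ind_tot) : Gam * tot E := repr (q : {eq_quot ind_equiv}%qT).

Lemma ind_piE g e g' e' : ind_pi g e = ind_pi g' e' <->
  exists k : K, \val g = (\val g' * \val k)%g /\ e' = vact k e.
Proof.
split; first by move/eqmodP => /asboolP.
by move=> h; apply/eqmodP/asboolP.
Qed.

Lemma ind_repK q : ind_pi (ind_rep q).1 (ind_rep q).2 = q.
Proof. by rewrite /ind_pi -surjective_pairing /ind_rep reprK. Qed.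

Lemma ind_pi_fun :
  (fun p : Gam * tot E => ind_pi p.1 p.2) = \pi_({eq_quot ind_equiv})%qT.
Proof. by apply/funext => p; rewrite /ind_pi -surjective_pairing. Qed.

Lemma ind_pi_cts : continuous (fun p : Gam * tot E => ind_pi p.1 p.2).
Proof. rewrite ind_pi_fun; exact: pi_continuous. Qed.

Lemma ind_cts (Z : topologicalType) (f : ind_tot -> Z) :
  continuous (fun p : Gam * tot E => f (ind_pi p.1 p.2)) -> continuous f.
Proof.
move=> cf; apply/quotient_continuous; rewrite (_ : _ \o _ = fun p => f (ind_pi p.1 p.2)) //.
by apply/funext => p /=; rewrite /ind_pi -surjective_pairing.
Qed.

Lemma ind_pi_open : open_map (fun p : Gam * tot E => ind_pi p.1 p.2).
Proof.
pose a (k : K) (p : Gam * tot E) : Gam * tot E :=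
  (sg_mul p.1 (sg_inv (set_elt (sgP k).1)), vact k p.2).
apply: (@open_map_orbits _ ind_tot _ K a) => [A|k|[g e] [h f]].
- rewrite ind_pi_fun; exact.
- apply: pair_cts.
    by apply: sg_mul_cts; [exact: fst_cts|exact: const_cts].
  by apply: vact_cts2; [exact: const_cts|exact: snd_cts].
- rewrite ind_piE; split=> [[k [/= gh fe]]|[k [-> ->]]].
    exists (sg_inv k); apply: f_equal2; first by apply: val_inj; rewrite /= invgK.
    by rewrite /= fe -vactM sg_Vmul vact1.
  by exists (sg_inv k); rewrite -vactM sg_Vmul vact1.
Qed.

Definition ind_proj (q : ind_tot) : [set: M] :=
  set_elt (I : [set: M] (rho (\val (ind_rep q).1) (\val (proj (ind_rep q).2)))).

Lemma ind_projE g e : \val (ind_proj (ind_pi g e)) = rho (\val g) (\val (proj e)).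
Proof.
have /ind_piE[k [gk ek]] : ind_pi g e = ind_pi (ind_rep (ind_pi g e)).1 (ind_rep (ind_pi g e)).2.
  by rewrite ind_repK.
by rewrite /ind_proj /= ek vact_proj gk -gactM.
Qed.

Lemma ind_proj_cts : continuous ind_proj.
Proof.
apply: continuous_to_set_type; apply: ind_cts.
under [X in continuous X]eq_fun do rewrite ind_projE.
apply: gact_cts2; first exact: (comp_cts (@fst_cts _ _) (@continuous_set_val _ _)).
exact: (comp_cts (comp_cts (@snd_cts _ _) (@proj_cts _ _ _ _ _ _ E)) (@continuous_set_val _ _)).
Qed.

Lemma ind_baseP : exists s : M -> Gam * C, forall x, rho (\val (s x).1) (\val (s x).2) = x.
Proof.
have h x : exists p : Gam * C, rho (\val p.1) (\val p.2) = x.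
  by have [g [c <-]] := cover x; exists (g, c).
by have [s sP] := choice h; exists s.
Qed.

Definition ind_base : M -> Gam * C := sval (cid ind_baseP).

Lemma ind_baseE x : rho (\val (ind_base x).1) (\val (ind_base x).2) = x.
Proof. exact: (svalP (cid ind_baseP) x). Qed.

(** The fibre has to be a vector space attached to [x] itself, so a representative of [x] is chosen
    once and for all. The choice only labels fibres: the topology comes from the quotient. *)
Definition ind_fib (x : [set: M]) : lmodType CC := fib E (ind_base (\val x)).2.

Definition ind_in (x : [set: M]) (v : ind_fib x) : ind_tot :=
  ind_pi (ind_base (\val x)).1 (fib_in v).

Lemma ind_in_inj x : injective (@ind_in x).
Proof.
move=> v w /ind_piE[k [/esym/eqP]].
rewrite -[X in _ == X]mulg1 => /eqP /mulgI k1.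
have -> : k = sg_one K by apply: val_inj.
by rewrite vact1 => /fib_in_inj.
Qed.

Lemma ind_proj_in x (v : ind_fib x) : ind_proj (ind_in v) = x.
Proof. by apply: val_inj; rewrite ind_projE proj_in ind_baseE. Qed.

Lemma ind_in_base (x : [set: M]) (g : Gam) (e : tot E) :
  rho (\val g) (\val (proj e)) = \val x ->
  exists2 k : K, \val g = (\val (ind_base (\val x)).1 * \val k)%g &
    proj (vact k e) = (ind_base (\val x)).2.
Proof.
rewrite -[RHS]ind_baseE => /(sliceK slice)[k gk xk]; exists k => //.
by apply: val_inj; rewrite vact_proj.
Qed.

Lemma ind_in_surj q : exists v, ind_in (x := ind_proj q) v = q.
Proof.
have := ind_repK q; case: (ind_rep q) => g e /= qE.
have [|k gk pk] := @ind_in_base (ind_proj q) g e; first by rewrite -qE ind_projE.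
have := fib_in_surj (vact k e); rewrite pk => -[v vE]; exists v.
rewrite -[RHS]qE; apply/esym/ind_piE; exists k; split=> //; exact: vE.
Qed.

Definition ind_act (g : Gam) (q : ind_tot) : ind_tot :=
  ind_pi (sg_mul g (ind_rep q).1) (ind_rep q).2.

Lemma ind_actE g h e : ind_act g (ind_pi h e) = ind_pi (sg_mul g h) e.
Proof.
rewrite /ind_act; have := ind_repK (ind_pi h e).
case: (ind_rep _) => h' e' /= /ind_piE[k [hk ek]].
by apply/ind_piE; exists k; rewrite /= hk mulgA.
Qed.

Lemma ind_act1 q : ind_act (sg_one Gam) q = q.
Proof.
rewrite -(ind_repK q) ind_actE; congr (ind_pi _ _).
by apply: val_inj; rewrite /= mul1g.
Qed.

Lemma ind_actM g h q : ind_act (sg_mul g h) q = ind_act g (ind_act h q).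
Proof. by rewrite -(ind_repK q) !ind_actE sg_mulA. Qed.

Lemma ind_act_cts : continuous (fun p : Gam * ind_tot => ind_act p.1 p.2).
Proof.
move=> [g q]; rewrite -(ind_repK q); set r := ind_rep q.
(* A product of an identity with a quotient map; it is [ind_pi_open] that allows descent along
   it. *)
pose j (p : Gam * (Gam * tot E)) := (p.1, ind_pi p.2.1 p.2.2).
have jo : open_map j := @open_map_prod _ _ _ _ id _ (@open_map_id Gam) ind_pi_open.
apply: (@open_map_descend _ _ _ j (fun p => ind_act p.1 p.2) (g, r) jo).
rewrite (_ : (fun x => _) = fun p : Gam * (Gam * tot E) => ind_pi (sg_mul p.1 p.2.1) p.2.2).
  apply: (@comp_cts _ (Gam * tot E)%type _
    (fun p : Gam * (Gam * tot E) => (sg_mul p.1 p.2.1, p.2.2))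
    (fun p => ind_pi p.1 p.2)); last exact: ind_pi_cts.
  apply: pair_cts; last exact: (comp_cts (@snd_cts _ _) (@snd_cts _ _)).
  apply: sg_mul_cts; first exact: fst_cts.
  exact: (comp_cts (@snd_cts _ _) (@fst_cts _ _)).
by apply/funext => -[a [b c]]; rewrite /j /= ind_actE.
Qed.

Lemma ind_act_proj g q : \val (ind_proj (ind_act g q)) = rho (\val g) (\val (ind_proj q)).
Proof. by rewrite -(ind_repK q) ind_actE !ind_projE gactM. Qed.

Lemma ind_pi_lin (g : Gam) (c : C) (x : [set: M]) : rho (\val g) (\val c) = \val x ->
  exists l : fib E c -> ind_fib x, linear l /\ forall v, ind_pi g (fib_in v) = ind_in (l v).
Proof.
rewrite -[RHS]ind_baseE => /(sliceK slice)[k gk xk].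
have [l [ll lE]] := vact_lin E xk; exists l; split=> // v.
by apply/ind_piE; exists k; split=> //; rewrite lE.
Qed.

Lemma ind_act_lin (g : Gam) (x y : [set: M]) : \val y = rho (\val g) (\val x) ->
  exists l : ind_fib x -> ind_fib y,
    linear l /\ forall v, ind_act g (ind_in v) = ind_in (l v).
Proof.
move=> yx; have [|l [ll lE]] := @ind_pi_lin (sg_mul g (ind_base (\val x)).1) (ind_base (\val x)).2 y.
  by rewrite /= gactM ind_baseE.
by exists l; split=> // v; rewrite /ind_in ind_actE lE.
Qed.

(** The frame given by [local_frame] at a representative of [x] is compatible with the classes. It
    descends to the base along [act_open], and its inverse descends to the total space along
    [ind_pi_open]. *)
Lemma ind_loc_triv x : exists (U : set [set: M]) (n : nat)
  (phi : U * 'cV[CC]_n -> ind_proj @^-1` U),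
  [/\ open U, U x & trivialization ind_in phi].
Proof.
pose g0 := \val (ind_base (\val x)).1; pose x0 := (ind_base (\val x)).2.
have [A [n [t [t' [oA A0 [tl tc t'c [tK t'K] teq]]]]]] :=
  local_frame E cG hG hM HK N01 N0K g0 x0.
pose m (p : Gam * C) : M := rho (\val p.1) (\val p.2).
have mo : open_map m := act_open cG clGam cM hM clC cover slice.
pose J (p : Gam * C) : G * C := (\val p.1, p.2).
have Jc : continuous J.
  apply: pair_cts; last exact: snd_cts.
  exact: (comp_cts (@fst_cts _ _) (@continuous_set_val _ _)).
pose B : set (Gam * C) := J @^-1` A.
have oB : open B := open_preim Jc oA.
pose V : set M := m @` B.
have oV : open V := open_map_open mo oB.
pose U : set [set: M] := \val @^-1` V.
have oU : open U by apply: (open_preim _ oV); exact: continuous_set_val.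
have Ux : U x by exists (ind_base (\val x)) => //; exact: ind_baseE.
(* Any representative in [B] will do: [tauE] shows that the frame does not depend on it. The default
   concerns points outside [V] only. *)
pose s (y : M) : Gam * C := xget (ind_base y) [set p | B p /\ m p = y].
have sP y : V y -> B (s y) /\ m (s y) = y.
  by move=> [p Bp mp]; rewrite /s; case: xgetP => [q -> //|/(_ p)]; case.
pose tau (y : M) (w : 'cV[CC]_n) : ind_tot := ind_pi (s y).1 (t (J (s y)) w).
have tP p w : A p -> proj (t p w) = p.2 by move=> /tl[l _ ->]; rewrite proj_in.
have tauE p w : B p -> tau (m p) w = ind_pi p.1 (t (J p) w).
  move=> Bp; have [Bs ms] := sP (m p) (ex_intro2 _ _ p Bp erefl).
  have [k gk xk] := sliceK slice ms.
  by apply/ind_piE; exists k; split=> //; apply: (teq k (J (s (m p))) (J p)).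
(* Likewise for the inverse of the frame, with [tau'E] as independence of the representative. *)
pose tau' (q : ind_tot) : 'cV[CC]_n :=
  let p := xget (ind_rep q) [set p : Gam * tot E | B (p.1, proj p.2) /\ q = ind_pi p.1 p.2] in
  t' (\val p.1, p.2).
have tau'E g e : B (g, proj e) -> tau' (ind_pi g e) = t' (\val g, e).
  move=> Bg; rewrite /tau'; set S := [set p | _ /\ _].
  case: xgetP => [p pE|/(_ (g, e))]; last by case.
  case: p pE => g1 e1 _ [/= B1 /ind_piE[k [gk ek]]].
  have xk : \val (proj e1) = rho (\val k) (\val (proj e)) by rewrite ek vact_proj.
  have E1 := teq k (\val g, proj e) (\val g1, proj e1) (t' (\val g, e)) Bg B1 gk xk.
  have E2 := t'K (\val g, e) Bg; rewrite /= in E2.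
  rewrite E2 -ek in E1.
  by have := tK (\val g1, proj e1) (t' (\val g, e)) B1; rewrite E1.
have repB q : U (ind_proj q) -> exists g e, q = ind_pi g e /\ B (g, proj e).
  move=> [[g1 c1] B1 mE]; have := ind_repK q; case: (ind_rep q) => g e /= qE.
  have gE : rho (\val g) (\val (proj e)) = rho (\val g1) (\val c1).
    by rewrite -ind_projE qE -mE.
  have [k gk ck] := sliceK slice gE.
  have pk : proj (vact k e) = c1 by apply: val_inj; rewrite vact_proj.
  exists g1, (vact k e); rewrite pk; split=> //.
  by rewrite -qE; apply/ind_piE; exists k.
have tauc p w : B p -> {for (m p, w), continuous (fun z : M * 'cV[CC]_n => tau z.1 z.2)}.
  move=> Bp.
  pose j (z : (Gam * C) * 'cV[CC]_n) := (m z.1, z.2).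
  have jo : open_map j := @open_map_prod _ _ _ _ m id mo (@open_map_id _).
  apply: (@open_map_descend _ _ _ j (fun z => tau z.1 z.2) (p, w) jo).
  apply: (@cts_on_open _ _ (fst @^-1` B) _ (fun z => ind_pi z.1.1 (t (J z.1) z.2))).
  - by apply: (open_preim _ oB); exact: fst_cts.
  - by [].
  - by move=> z Bz; exact: tauE.
  have h1 : {for (p, w), continuous (fun z : (Gam * C) * 'cV[CC]_n => (J z.1, z.2))}.
    apply: pair_cts; last exact: snd_cts.
    exact: (comp_cts (@fst_cts _ _) Jc).
  have h2 := continuous_comp h1 (tc (J p) w Bp).
  have h3 : {for (p, w), continuous (fun z : (Gam * C) * 'cV[CC]_n => z.1.1)}.
    exact: (comp_cts (@fst_cts _ _) (@fst_cts _ _)).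
  exact: (@continuous_comp _ _ _
    (fun z : (Gam * C) * 'cV[CC]_n => (z.1.1, t (J z.1) z.2))
    (fun z => ind_pi z.1 z.2) (p, w) (cvg_pair h3 h2) (@ind_pi_cts _)).
exists U, n.
have [phi phiP] : exists phi : U * 'cV[CC]_n -> ind_proj @^-1` U, trivialization ind_in phi.
  apply: (@trivialization_of_total R M ind_tot setT ind_proj ind_fib ind_in ind_proj_in
    U n (fun x w => tau (\val x) w) tau' ind_proj_cts).
  - move=> y Uy; have [Bs ms] := sP _ Uy.
    have [l ll lE] := tl (J (s (\val y))) Bs.
    have [a [al aE]] := @ind_pi_lin (s (\val y)).1 (s (\val y)).2 y ms.
    exists (a \o l); first exact: linear_comp.
    by move=> w; rewrite /tau lE aE.
  - move=> y w Uy; have [p Bp mp] := Uy.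
    have h : {for (y, w), continuous (fun q : [set: M] * 'cV[CC]_n => (\val q.1, q.2))}.
      apply: pair_cts; last exact: snd_cts.
      exact: (comp_cts (@fst_cts _ _) (@continuous_set_val _ _)).
    have := @tauc p w Bp; rewrite mp => c2.
    exact: (continuous_comp h c2).
  - move=> q Uq; have [g [e [-> Bg]]] := repB q Uq.
    apply: (@open_map_descend _ _ _ (fun p : Gam * tot E => ind_pi p.1 p.2) tau' (g, e) ind_pi_open).
    pose j (z : Gam * tot E) : Gam * C := (z.1, proj z.2).
    have jc : continuous j.
      apply: pair_cts; first exact: fst_cts.
      exact: (comp_cts (@snd_cts _ _) (@proj_cts _ _ _ _ _ _ E)).
    apply: (@cts_on_open _ _ (j @^-1` B) _ (fun z => t' (\val z.1, z.2))).
    + exact: open_preim jc oB.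
    + by [].
    + by move=> z Bz; exact: tau'E.
    have h1 : {for (g, e), continuous (fun z : Gam * tot E => (\val z.1, z.2))}.
      apply: pair_cts; last exact: snd_cts.
      exact: (comp_cts (@fst_cts _ _) (@continuous_set_val _ _)).
    exact: (continuous_comp h1 (t'c (\val g, e) Bg)).
  - move=> y w Uy; have [Bs ms] := sP _ Uy.
    have pE : proj (t (J (s (\val y))) w) = (s (\val y)).2 by exact: tP.
    rewrite /tau tau'E; last by rewrite pE -surjective_pairing.
    exact: (tK (J (s (\val y))) w Bs).
  - move=> q Uq; have [g [e [-> Bg]]] := repB q Uq.
    rewrite ind_projE tau'E // (tauE (g, proj e)) //=.
    by rewrite [t _ _](t'K (\val g, e) Bg).
by exists phi; split.
Qed.

Definition induced_bundle : vbundle R rho Gam setT :=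
  VBundle ind_proj_cts ind_in_inj ind_proj_in ind_in_surj ind_loc_triv
    ind_act1 ind_actM ind_act_cts ind_act_proj ind_act_lin.

(** Over the image of [c] under [g], the kernel element [h] acts as [g^-1 h g] does over [c]. The
    hypothesis on [E] is therefore applied to the conjugate representation [r'], which affords [chi]
    as well because [g] fixes [chi]. *)
Lemma induced_isotypical (chi : G -> CC) :
  (forall g h, subgrp_set Gam g -> gker rho h -> chi (g^-1 * h * g)%g = chi h) ->
  isotypical chi E -> isotypical chi induced_bundle.
Proof.
move=> chiJ iE d r [[r1 rM rc] d0 rirr] rchi x.
pose g := (ind_base (\val x)).1; pose c := (ind_base (\val x)).2.
have kJ h : gker rho h -> gker rho (\val g * h * (\val g)^-1)%g.
  by move=> kh; have := gkerJ (\val g)^-1%g kh; rewrite invgK.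
pose r' h := r (\val g * h * (\val g)^-1)%g.
have irr' : irreducible (gker rho) r'.
  split; [split| exact: d0 |].
  - by rewrite /r' mulg1 mulgV.
  - move=> h k Hh Hk; rewrite /r' -rM; [|exact: kJ|exact: kJ].
    by congr r; rewrite !mulgA mulgVK.
  - pose a (h : gker rho) : gker rho := set_elt (kJ _ (set_mem (valP h))).
    apply: (@comp_cts _ _ _ a _ _ rc); apply: continuous_to_set_type.
    apply: mulg_cts; last exact: const_cts.
    by apply: mulg_cts; [exact: const_cts|exact: continuous_set_val].
  - move=> W WP; apply: rirr => h v Hh Wv.
    have := WP _ v (gkerJ (\val g) Hh) Wv; rewrite /r'.
    by rewrite !mulgA mulgV mul1g -!mulgA mulgV mulg1.
have achi : affords (gker rho) r' chi.
  move=> h Hh; rewrite /r' -rchi; last exact: kJ.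
  rewrite -(chiJ _ _ (sgP g) (kJ _ Hh)).
  by rewrite !mulgA mulVg mul1g mulgVK.
have [m [l [ll lb lE]]] := iE d r' irr' achi c.
exists m, l; split=> // h u Hh.
have Hk := gkerJ (\val g) Hh.
pose k : K := set_elt (HK Hk).
have := lE k u Hk; rewrite /r' /= !mulgA mulgV mul1g -mulgA mulgV mulg1 => E1.
rewrite [LHS]ind_actE; apply/ind_piE; exists k; split; last exact: (esym E1).
by rewrite /= !mulgA mulgV mul1g.
Qed.

(** The complement of the image is itself the image, under the open map [ind_pi], of the complement
    of the saturated set [S]; so it is enough that [S] is closed. This makes the unit map of
    [restriction_induced] a homeomorphism onto its image. *)
Lemma ind_unit_closed (A : set (tot E)) : closed A -> closed (ind_pi (sg_one Gam) @` A).
Proof.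
move=> cA; pose S : set (Gam * tot E) :=
  [set p | exists2 k : K, \val k = \val p.1 & A (vact k p.2)].
have cS : closed S.
  rewrite -[S]setCK; apply: open_closedC; rewrite openE => -[g e] nS.
  have clK : closed K := stab_closed clGam clC slice.
  (* Off [K] the closedness of [K] gives a neighbourhood avoiding [S]; on [K] continuity of the
     action does. *)
  have [Kg|nKg] := pselect (subgrp_set K (\val g)); last first.
    have nb : nbhs (\val g) (~` (subgrp_set K)).
      by apply: open_nbhs_nbhs; split=> //; exact: closed_openC.
    have c1 : continuous (fun p : Gam * tot E => \val p.1).
      exact: (comp_cts (@fst_cts _ _) (@continuous_set_val _ _)).
    have h := nbhs_preim (c1 (g, e)) nb.
    by apply: (filterS _ h) => -[g' e'] nK [k kE _]; apply: nK; have := sgP k; rewrite kE; exact.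
  pose k : K := set_elt Kg.
  have nA : nbhs (vact k e) (~` A).
    apply: open_nbhs_nbhs; split; first exact: closed_openC.
    by move=> Ae; apply: nS; exists k.
  have vc : continuous (fun p : K * tot E => vact p.1 p.2) by exact: vact_cts.
  have [[P Q] /= [nP nQ] PQ] := nbhs_preim (vc (k, e)) nA.
  have [N nN NP] := (nbhs_sub k P).1 nP.
  have vg : continuous (\val : Gam -> G) by exact: continuous_set_val.
  exists ((fun g : Gam => N (\val g)), Q).
    by split=> //; exact: (nbhs_preim (vg g) nN).
  move=> [g' e'] /= [Ng' Qe'] [k' kE' Ak'].
  by apply: (PQ (k', e')) => //; split=> //; apply: NP; rewrite kE'.
rewrite -[X in closed X]setCK; apply: open_closedC.
have -> : ~` (ind_pi (sg_one Gam) @` A) =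
    (fun p : Gam * tot E => ind_pi p.1 p.2) @` (~` S).
  apply/seteqP; split=> [q nq|_ [[g e] nS <-] [a Aa /ind_piE[k /= [gk ek]]]].
    have := ind_repK q; case: (ind_rep q) => g e /= qE; exists (g, e) => //.
    move=> [k kE Ak]; apply: nq; exists (vact k e) => //; rewrite -qE.
    by apply/esym/ind_piE; exists k; rewrite /= mul1g.
  apply: nS; exists (sg_inv k) => /=; last by rewrite ek -vactM sg_Vmul vact1.
  by apply: (@mulIg _ (\val k)); rewrite mulVg -gk.
exact: (open_map_open ind_pi_open (closed_openC cS)).
Qed.

(** The isomorphism is [e] to [[1, e]]. It is onto since a class [[g, e]] lying over [C] has [g] in
    the stabilizer, by the slice property. *)
Lemma restriction_induced (KK : subgrp_set K `<=` subgrp_set Gam) (XX : C `<=` setT)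
    (KX : forall k x, subgrp_set K k -> C x -> C (rho k x)) :
  vb_iso E (restriction induced_bundle KK XX KX).
Proof.
have jP e : @rs_set _ _ _ _ Gam setT C induced_bundle (ind_pi (sg_one Gam) e).
  have h : C (\val (ind_proj (ind_pi (sg_one Gam) e))).
    by rewrite ind_projE gact1; exact: set_mem (valP (proj e)).
  exact: h.
exists (fun e => set_elt (jP e)); split.
- apply: closed_map_homeo.
  + move=> A cA; rewrite (_ : _ @` A = \val @^-1` (ind_pi (sg_one Gam) @` A)).
      by apply: (closed_preim _ (ind_unit_closed cA)); exact: continuous_set_val.
    apply/seteqP; split=> [_ [a Aa <-]|q [a Aa aq]]; first by exists a.
    by exists a => //; exact: val_inj.
  + apply: continuous_to_set_type => /=.
    apply: (@comp_cts _ (Gam * tot E)%type _ (fun e => (sg_one Gam, e))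
      (fun p => ind_pi p.1 p.2)); last exact: ind_pi_cts.
    by apply: pair_cts; [exact: const_cts|exact: id_cts].
  + move=> e e' /(congr1 \val) /= /ind_piE[k [k1 ->]].
    have -> : k = sg_one K by apply: val_inj; move: k1; rewrite /= mul1g.
    by rewrite vact1.
  + move=> q; have := ind_repK (\val q); case: (ind_rep _) => g e /= qE.
    have Cq : C (rho (\val g) (\val (proj e))).
      have h : C (\val (ind_proj (\val q))) by exact: (rs_totP q).
      by rewrite -ind_projE qE.
    have Kg : subgrp_set K (\val g).
      by split; [exact: sgP|apply: (slice (sgP g) _ Cq); exact: set_mem (valP (proj e))].
    exists (vact (set_elt Kg) e); apply: val_inj; rewrite /= -qE.
    by apply/esym/ind_piE; exists (set_elt Kg); rewrite /= mul1g.
- move=> k e; apply: val_inj; rewrite /= [RHS]ind_actE.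
  by apply/esym/ind_piE; exists k; rewrite /= mul1g mulg1.
- move=> x; have [|l [ll lE]] := @ind_pi_lin (sg_one Gam) x (incl_base XX x).
    by rewrite /= gact1.
  by exists l; split=> // v; apply: val_inj; exact: lE.
Qed.

End Induced.

(** * Restriction to a slice *)

Section ExtendIso.
Variables (R : realType) (G : topGroupType) (M : topologicalType).
Variables (rho : gaction G M) (Gam : subgrp G) (C : set M).
Local Notation CC := (Cplx R).
Local Notation K := (set_stab rho Gam C).
Hypothesis cG : compact [set: G].
Hypothesis clGam : closed Gam.
Hypothesis clC : closed C.
Hypothesis cover : forall x, exists g : Gam, exists c : C, rho (\val g) (\val c) = x.
Hypothesis slice : forall g x, subgrp_set Gam g -> C x -> C (rho g x) -> rho g @` C = C.
Variables (KK : subgrp_set K `<=` subgrp_set Gam) (XX : C `<=` setT).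
Variable KX : forall k x, subgrp_set K k -> C x -> C (rho k x).

(** Presents [E] as a quotient of [Gam] times its restriction to [C], along which morphisms defined
    over [C] are extended. *)
Definition spread (E : vbundle R rho Gam setT) (p : Gam * rs_tot C E) : tot E :=
  vact p.1 (\val p.2).

Lemma spread_cts (E : vbundle R rho Gam setT) : continuous (@spread E).
Proof.
apply: vact_cts2; first exact: fst_cts.
exact: (comp_cts (@snd_cts _ _) (@continuous_set_val _ _)).
Qed.

Lemma spread_surj (E : vbundle R rho Gam setT) (e : tot E) : exists p, @spread E p = e.
Proof.
have [g [c gc]] := cover (\val (proj e)).
have Ce : @rs_set _ _ _ _ Gam setT C E (vact (sg_inv g) e).
  by rewrite /rs_set /= vact_proj /= -gc gactK; exact: set_mem (valP c).
by exists (g, set_elt Ce); rewrite /spread /= -vactM sg_mulV vact1.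
Qed.

Lemma spread_eq (E : vbundle R rho Gam setT) g e g' e' : @spread E (g, e) = spread (g', e') ->
  exists2 k : K, \val g = (\val g' * \val k)%g & e' = rs_act KK KX k e.
Proof.
move=> h; have := congr1 (fun e => \val (proj e)) h; rewrite /spread /= !vact_proj => pe.
have [k gk _] := sliceK slice (x := rs_proj e) (y := rs_proj e') pe.
exists k => //; apply: val_inj => /=.
have -> : incl_grp KK k = sg_mul (sg_inv g') g.
  by apply: val_inj; rewrite /= gk mulKg.
by rewrite vactM; move: h; rewrite /spread /= => ->; rewrite -vactM sg_Vmul vact1.
Qed.

Lemma rs_closed (E : vbundle R rho Gam setT) : closed (@rs_set _ _ _ _ Gam setT C E).
Proof.
apply: (closed_preim (f := fun e : tot E => \val (proj e))) clC.
exact: (comp_cts (@proj_cts _ _ _ _ _ _ E) (@continuous_set_val _ _)).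
Qed.

(** A point [e] is outside the image when no [(g, g^-1 e)] belongs to [A]. Each such condition is
    open in [e] and [g] jointly, and [Gam] is compact, so the tube lemma applies. *)
Lemma spread_closed (E : vbundle R rho Gam setT) (A : set (Gam * rs_tot C E)) :
  closed A -> closed (@spread E @` A).
Proof.
move=> cA; rewrite -[X in closed X]setCK; apply: open_closedC.
rewrite openE => e ne; rewrite /interior.
have cGam : compact [set: Gam].
  by apply: compact_sub; exact: (subclosed_compact clGam cG (@subsetT _ _)).
pose P (e : tot E) (g : Gam) := forall e' : rs_tot C E, \val e' = vact (sg_inv g) e -> ~ A (g, e').
have h : \forall e1 \near e, forall g, setT g -> P e1 g.
  apply: (near_forall_compact (P := P)) => // g _.
  have ac : continuous (fun p : tot E * Gam => vact (sg_inv p.2) p.1).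
    by apply: vact_cts2; [apply: sg_inv_cts; exact: snd_cts|exact: fst_cts].
  have [Ce|nCe] := pselect (@rs_set _ _ _ _ Gam setT C E (vact (sg_inv g) e)); last first.
    have nb : nbhs (vact (sg_inv g) e) (~` @rs_set _ _ _ _ Gam setT C E).
      by apply: open_nbhs_nbhs; split=> //; apply: closed_openC; exact: rs_closed.
    apply: (filterS _ (nbhs_preim (ac (e, g)) nb)) => -[e1 g1] n1 e' e'E _.
    by apply: n1; rewrite /= -e'E; exact: set_mem (valP e').
  pose e0 : rs_tot C E := set_elt Ce.
  have nA : nbhs (g, e0) (~` A).
    apply: open_nbhs_nbhs; split; first exact: closed_openC.
    by move=> Ae; apply: ne; exists (g, e0); rewrite // /spread /= -vactM sg_mulV vact1.
  have [[S Q] /= [nS nQ] SQ] := nA.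
  have [N nN NQ] := (nbhs_sub e0 Q).1 nQ.
  have h1 := nbhs_preim (ac (e, g)) nN.
  have h2 := nbhs_preim (@snd_cts (tot E) Gam (e, g)) nS.
  apply: (filterS _ (nbhsI h1 h2)) => -[e1 g1] [/= N1 S1] e' e'E.
  by apply: (SQ (g1, e')); split=> //; apply: NQ; rewrite e'E.
apply: (filterS _ h) => e1 Pe [[g e'] Aq qE].
apply: (Pe g I e') Aq; rewrite -qE /spread /= -vactM sg_Vmul vact1 //.
Qed.

(** Equivariance forces [g e] to go to [g (f e)]. This is well defined because [f] commutes with
    [K], and continuous because [spread] is a closed surjection. *)
Lemma extend_morphism (E F : vbundle R rho Gam setT) (f : rs_tot C E -> rs_tot C F) :
  continuous f ->
  (forall k e, f (rs_act KK KX k e) = rs_act KK KX k (f e)) ->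
  exists2 fh : tot E -> tot F, continuous fh &
    forall g e, fh (vact g (\val e)) = vact g (\val (f e)).
Proof.
move=> fc fa; have [s sK] := choice (@spread_surj E).
pose fh (e : tot E) : tot F := spread ((s e).1, f (s e).2).
have fhE g e : fh (spread (g, e)) = spread (g, f e).
  rewrite /fh; have := sK (spread (g, e)); case: (s _) => g' e' /= /spread_eq[k gk ->].
  rewrite fa /spread /= -vactM; congr (vact _ _).
  by apply: val_inj; rewrite /= gk.
exists fh; last by move=> g e; exact: (fhE g e).
apply: (closed_map_descend (@spread_closed E) (@spread_surj E)).
rewrite (_ : (fun _ => _) = fun p => spread (p.1, f p.2)).
  apply: (@comp_cts _ (Gam * rs_tot C F)%type _ (fun p : Gam * rs_tot C E => (p.1, f p.2)) _ _ (@spread_cts F)).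
  by apply: pair_cts; [exact: fst_cts|exact: (comp_cts (@snd_cts _ _) fc)].
by apply/funext => -[g e]; exact: fhE.
Qed.

Lemma restriction_inj (E F : vbundle R rho Gam setT) :
  vb_iso (restriction E KK XX KX) (restriction F KK XX KX) -> vb_iso E F.
Proof.
move=> [f [[fc [f' [fc' fK f'K]]] fa fl]].
have fa' k e : f' (rs_act KK KX k e) = rs_act KK KX k (f' e).
  by apply: (can_inj fK); rewrite f'K [RHS]fa f'K.
have [fh fhc fhE] := extend_morphism fc fa.
have [fh' fhc' fhE'] := extend_morphism fc' fa'.
exists fh; split.
- split=> //; exists fh'; split=> // e.
    by have [[g e0] <-] := spread_surj e; rewrite /spread /= fhE fhE' fK.
  by have [[g e0] <-] := spread_surj e; rewrite /spread /= fhE' fhE f'K.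
- move=> h e; have [[g e0] <-] := spread_surj e.
  by rewrite /spread /= -vactM !fhE vactM.
- move=> x; have [g [c gc]] := cover (\val x).
  have cx : \val (incl_base XX c) = rho (\val (sg_inv g)) (\val x) by rewrite /= -gc gactK.
  have [l1 [ll1 lE1]] := vact_lin E cx.
  have [l2 [ll2 lE2]] := fl c.
  have [l3 [ll3 lE3]] := vact_lin F (esym gc : \val x = rho (\val g) (\val (incl_base XX c))).
  exists (fun v => l3 (l2 (l1 v))); split.
    by move=> a u v; rewrite ll1 ll2 ll3.
  move=> v.
  have -> : fib_in v = vact g (\val (rs_in (E := E) (x := c) (l1 v))).
    by rewrite /= -lE1 -vactM sg_mulV vact1.
  rewrite fhE -lE3; congr (vact g _).
  exact: (congr1 \val (lE2 (l1 v))).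
Qed.

End ExtendIso.

Section RestrictionWhitney.
Variables (R : realType) (G : topGroupType) (M : topologicalType).
Variables (rho : gaction G M) (K K' : subgrp G) (X X' : set M).
Variables (KK : subgrp_set K' `<=` subgrp_set K) (XX : X' `<=` X).
Variable KX : forall k x, subgrp_set K' k -> X' x -> X' (rho k x).
Variables E F : vbundle R rho K X.
Local Notation rE := (restriction E KK XX KX).
Local Notation rF := (restriction F KK XX KX).

Lemma restriction_whitney :
  vb_iso (restriction (whitney_sum E F) KK XX KX) (whitney_sum rE rF).
Proof.
have p1 (e : rs_tot X' (whitney_sum E F)) : @rs_set _ _ _ _ K X X' E (\val (\val e)).1.
  exact: rs_totP e.
have p2 (e : rs_tot X' (whitney_sum E F)) : @rs_set _ _ _ _ K X X' F (\val (\val e)).2.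
  by have := rs_totP e; rewrite /rs_set /= -wh_totP.
have p12 e : @proj _ _ _ _ _ _ rE (set_elt (p1 e)) = @proj _ _ _ _ _ _ rF (set_elt (p2 e)).
  by apply: val_inj; rewrite /= wh_totP.
have q12 (e : wh_tot rE rF) : proj (\val (\val e).1) = proj (\val (\val e).2).
  have := congr1 (@incl_base _ _ _ XX) (wh_totP e).
  by rewrite [LHS]rs_projE [RHS]rs_projE.
have q (e : wh_tot rE rF) : @rs_set _ _ _ _ K X X' (whitney_sum E F) (wh_pair (q12 e)).
  exact: (rs_totP (\val e).1).
exists (fun e => wh_pair (p12 e)); split.
- split.
    apply: continuous_to_set_type; apply: pair_cts; apply: continuous_to_set_type => /=.
      exact: (comp_cts (@continuous_set_val _ _) (@wh_fst_cts _ _ _ _ _ _ E F)).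
    exact: (comp_cts (@continuous_set_val _ _) (@wh_snd_cts _ _ _ _ _ _ E F)).
  exists (fun e => set_elt (q e)); split.
  + apply: continuous_to_set_type; apply: continuous_to_set_type => /=.
    apply: pair_cts.
      exact: (comp_cts (@wh_fst_cts _ _ _ _ _ _ rE rF) (@continuous_set_val _ _)).
    exact: (comp_cts (@wh_snd_cts _ _ _ _ _ _ rE rF) (@continuous_set_val _ _)).
  + by move=> e; apply: val_inj; apply: wh_eq.
  + by move=> e; apply: wh_eq; apply: val_inj.
- by move=> k e; apply: wh_eq; apply: val_inj.
- move=> x; exists id; split; first exact: linear_id.
  by move=> v; apply: wh_eq; apply: val_inj.
Qed.

End RestrictionWhitney.

Section VectSlice.
Variables (R : realType) (G : topGroupType) (M : topologicalType) (rho : gaction G M).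

Lemma Vect_eq (chi : G -> Cplx R) (K : subgrp G) (X : set M) (a b : Vect rho chi K X) :
  vclass a = vclass b -> a = b.
Proof.
by case: a b => [a pa] [b pb] /= ab; subst b; congr MkVect; exact: Prop_irrelevance.
Qed.

Lemma vb_iso_class (K : subgrp G) (X : set M) (E F : vbundle R rho K X) :
  vb_iso E F -> vb_iso E = vb_iso F.
Proof.
move=> h; apply/funext => D; apply/propext; split; last exact: vb_iso_trans h.
by apply: vb_iso_trans; exact: vb_iso_sym.
Qed.

Lemma vb_class_iso (K : subgrp G) (X : set M) (E F : vbundle R rho K X) :
  vb_iso E = vb_iso F -> vb_iso E F.
Proof. by move=> ->; exact: vb_iso_refl. Qed.

Lemma Vect_addE (chi : G -> Cplx R) (K : subgrp G) (X : set M) (a b : Vect rho chi K X) E F :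
  vclass a = vb_iso E -> vclass b = vb_iso F ->
  vclass (Vect_add a b) = vb_iso (whitney_sum E F).
Proof.
move=> aE bF; rewrite /= aE bF; apply/funext => D; apply/propext; split.
  move=> [E1 [F1 [h1 h2 h3]]]; apply: vb_iso_trans h3; exact: vb_iso_whitney.
by move=> h; exists E, F; split=> //; exact: vb_iso_refl.
Qed.

(** The torus does not enter here: what counts is a closed slice whose stabilizer is discrete modulo
    the kernel. Extension of isomorphisms gives injectivity, induction gives surjectivity. *)
Lemma Vect_isomorphism_slice (chi : G -> Cplx R) (Gam : subgrp G) (C : set M) (N : set G) :
  compact [set: G] -> hausdorff_space G -> closed Gam ->
  compact [set: M] -> hausdorff_space M -> closed C ->
  (forall x, exists g : Gam, exists c : C, rho (\val g) (\val c) = x) ->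
  (forall g x, subgrp_set Gam g -> C x -> C (rho g x) -> rho g @` C = C) ->
  gker rho `<=` subgrp_set (set_stab rho Gam C) ->
  nbhs 1%g N ->
  (forall g, N g -> subgrp_set (set_stab rho Gam C) g -> gker rho g) ->
  (forall g h, subgrp_set Gam g -> gker rho h -> chi (g^-1 * h * g)%g = chi h) ->
  Vect_isomorphism (restrict_to rho chi Gam C).
Proof.
move=> cG hG clGam cM hM clC cover slice HK N1 NK chiJ.
have resE (a : Vect rho chi Gam setT) E : vclass a = vb_iso E ->
    vclass (restrict_to rho chi Gam C a) =
    vb_iso (restriction E (@set_stab_sub _ _ rho Gam C) (@subsetT M C) (@set_stab_act _ _ rho Gam C)).
  move=> aE; rewrite /restrict_to /Vect_res /= aE; apply/funext => F; apply/propext; split.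
    by move=> [D ED]; apply: vb_iso_trans; exact: vb_iso_restriction.
  by move=> h; exists E => //; exact: vb_iso_refl.
split.
  have inj : injective (restrict_to rho chi Gam C).
    move=> a b ab; apply: Vect_eq.
    have [E iE aE] := vclassP a; have [F iF bF] := vclassP b.
    have := congr1 (@vclass _ _ _ _ _ _ _) ab; rewrite (resE a E aE) (resE b F bF).
    move=> /vb_class_iso /(restriction_inj cG clGam clC cover slice) EF.
    by rewrite aE bF; exact: vb_iso_class.
  have surj b : exists a, restrict_to rho chi Gam C a = b.
    have [E iE bE] := vclassP b.
    pose I := induced_bundle cG hG clGam cM hM clC cover slice HK N1 NK E.
    have iI : isotypical chi I by exact: induced_isotypical.
    exists (Vect_class iI); apply: Vect_eq; rewrite (resE (Vect_class iI) I erefl) bE.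
    by apply/esym/vb_iso_class; exact: restriction_induced.
  have [s sK] := choice surj.
  by exists s => // a; apply: inj; rewrite sK.
move=> a b; apply: Vect_eq.
have [E iE aE] := vclassP a; have [F iF bF] := vclassP b.
rewrite (resE _ _ (Vect_addE aE bF)) (Vect_addE (resE a E aE) (resE b F bF)).
exact: vb_iso_class (restriction_whitney _ _ _ E F).
Qed.

End VectSlice.

(** * Closed subgroups of the plane *)

Section Plane.
Variable R : realType.
Local Notation V := 'cV[R]_2.
Implicit Types x y v w a : V.

Definition small (e : R) (x : V) := forall i, `|x i 0| < e.

(** For fixed nonzero [x] this is a linear form with kernel the line of [x], used as the coordinate
    transversal to that line. *)
Definition det2 (x y : V) : R := x 0 0 * y 1 0 - x 1 0 * y 0 0.

Lemma ord2_cases (i : 'I_2) : i = 0 \/ i = 1.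
Proof. by case: i => [[|[|//]] ?]; [left|right]; apply: val_inj. Qed.

Lemma cV2P x y : x 0 0 = y 0 0 -> x 1 0 = y 1 0 -> x = y.
Proof.
by move=> h0 h1; apply/matrixP => i j; rewrite (ord1 j); case: (ord2_cases i) => ->.
Qed.

Lemma det2D x y z : det2 x (y + z) = det2 x y + det2 x z.
Proof. by rewrite /det2 !mxE; ring. Qed.

Lemma det2N x y : det2 x (- y) = - det2 x y.
Proof. by rewrite /det2 !mxE; ring. Qed.

Lemma det2B x y z : det2 x (y - z) = det2 x y - det2 x z.
Proof. by rewrite det2D det2N. Qed.

Lemma det2Z x y t : det2 x (t *: y) = t * det2 x y.
Proof. by rewrite /det2 !mxE; ring. Qed.

Lemma det2xx x : det2 x x = 0.
Proof. by rewrite /det2; ring. Qed.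

Lemma det2C x y : det2 x y = - det2 y x.
Proof. by rewrite /det2; ring. Qed.

(** Cramer's rule. *)
Lemma det2_dec v w x : det2 v w != 0 ->
  x = (det2 x w / det2 v w) *: v + (det2 v x / det2 v w) *: w.
Proof.
move=> d; apply: (scalerI d); rewrite scalerDr !scalerA !mulrA !(mulrAC _ _ (_^-1)) !divff // !mul1r.
by apply: cV2P; rewrite !mxE /det2; ring.
Qed.

Lemma det2_nz v : v != 0 -> exists w, det2 v w != 0.
Proof.
move=> v0; have [v00|v00] := eqVneq (v 0 0) 0; last first.
  exists (delta_mx 1 0); rewrite /det2 !mxE /=.
  by rewrite mulr1 mulr0 subr0.
exists (delta_mx 0 0); rewrite /det2 !mxE /= mulr0 mulr1 sub0r oppr_eq0.
by apply: contraNneq v0 => v10; apply/eqP; apply: cV2P; rewrite ?mxE.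
Qed.

Lemma det2_eq0 v x : v != 0 -> det2 v x = 0 -> exists t, x = t *: v.
Proof.
move=> v0 vx; have [w vw] := det2_nz v0.
by exists (det2 x w / det2 v w); rewrite {1}(det2_dec x vw) vx mul0r scale0r addr0.
Qed.

Lemma det2_small v e x : small e x -> 0 < e -> `|det2 v x| <= (`|v 0 0| + `|v 1 0|) * e.
Proof.
move=> sx e0; rewrite /det2 (le_trans (ler_normB _ _)) // !normrM mulrDl.
by apply: lerD; apply: ler_wpM2l => //; apply: ltW; exact: sx.
Qed.

Section ClosedSubgroup.
Variable A : set V.
Hypothesis A0 : A 0.
Hypothesis AB : forall x y, A x -> A y -> A (x - y).
Hypothesis clA : forall x, (forall e, 0 < e -> exists2 a, A a & small e (x - a)) -> A x.

Lemma subgroupN x : A x -> A (- x).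
Proof. by move=> Ax; rewrite -[- x]add0r; exact: AB. Qed.

Lemma subgroupD x y : A x -> A y -> A (x + y).
Proof. by move=> Ax Ay; rewrite -[y]opprK; apply: AB => //; exact: subgroupN. Qed.

Lemma subgroup_int x (n : int) : A x -> A (n%:~R *: x).
Proof.
move=> Ax; have nat (m : nat) : A (m%:R *: x).
  by elim: m => [|m IH]; rewrite ?scale0r // -[m.+1%:R]natr1 scalerDl scale1r; exact: subgroupD.
case: n => m; first exact: nat.
by rewrite NegzE mulrNz scaleNr; apply: subgroupN; exact: nat.
Qed.

Lemma floor_dist (t b : R) : b != 0 -> `|t - (Num.floor (t / b))%:~R * b| <= `|b|.
Proof.
move=> b0; have -> : t - (Num.floor (t / b))%:~R * b = (t / b - (Num.floor (t / b))%:~R) * b.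
  by rewrite mulrBl divfK.
rewrite normrM; apply: ler_piMl => //.
rewrite ger0_norm; last by rewrite subr_ge0 floor_le.
by rewrite lerBlDl ltW // -[1]/(1%:~R) -intrD floorD1_gt.
Qed.

Hypothesis nondiscrete : forall e, 0 < e -> exists a, [/\ A a, small e a & a != 0].

(** If each coordinate failed to dominate below some scale, a nonzero element smaller than both
    scales would be a contradiction. Dividing by the dominant coordinate [i] keeps slopes in
    [-1, 1]. *)
Lemma small_dominant : exists i j : 'I_2, (forall k, k = i \/ k = j) /\
  forall e, 0 < e -> exists a, [/\ A a, small e a, a i 0 != 0 & `|a j 0| <= `|a i 0|].
Proof.
pose Q (i j : 'I_2) := forall e, 0 < e ->
  exists a, [/\ A a, small e a, a i 0 != 0 & `|a j 0| <= `|a i 0|].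
have [h01|h01] := pselect (Q 0 1).
  by exists 0, 1; split=> // k; exact: ord2_cases.
have [h10|h10] := pselect (Q 1 0).
  by exists 1, 0; split=> // k; case: (ord2_cases k); [right|left].
exfalso; have [e1 n1] := (existsNP _).2 h01; have [e2 n2] := (existsNP _).2 h10.
have [e10 m1] := (not_implyP _ _).1 n1; have [e20 m2] := (not_implyP _ _).1 n2.
have e0 : 0 < Num.min e1 e2 by rewrite lt_min e10.
have [a [Aa sa a0]] := nondiscrete e0.
have s1 : small e1 a by move=> k; apply: lt_le_trans (sa k) _; rewrite ge_min lexx.
have s2 : small e2 a by move=> k; apply: lt_le_trans (sa k) _; rewrite ge_min lexx orbT.
have [le|le] := leP `|a 1 0| `|a 0 0|.
  apply: m1; exists a; split=> //; apply: contraNneq a0 => a00.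
  move: le; rewrite a00 normr0 normr_le0 => /eqP a10.
  by apply/eqP; apply: cV2P; rewrite mxE.
apply: m2; exists a; split=> //; last exact: ltW.
by apply: contraTneq le => ->; rewrite normr0 -leNgt.
Qed.

(** Small elements of [A] have slopes accumulating at some [s]. Integer multiples of those with
    slope near [s] approximate every point of the line of slope [s], which [A] contains by
    closedness. *)
Lemma subgroup_line : exists2 v, v != 0 & forall t, A (t *: v).
Proof.
have [i [j [ij dom]]] := small_dominant.
have ji : j != i.
  apply/eqP => jE; subst j.
  have e0 : 0 = i :> 'I_2 by case: (ij 0).
  have e1 : 1 = i :> 'I_2 by case: (ij 1).
  by move: e1; rewrite -e0.
pose I : set R := `[-1, 1]%classic.
(* An accumulation point of slopes at all scales, by compactness of [-1, 1]. *)
have [s Is sP] : exists2 s, I s & forall e d, 0 < e -> 0 < d ->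
    exists a, [/\ A a, small e a, a i 0 != 0, `|a j 0| <= `|a i 0| & `|a j 0 / a i 0 - s| < d].
  apply: contrapT => no.
  have bad s : I s -> exists e d, [/\ 0 < e, 0 < d & forall a, A a -> small e a ->
      a i 0 != 0 -> `|a j 0| <= `|a i 0| -> ~ `|a j 0 / a i 0 - s| < d].
    move=> Is; apply: contrapT => nb; apply: no; exists s => // e d e0 d0.
    apply: contrapT => na; apply: nb; exists e, d; split=> // a Aa sa ai aj ad.
    by apply: na; exists a.
  (* The scale is a parameter tending to 0 from both sides, hence the absolute value. If no slope
     accumulated, some fixed scale would admit no slope in [-1, 1] at all. *)
  pose P (e s : R) := forall a, A a -> small `|e| a -> a i 0 != 0 ->
    `|a j 0| <= `|a i 0| -> a j 0 / a i 0 <> s.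
  have /nbhs_ballP[r /= r0 rP] : \forall e \near (0 : R), forall s, I s -> P e s.
    apply: (near_forall_compact (P := P)); first exact: segment_compact.
    move=> s /bad[e [d [e0 d0 ed]]].
    exists (ball (0 : R) e, ball s d); first by split; apply/nbhs_ballP; [exists e|exists d].
    move=> [e' s'] /= []; rewrite -!ball_normE /= sub0r normrN => ee' ss' a Aa sa ai aj as'.
    apply: (ed a) => //; last by rewrite as' distrC.
    by move=> k; apply: lt_trans (sa k) ee'.
  have r2 : 0 < r / 2 by rewrite divr_gt0.
  have [a [Aa sa ai aj]] := dom _ r2.
  have Br : ball (0 : R) r (r / 2).
    by rewrite -ball_normE /= sub0r normrN gtr0_norm // ltr_pdivrMr // mulr_natr mulr2n ltrDl.
  have Ia : I (a j 0 / a i 0).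
    by rewrite /I /= in_itv /= -ler_norml normf_div ler_pdivrMr ?normr_gt0 // mul1r.
  by apply: (rP _ Br _ Ia a) => //; rewrite gtr0_norm.
have s1 : `|s| <= 1 by move: Is; rewrite /I /= in_itv /= -ler_norml.
pose v : V := \col_k (if k == i then 1 else s).
have vi : v i 0 = 1 by rewrite mxE eqxx.
have vj : v j 0 = s by rewrite mxE (negbTE ji).
exists v.
  by apply/eqP => v0; move: vi; rewrite v0 mxE => /eqP; rewrite eq_sym oner_eq0.
move=> t; apply: clA => e e0.
have e2 : 0 < e / 2 by rewrite divr_gt0.
have d0 : 0 < e / 2 / (`|t| + 1) by rewrite divr_gt0 // ltr_wpDl.
have [a [Aa sa ai aj ad]] := sP _ _ e2 d0.
pose n := Num.floor (t / a i 0).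
exists (n%:~R *: a); first exact: subgroup_int.
have bi := floor_dist t ai; rewrite -/n in bi.
have hi : `|t - n%:~R * a i 0| < e / 2 by apply: le_lt_trans bi (sa i).
move=> k; case: (ij k) => ->; rewrite !mxE -?/(v _ _).
  rewrite eqxx mulr1; apply: lt_le_trans hi _.
  by rewrite ler_pdivrMr // ler_pMr // ler1n.
rewrite (negbTE ji).
(* The error of the slope plus the error of rounding to a multiple of [a]; each contributes at most
   [e / 2]. *)
have -> : t * s - n%:~R * a j 0 =
    t * (s - a j 0 / a i 0) + (a j 0 / a i 0) * (t - n%:~R * a i 0).
  by field.
rewrite (splitr e); apply: le_lt_trans (ler_normD _ _) _; rewrite !normrM.
apply: ler_ltD; last first.
  apply: le_lt_trans hi; apply: ler_piMl => //.
  by rewrite normfV ler_pdivrMr ?mul1r ?normr_gt0.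
rewrite distrC; have h : `|t| * `|a j 0 / a i 0 - s| <= `|t| * (e / 2 / (`|t| + 1)).
  by apply: ler_wpM2l => //; exact: ltW.
apply: le_trans h _; rewrite mulrCA; apply: ler_piMr; first exact: ltW.
by rewrite ler_pdivrMr ?mul1r ?lerDl // ltr_wpDl.
Qed.

(** Otherwise [A] has elements with arbitrarily small nonzero transversal coordinate; their
    multiples, together with the line of [v], are dense, and [A] would be everything. *)
Lemma subgroup_gap v : v != 0 -> (forall t, A (t *: v)) -> (exists x, ~ A x) ->
  exists2 d, 0 < d & forall a, A a -> `|det2 v a| < d -> det2 v a = 0.
Proof.
move=> v0 Av [x nAx]; apply: contrapT => no; apply: nAx.
have [u vu] := det2_nz v0; apply: clA => e e0.
(* Bounds the coordinates of the multiple of [u] with transversal coordinate 1; the added 1 makes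
   the bound strict and positive. *)
pose B := (`|u 0 0| + `|u 1 0|) / `|det2 v u| + 1.
have B0 : 0 < B by rewrite ltr_wpDl // divr_ge0 // addr_ge0.
have [a [Aa ae a0]] : exists a, [/\ A a, `|det2 v a| < e / B & det2 v a != 0].
  apply: contrapT => na; apply: no; exists (e / B); first by rewrite divr_gt0.
  by move=> a Aa ae; apply: contrapT => /eqP a0; apply: na; exists a.
pose n := Num.floor (det2 v x / det2 v a).
pose y := x - n%:~R *: a.
exists (n%:~R *: a + (det2 y u / det2 v u) *: v); first by apply: subgroupD; [exact: subgroup_int|exact: Av].
have -> : x - (n%:~R *: a + (det2 y u / det2 v u) *: v) = (det2 v y / det2 v u) *: u.
  by rewrite opprD addrA -/y {1}(det2_dec y vu) addrAC subrr add0r.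
have yn : `|det2 v y| < e / B.
  by rewrite /y det2B det2Z; apply: le_lt_trans (floor_dist _ a0) ae.
move=> k; rewrite mxE normrM normf_div mulrAC -mulrA.
have uB : `|u k 0| / `|det2 v u| < B.
  apply: (@le_lt_trans _ _ ((`|u 0 0| + `|u 1 0|) / `|det2 v u|)); last by rewrite ltrDl.
  by rewrite ler_pM2r ?invr_gt0 ?normr_gt0 //; case: (ord2_cases k) => ->; rewrite ?lerDl ?lerDr.
rewrite -[e](divfK (lt0r_neq0 B0)).
apply: ltr_pM => //; by rewrite divr_ge0.
Qed.

End ClosedSubgroup.

End Plane.

(** * Linear parts *)

Section LinearParts.
Variable R : realType.
Local Notation V := 'cV[R]_2.

Definition intv (y : V) := forall i, y i 0 \is a Num.int.

Lemma intvP y : intv y -> exists z : 'cV[int]_2, y = map_mx intr z.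
Proof.
move=> iy; exists (\col_i Num.floor (y i 0)); apply/matrixP => i j.
by rewrite (ord1 j) !mxE; have /intrP[n ->] := iy i; rewrite intrKfloor.
Qed.

Lemma intv_map (z : 'cV[int]_2) : intv (map_mx intr z).
Proof. by move=> i; rewrite mxE; apply/intrP; exists (z i 0). Qed.

Lemma intvB x y : intv x -> intv y -> intv (x - y).
Proof. by move=> ix iy i; rewrite !mxE rpredB. Qed.

Lemma intvN x : intv x -> intv (- x).
Proof. by move=> ix i; rewrite !mxE rpredN. Qed.

Lemma intv_delta (i : 'I_2) : intv (delta_mx i 0).
Proof. by move=> j; rewrite mxE; case: (_ && _). Qed.

Lemma finite_order (s : seq 'M[R]_2) (M : 'M[R]_2) : M \in unitmx ->
  (forall n, M ^+ n.+1 \in s) -> exists2 n, (0 < n)%N & M ^+ n = 1.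
Proof.
move=> uM Ms; pose t := [seq M ^+ i.+1 | i <- iota 0 (size s).+1].
have : ~~ uniq t.
  apply/negP => ut; have ts : {subset t <= s} by move=> _ /mapP[i _ ->]; exact: Ms.
  by have := uniq_leq_size ut ts; rewrite size_map size_iota ltnn.
move=> /(uniqPn 0)[i [j [ij]]]; rewrite size_map size_iota => js.
rewrite !(nth_map 0%N) ?size_iota // ?(ltn_trans ij) // !nth_iota // ?(ltn_trans ij) // !add0n.
move=> E; exists (j - i)%N; first by rewrite subn_gt0.
have uMi : M ^+ i.+1 \is a GRing.unit by rewrite unitrX.
apply: (mulrI uMi); rewrite mulr1 -exprD E; congr (_ ^+ _).
by rewrite addSn subnKC // ltnW.
Qed.

(** As [N] squares to zero, the power is [1 + n N]. *)
Lemma unipotent_finite_order (N : 'M[R]_2) n : (0 < n)%N ->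
  N * N = 0 -> (1 + N) ^+ n = 1 -> N = 0.
Proof.
move=> n0 NN; have -> : (1 + N) ^+ n = 1 + N *+ n.
  elim: n {n0} => [|n IH]; first by rewrite mulr0n addr0 expr0.
  by rewrite exprS IH mulrDl mul1r mulrDr mulr1 mulrnAr NN mul0rn addr0 -addrA -mulrSr.
move/eqP; rewrite -subr_eq0 addrAC subrr add0r => /eqP /matrixP h.
apply/matrixP => i j; have := h i j; rewrite !mxE mulmxnE => /eqP.
by rewrite mulrn_eq0 eqn0Ngt n0 => /eqP.
Qed.

Lemma root_of_unity_sqr (x : R) n : (0 < n)%N -> x ^+ n = 1 -> x ^+ 2 = 1.
Proof.
move=> n0 xn; have /eqP : `|x| ^+ n = 1 by rewrite -normrX xn normr1.
by rewrite pexpr_eq1 ?normr_ge0 // => /eqP x1; rewrite -real_normK ?num_real// x1 expr1n.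
Qed.

Lemma matrix2_eq (M N : 'M[R]_2) (v u : V) : det2 v u != 0 ->
  M *m v = N *m v -> M *m u = N *m u -> M = N.
Proof.
move=> vu Mv Mu; have h (x : V) : M *m x = N *m x.
  by rewrite (det2_dec x vu) !mulmxDr -!scalemxAr Mv Mu.
by apply/matrixP => i j; have := h (delta_mx j 0); rewrite -!colE => /colP/(_ i); rewrite !mxE.
Qed.

(** In the basis [v], [u] the matrix is triangular with real roots of unity, that is 1 or -1, on the
    diagonal. Its square is then unipotent of finite order, hence the identity. *)
Lemma triangular_involution (M : 'M[R]_2) (v : V) n : v != 0 -> (0 < n)%N ->
  M ^+ n = 1 -> det2 v (M *m v) = 0 ->
  M *m M = 1%:M /\ exists2 mu, mu ^+ 2 = 1 & M *m v = mu *: v.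
Proof.
move=> v0 n0 Mn vMv; have [u vu] := det2_nz v0.
have [mu Mv] := det2_eq0 v0 vMv.
pose nu := det2 v (M *m u) / det2 v u; pose b := det2 (M *m u) u / det2 v u.
have Mu : M *m u = b *: v + nu *: u by rewrite {1}(det2_dec (M *m u) vu).
have powv k : M ^+ k *m v = mu ^+ k *: v.
  elim: k => [|k IH]; first by rewrite !expr0 mul1mx scale1r.
  by rewrite !exprSr -mulmxE -mulmxA Mv -scalemxAr IH scalerA mulrC -exprSr.
have powu k : det2 v (M ^+ k *m u) = nu ^+ k * det2 v u.
  elim: k => [|k IH]; first by rewrite !expr0 mul1mx mul1r.
  rewrite !exprSr -mulmxE -mulmxA Mu mulmxDr -!scalemxAr powv det2D !det2Z det2xx !mulr0 add0r.
  by rewrite IH mulrCA mulrA.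
have mu2 : mu ^+ 2 = 1.
  apply: (root_of_unity_sqr n0); have := powv n; rewrite Mn mul1mx => /eqP.
  rewrite -{1}[v]scale1r -subr_eq0 -scalerBl scaler_eq0 (negbTE v0) orbF subr_eq0.
  by move/eqP.
have nu2 : nu ^+ 2 = 1.
  apply: (root_of_unity_sqr n0); have := powu n; rewrite Mn mul1mx => /eqP.
  by rewrite -{1}[det2 v u]mul1r (inj_eq (mulIf vu)) => /eqP.
split; last by exists mu.
pose N := M ^+ 2 - 1.
have Nv : N *m v = 0 by rewrite mulmxBl powv mu2 mul1mx scale1r subrr.
have Nu : exists c, N *m u = c *: v.
  apply: det2_eq0 => //; rewrite mulmxBl det2B powu nu2 mul1mx mul1r subrr //.
have NN : N * N = 0.
  apply: (matrix2_eq vu); rewrite -mulmxE -mulmxA ?Nv ?mulmx0 ?mul0mx //.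
  by have [c ->] := Nu; rewrite -scalemxAr Nv scaler0.
have N0 : N = 0.
  apply: (unipotent_finite_order n0 NN).
  by rewrite /N addrCA subrr addr0 -exprM mulnC exprM Mn expr1n.
by move/eqP: N0; rewrite subr_eq0 expr2 -mulmxE => /eqP.
Qed.

Section InvariantComplement.
Variables (v : V) (Lin : 'M[R]_2 -> Prop) (s : seq 'M[R]_2).
Hypothesis v0 : v != 0.
Hypothesis Lin_mul : forall M N, Lin M -> Lin N -> Lin (M *m N).
Hypothesis Lin_unit : forall M, Lin M -> M \in unitmx.
Hypothesis Lin_int : forall M y, Lin M -> intv y -> intv (M *m y).
Hypothesis Lin_v : forall M, Lin M -> det2 v (M *m v) = 0.
Hypothesis Lin_fin : forall M, Lin M -> M \in s.

Lemma Lin_involution M : Lin M ->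
  M *m M = 1%:M /\ exists2 mu, mu ^+ 2 = 1 & M *m v = mu *: v.
Proof.
move=> LM; have [|n n0 Mn] := finite_order (s := s) (Lin_unit LM).
  move=> n; apply: Lin_fin; elim: n => [|n IH]; first by rewrite expr1.
  by rewrite exprS; apply: Lin_mul.
exact: triangular_involution v0 n0 Mn (Lin_v LM).
Qed.

(** The product of the two involutions is again an involution. *)
Lemma Lin_comm M N : Lin M -> Lin N -> M *m N = N *m M.
Proof.
move=> LM LN; have [MM _] := Lin_involution LM; have [NN _] := Lin_involution LN.
have [MNMN _] := Lin_involution (Lin_mul LM LN).
have := congr1 (fun X => M *m X *m N) MNMN.
by rewrite mulmx1 !mulmxA MM mul1mx -[N *m M *m N *m N]mulmxA NN mulmx1 => ->.
Qed.

(** If every linear part is scalar, a coordinate vector off the line of [v] will do. Otherwise some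
    nonscalar [M0] acts on [v] by [mu], which is 1 or -1. Its other eigenline is the image of
    [M0 - mu], an integral matrix, so it contains a nonzero integer vector; it is preserved by
    everything that commutes with [M0]. *)
Lemma invariant_complement : exists w, [/\ intv w, det2 v w != 0 &
  forall M, Lin M -> exists2 r, r != 0 & M *m w = r *: w].
Proof.
have [allpm|/existsNP[M0 /not_implyP[LM0 nM0]]] :=
    pselect (forall M, Lin M -> exists2 r : R, r ^+ 2 = 1 & M = r%:M).
  have [i vi] : exists i : 'I_2, det2 v (delta_mx i 0) != 0.
    apply: contrapT => no; move: v0; apply/negP/negPn/eqP.
    have h i : det2 v (delta_mx i 0) = 0 by apply: contrapT => /eqP ?; apply: no; exists i.
    have := h 0; have := h 1; rewrite /det2 !mxE /= !mulr1 !mulr0 subr0 sub0r => v00 /eqP.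
    by rewrite oppr_eq0 => /eqP v10; apply: cV2P; rewrite !mxE.
  exists (delta_mx i 0); split=> // [|M /allpm[r r2 ->]]; first exact: intv_delta.
  exists r; last by rewrite mul_scalar_mx.
  by apply: contra_eq_neq r2 => ->; rewrite expr0n /= eq_sym oner_neq0.
have [MM [mu mu2 Mv]] := Lin_involution LM0.
have mu01 : mu = 1 \/ mu = -1.
  by move/eqP: mu2; rewrite sqrf_eq1 => /orP[/eqP->|/eqP->]; [left|right].
have mu0 : mu != 0 by apply: contra_eq_neq mu2 => ->; rewrite expr0n /= eq_sym oner_neq0.
pose P := M0 - mu%:M.
have [i Pi] : exists i : 'I_2, P *m (delta_mx i 0 : V) != 0.
  apply: contrapT => no; apply: nM0; exists mu => //; apply/eqP; rewrite -subr_eq0 -/P; apply/eqP.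
  have h i : P *m (delta_mx i 0 : V) = 0 by apply: contrapT => /eqP ?; apply: no; exists i.
  apply/matrixP => k j; have := h j; rewrite -colE => /colP/(_ k).
  by rewrite [in X in X -> _]mxE => ->; rewrite !mxE.
set w := P *m (delta_mx i 0 : V) in Pi.
(* [(M0 + mu) (M0 - mu) = 0], because [M0] and [mu] both square to 1. *)
have M0w : M0 *m w = - mu *: w.
  rewrite /w mulmxA /P mulmxBr MM mul_mx_scalar scalemxAl; congr (_ *m _).
  by rewrite scalerBr scale_scalar_mx mulNr -expr2 mu2 scaleNr rmorphN /= opprK addrC.
have vw : det2 v w != 0.
  apply/eqP => /(det2_eq0 v0)[t wt]; move: M0w; rewrite wt -scalemxAr Mv !scalerA => /eqP.
  rewrite -subr_eq0 -scalerBl scaler_eq0 (negbTE v0) orbF mulNr opprK mulrC -mulr2n.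
  rewrite mulrn_eq0 /= mulf_eq0 (negbTE mu0) /= => /eqP t0.
  by move: Pi; rewrite wt t0 scale0r eqxx.
exists w; split=> // [|M LM].
  rewrite /w /P mulmxBl mul_scalar_mx; apply: intvB; first by apply: Lin_int => //; exact: intv_delta.
  case: mu01 => ->; rewrite ?scale1r ?scaleN1r; [|apply: intvN]; exact: intv_delta.
have [MM' [mu' mu'2 Mv']] := Lin_involution LM.
have E : M0 *m (M *m w) = - mu *: (M *m w).
  by rewrite mulmxA (Lin_comm LM0 LM) -mulmxA M0w -scalemxAr.
have := det2_dec (M *m w) vw; set a := _ / _; set r := _ / _ => Mw.
(* [M *m w] is an eigenvector of [M0] for [- mu], so it has no component along [v], whose eigenvalue
   is [mu]. *)
have a0 : a = 0.
  move: E; rewrite Mw mulmxDr -!scalemxAr Mv M0w scalerDr => /eqP.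
  rewrite !scalerA [r * _]mulrC -subr_eq0 opprD addrACA subrr addr0 -scalerBl scaler_eq0.
  rewrite (negbTE v0) orbF mulNr opprK mulrC -mulr2n mulrn_eq0 /= mulf_eq0 (negbTE mu0) /=.
  by move/eqP.
rewrite a0 scale0r add0r in Mw; exists r => //.
apply: contraNneq vw => r0; have : M *m (M *m w) = 0 by rewrite Mw r0 scale0r mulmx0.
by rewrite mulmxA MM' mul1mx => ->; rewrite /det2 !mxE !mulr0 subrr.
Qed.

End InvariantComplement.

(** Divides by the gcd. The Bezout coefficients [a] and [b] certify primitivity, and recover [t]
    modulo the integers from [t w] modulo integer vectors. *)
Lemma primitive_vector (w : V) : intv w -> w != 0 ->
  exists (w' : V) (a b d : R), [/\ intv w', a \is a Num.int, b \is a Num.int,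
    a * w' 0 0 + b * w' 1 0 = 1 & d != 0 /\ w = d *: w'].
Proof.
move=> iw w0; have [z wz] := intvP iw.
pose g := gcdz (z 0 0) (z 1 0).
have g0 : g != 0.
  apply: contraNneq w0 => /eqP; rewrite gcdz_eq0 => /andP[/eqP z0 /eqP z1].
  by rewrite wz; apply/eqP; apply: cV2P; rewrite !mxE ?z0 ?z1.
have [u [v uv]] := Bezoutz (z 0 0) (z 1 0).
pose z' : 'cV[int]_2 := \col_i (z i ord0 %/ g)%Z.
have zE i : z i 0 = z' i 0 * g.
  rewrite mxE divzK //; case: (ord2_cases i) => ->; [exact: dvdz_gcdl|exact: dvdz_gcdr].
have gR : (g%:~R : R) != 0 by rewrite intr_eq0.
exists (map_mx intr z'), u%:~R, v%:~R, g%:~R; split.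
- exact: intv_map.
- by apply/intrP; exists u.
- by apply/intrP; exists v.
- apply: (mulIf gR); rewrite mul1r [in RHS]/g -uv; rewrite !mxE.
  have e0 := zE 0; have e1 := zE 1; rewrite !mxE in e0 e1.
  by rewrite mulrDl -!mulrA -!intrM -e0 -e1 -intrD.
- split=> //; rewrite wz; apply/matrixP => i j; rewrite (ord1 j) 3!mxE zE.
  by rewrite intrM mulrC.
Qed.

End LinearParts.

(** * The torus *)

Section CircleMap.
Variable R : realType.

Definition expi (t : R) : R * R := (cos (pi *+ 2 * t), sin (pi *+ 2 * t)).

Lemma expi_circle t : unit_circle (expi t).
Proof. exact: cos2Dsin2. Qed.

Lemma expi_cts : continuous expi.
Proof.
have m : continuous (fun t : R => pi *+ 2 * t) by move=> t; exact: mulrl_continuous.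
apply: pair_cts.
  exact: (comp_cts m (@continuous_cos R)).
exact: (comp_cts m (@continuous_sin R)).
Qed.

Lemma expi_nat t (n : nat) : expi (t + n%:R) = expi t.
Proof.
elim: n => [|n IH]; first by rewrite addr0.
rewrite -natr1 addrA -[RHS]IH /expi mulrDr mulr1.
by rewrite cosD2pi sinD2pi.
Qed.

Lemma expi_int t (n : int) : expi (t + n%:~R) = expi t.
Proof.
case: n => n; first exact: expi_nat.
by rewrite -[in RHS](subrK n.+1%:R t) expi_nat NegzE mulrNz.
Qed.

Lemma expi_sub s t : expi s = expi t -> expi (s - t) = (1, 0).
Proof.
rewrite /expi mulrBr cosB sinB => -[-> ->].
by rewrite -!expr2 cos2Dsin2 mulrC subrr.
Qed.

Lemma expi_eq1 t : 0 <= t < 1 -> expi t = (1, 0) -> t = 0.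
Proof.
move=> /andP[t0 t1] [c _]; have p0 : 0 < (pi : R) := pi_gt0 R.
have z : (0 : R) \in `[0, pi] by rewrite in_itv /= lexx ltW.
have p2 : 0 < (pi : R) *+ 2 by rewrite mulrn_wgt0.
have [le|gt] := leP (pi *+ 2 * t) pi.
  have h : pi *+ 2 * t \in `[0, pi] by rewrite in_itv /= le andbT mulr_ge0 // ltW.
  have /eqP : pi *+ 2 * t = 0 by apply: (cos_inj h z); rewrite c cos0.
  by rewrite mulf_eq0 (gt_eqF p2) => /eqP.
(* Past the half turn, [1 - t] takes the place of [t], to return to the interval on which [cos] is
   injective. *)
have h : pi *+ 2 * (1 - t) \in `[0, pi].
  rewrite in_itv /=; apply/andP; split; first by rewrite mulr_ge0 ?subr_ge0 // ltW.
  by rewrite mulrBr mulr1 {1}mulr2n lerBlDl lerD2r ltW.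
have /eqP : pi *+ 2 * (1 - t) = 0.
  by apply: (cos_inj h z); rewrite mulrBr mulr1 cosB cos2pi sin2pi c mul1r mul0r addr0 cos0.
by rewrite mulf_eq0 (gt_eqF p2) /= subr_eq0 => /eqP E; move: t1; rewrite -E ltxx.
Qed.

Lemma expi_eq s t : expi s = expi t <-> s - t \is a Num.int.
Proof.
split=> [/expi_sub h|/intrP[n E]]; last by rewrite -(subrK t s) E addrC expi_int.
pose f := (s - t) - (Num.floor (s - t))%:~R.
have f0 : f = 0.
  apply: expi_eq1; last by rewrite /f -mulrNz expi_int.
  by rewrite /f subr_ge0 floor_le /= ltrBlDl -[1]/(1%:~R) -intrD floorD1_gt.
by move/eqP: f0; rewrite subr_eq0 => /eqP ->; rewrite intr_int.
Qed.

Lemma expi_surj (p : R * R) : unit_circle p -> exists t, expi t = p.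
Proof.
case: p => a b; rewrite /unit_circle /= => ab.
have p0 : (pi : R) *+ 2 != 0 by rewrite mulrn_eq0 /= gt_eqF // pi_gt0.
have a1 : -1 <= a <= 1.
  rewrite -ler_norml -(ler_pXn2r (n := 2)) ?nnegrE // expr1n real_normK ?num_real //.
  by rewrite -ab lerDl sqr_ge0.
have sb : sin (acos a) = `|b|.
  by rewrite sin_acos // -ab addrAC subrr add0r sqrtr_sqr.
have ca : cos (acos a) = a by rewrite acosK // in_itv.
have [b0|b0] := leP 0 b.
  exists (acos a / (pi *+ 2)); rewrite /expi mulrC divfK // ca sb ger0_norm //.
exists (- acos a / (pi *+ 2)); rewrite /expi mulrC divfK // cosN sinN ca sb.
by rewrite ltr0_norm // opprK.
Qed.

Lemma frac_itv (t : R) : exists2 s : `[0, (1 : R)]%classic, True & t - \val s \is a Num.int.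
Proof.
have h : `[0, (1 : R)]%classic (t - (Num.floor t)%:~R).
  by rewrite /= in_itv /= subr_ge0 floor_le /= lerBlDl ltW // -[1]/(1%:~R) -intrD floorD1_gt.
by exists (set_elt h) => //=; rewrite opprB addrC subrK intr_int.
Qed.

End CircleMap.

Section TorusTopology.
Variables (R : realType) (L : lattice R) (B : 'M[R]_2).
Local Notation V := 'cV[R]_2.
Hypothesis uB : B \in unitmx.
Hypothesis LB : lattice_set L = [set B *m map_mx intr z | z in [set: 'cV[int]_2]].

(* Coordinates in which the lattice is Z^2. *)
Definition tq (y : V) : torus L := torus_pi L (B *m y).

Lemma tq_eq y y' : tq y = tq y' <-> intv (y - y').
Proof.
rewrite /tq /torus_pi; split.
  move/eqmodP/asboolP; rewrite LB => -[z _]; rewrite -mulmxBr => E i.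
  by rewrite -(mulKmx uB (y - y')) -E mulKmx // mxE intr_int.
move=> /intvP[z zE]; apply/eqmodP/asboolP; rewrite LB; exists z => //.
by rewrite -mulmxBr zE.
Qed.

Lemma tq_shift y z : intv z -> tq (y + z) = tq y.
Proof. by move=> iz; apply/tq_eq; rewrite addrAC subrr add0r. Qed.

Lemma mulB_cts (A : 'M[R]_2) : continuous (fun y : V => A *m y).
Proof. by apply: mulmx_cts; [exact: const_cts|exact: id_cts]. Qed.

Lemma tq_cts : continuous tq.
Proof.
apply: (@comp_cts V V (torus L) (fun y => B *m y) (torus_pi L)); first exact: mulB_cts.
exact: pi_continuous.
Qed.

Lemma tq_surj x : exists y, tq y = x.
Proof.
exists (invmx B *m repr (x : {eq_quot lattice_equiv L}%qT)).
by rewrite /tq mulKVmx // /torus_pi reprK.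
Qed.

Lemma addV_cts (X : topologicalType) (f g : X -> V) :
  continuous f -> continuous g -> continuous (fun x => f x + g x).
Proof. by move=> cf cg x; exact: cvgD (cf x) (cg x). Qed.

Lemma tq_open : open_map tq.
Proof.
apply: (@open_map_orbits V (torus L) tq 'cV[int]_2 (fun z y => y + map_mx intr z)).
- move=> A oA; apply: (_ : open (torus_pi L @^-1` A)).
  rewrite (_ : _ @^-1` A = (fun x => invmx B *m x) @^-1` (tq @^-1` A)).
    by apply: (open_preim _ oA); exact: mulB_cts.
  by apply/funext => x; rewrite /preimage /tq /= mulKVmx.
- by move=> z; apply: addV_cts; [exact: id_cts|exact: const_cts].
move=> x y; rewrite tq_eq; split=> [/intvP[z zE]|[z ->]].
  by exists z; rewrite -zE addrC subrK.
by rewrite addrAC subrr add0r; exact: intv_map.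
Qed.

Lemma torus_descend (W : topologicalType) (f : torus L -> W) :
  continuous (fun y => f (tq y)) -> continuous f.
Proof.
move=> cf x; have [y <-] := tq_surj x.
exact: (open_map_descend (f := f) tq_open (cf y)).
Qed.

Lemma torus_compact : compact [set: torus L].
Proof.
pose I := `[0, (1 : R)]%classic.
pose f (p : R * R) : torus L := tq (\col_i if i == 0 then p.1 else p.2).
have fc : continuous f.
  apply: (@comp_cts (R * R)%type V _ _ tq); last exact: tq_cts.
  apply: mx_cts => i j; under [X in continuous X]eq_fun do rewrite mxE.
  by case: (i == 0); [exact: fst_cts|exact: snd_cts].
rewrite (_ : setT = f @` (I `*` I)).
  apply: continuous_compact; first exact: continuous_subspaceT.
  by apply: compact_setX; exact: segment_compact.
apply/seteqP; split=> // x _; have [y <-] := tq_surj x.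
have [s0 _ i0] := frac_itv (y 0 0); have [s1 _ i1] := frac_itv (y 1 0).
exists (\val s0, \val s1); first by split; [exact: set_mem (valP s0)|exact: set_mem (valP s1)].
apply/esym/tq_eq => i; rewrite !mxE /=.
by case: (ord2_cases i) => ->.
Qed.

(** The exponentials of the two lattice coordinates inject the torus continuously into a Hausdorff
    space. *)
Lemma torus_hausdorff : hausdorff_space (torus L).
Proof.
have [s sK] := choice tq_surj.
pose f (x : torus L) := (expi (s x 0 0), expi (s x 1 0)).
have fE y : f (tq y) = (expi (y 0 0), expi (y 1 0)).
  have /tq_eq h := sK (tq y).
  by apply: f_equal2; apply/expi_eq; [have := h 0|have := h 1]; rewrite !mxE.
apply: (@hausdorff_inj _ ((R * R) * (R * R))%type f).
- apply: (@norm_hausdorff R ((R * R) * (R * R))%type).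
- apply: torus_descend; rewrite (_ : (fun y => _) = fun y : V => (expi (y 0 0), expi (y 1 0))).
    apply: pair_cts; [apply: (@comp_cts V R _ (fun y : V => y 0 0))|apply: (@comp_cts V R _ (fun y : V => y 1 0))];
      by [exact: coord_continuous|exact: expi_cts].
  by apply/funext => y; exact: fE.
move=> x x'; have [y <-] := tq_surj x; have [y' <-] := tq_surj x'.
rewrite !fE => -[/esym h0 /esym h1 h2 h3]; apply/tq_eq => i; rewrite !mxE.
by case: (ord2_cases i) => ->; apply/expi_eq; rewrite /expi; congr pair.
Qed.

Section Circle.
Variable w : V.
Variables a b : R.
Hypothesis iw : intv w.
Hypothesis ia : a \is a Num.int.
Hypothesis ib : b \is a Num.int.
Hypothesis abw : a * w 0 0 + b * w 1 0 = 1.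

Definition line : set (torus L) := [set tq (t *: w) | t in [set: R]].

Lemma line_eq s t : tq (s *: w) = tq (t *: w) <-> s - t \is a Num.int.
Proof.
rewrite tq_eq -scalerBl; split=> [h|st].
  rewrite -[s - t]mulr1 -abw mulrDr !mulrA ![_ * a]mulrC ![_ * b]mulrC -!mulrA.
  by have := h 0; have := h 1; rewrite !mxE => h1 h0; rewrite rpredD // rpredM.
by move=> i; rewrite mxE rpredM.
Qed.

Lemma line_cts : continuous (fun t : R => tq (t *: w)).
Proof.
apply: (@comp_cts R V _ (fun t : R => t *: w) tq); last exact: tq_cts.
by move=> t; exact: scalel_continuous.
Qed.

Lemma line_frac x : line x -> exists s : `[0, (1 : R)]%classic, tq (\val s *: w) = x.
Proof.
move=> [t _ <-]; have [s _ st] := frac_itv t; exists s; apply/line_eq.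
by rewrite -opprB rpredN.
Qed.

Lemma line_closed : closed line.
Proof.
apply: compact_closed; first exact: torus_hausdorff.
rewrite (_ : line = (fun t => tq (t *: w)) @` `[0, (1 : R)]%classic).
  apply: continuous_compact; last exact: segment_compact.
  by apply: continuous_subspaceT; exact: line_cts.
apply/seteqP; split=> [x /line_frac[s <-]|_ [t _ <-]]; last by exists t.
by exists (\val s) => //; exact: set_mem (valP s).
Qed.

(** The line and the unit circle are both quotients of [0, 1], with the same identifications by
    [line_eq] and [expi_eq]. *)
Lemma line_circle : is_circle R line.
Proof.
have lt t : line (tq (t *: w)) by exists t.
pose I := `[0, (1 : R)]%classic.
pose f (t : I) : @unit_circle R := set_elt (expi_circle (\val t)).
pose g (t : I) : line := set_elt (lt (\val t)).
apply: (@homeo_compact_quot I _ _ f g).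
- by apply: compact_sub; exact: segment_compact.
- exact: (@hausdorff_inj (@unit_circle R) (R * R)%type _
    (@norm_hausdorff R (R * R)%type) (@continuous_set_val _ _) val_inj).
- exact: (@hausdorff_inj line (torus L) _ torus_hausdorff (@continuous_set_val _ _) val_inj).
- apply: continuous_to_set_type => /=.
  exact: (@comp_cts I R _ (fun t : I => \val t) (@expi R) (@continuous_set_val _ _) (@expi_cts R)).
- apply: continuous_to_set_type => /=.
  exact: (@comp_cts I R _ (fun t : I => \val t) (fun t : R => tq (t *: w)) (@continuous_set_val _ _) line_cts).
- move=> p; have [t tp] := expi_surj (set_mem (valP p) : unit_circle (\val p)).
  have [s _ st] := frac_itv t; exists s; apply: val_inj; rewrite /= -tp.
  by apply/expi_eq; rewrite -opprB rpredN.
- by move=> x; have [s sx] := line_frac (set_mem (valP x)); exists s; exact: val_inj.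
- move=> s t; split=> /(congr1 \val) /= h; apply: val_inj => /=.
    by apply/line_eq/expi_eq.
  by apply/expi_eq/line_eq.
Qed.

End Circle.

End TorusTopology.

(** * Affine actions of one-dimensional image *)

Section TopGroupCover.
Variables (G : topGroupType) (Gam : subgrp G).
Hypothesis cG : compact [set: G].
Hypothesis clGam : closed Gam.

Lemma subgroup_finite_cover (N : set G) : nbhs 1%g N ->
  exists2 s : seq Gam, True & forall g : Gam, exists2 h, h \in s & N ((\val h)^-1 * \val g)%g.
Proof.
move=> N1; have cGam : compact (subgrp_set Gam) := subclosed_compact clGam cG (@subsetT _ _).
(* Finite lists ordered by inclusion: compactness along this filter yields one list that serves all
   of [Gam]. *)
pose F := filter_from [set: seq Gam] (fun s => [set t : seq Gam | {subset s <= t}]).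
have FF : Filter F.
  apply: filter_from_filter; first by exists [::].
  move=> s t _ _; exists (s ++ t) => // u stu; split=> x xs; apply: stu;
    by rewrite mem_cat xs ?orbT.
pose P (s : seq Gam) (g : G) := exists2 h, h \in s & N ((\val h)^-1 * g)%g.
have [s _ /(_ s (fun x h => h)) sP] : F [set s | subgrp_set Gam `<=` P s].
  have /compact_near_coveringP near_cov := cGam.
  apply: (near_cov (seq Gam) F P FF) => g Gg.
  have c : continuous (fun g' : G => g^-1 * g')%g.
    by apply: mulg_cts; [exact: const_cts|exact: id_cts].
  have n1 : nbhs (g^-1 * g)%g N by rewrite mulVg.
  exists ((fun g' : G => g^-1 * g')%g @^-1` N, [set t : seq Gam | {subset [:: (set_elt Gg : Gam)] <= t}]).
    by split; [exact: (nbhs_preim (c g) n1)|exists [:: (set_elt Gg : Gam)]].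
  move=> [g' t] /= [Ng' st]; exists (set_elt Gg) => //.
  by apply: st; rewrite inE.
by exists s => // g; exact: (sP (\val g) (sgP g)).
Qed.

End TopGroupCover.

Section NoPlanarInjection.
Variable R : realType.

(* [f (0, 0)] lies strictly between [f (- e, 0)] and [f (e, 0)], so the values
   [f (0, t)] for small [t] are also taken on the horizontal axis. *)
Lemma no_planar_injection (f : R * R -> R) (e : R) : 0 < e ->
  (forall p, `|p.1| <= e -> `|p.2| <= e -> {for p, continuous f}) ->
  (forall p q, `|p.1| <= e -> `|p.2| <= e -> `|q.1| <= e -> `|q.2| <= e -> f p = f q -> p = q) ->
  False.
Proof.
move=> e0 fc fI; have ee : - e <= e by rewrite ge0_cp // ltW.
have n0 : `|0 : R| <= e by rewrite normr0 ltW.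
pose g (s : R) := f (s, 0).
have gc s : `|s| <= e -> {for s, continuous g}.
  move=> se; have h : {for s, continuous (fun s : R => (s, 0 : R))}.
    by apply: pair_cts; [exact: id_cts|exact: const_cts].
  exact: (continuous_comp h (fc (s, 0) se n0)).
have gI s t : `|s| <= e -> `|t| <= e -> g s = g t -> s = t.
  by move=> se te /(fI (s, 0) (t, 0) se n0 te n0) [].
have gw (a b : R) : `|a| <= e -> `|b| <= e -> {within `[a, b], continuous g}.
  move=> ae be; apply: continuous_in_subspaceT => x; rewrite inE /= in_itv /= => /andP[ax xb].
  apply: gc; move: ae be; rewrite !ler_norml => /andP[? ?] /andP[? ?].
  by apply/andP; split; lra.
have ne : `|- e| <= e by rewrite normrN gtr0_norm.
have pe : `|e| <= e by rewrite gtr0_norm.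
(* By the intermediate value theorem and injectivity, no point outside [[a, b]] has its value
   between those of the endpoints. *)
have mid (a b c : R) : `|a| <= e -> `|b| <= e -> `|c| <= e -> a <= b -> c != a -> c != b ->
    ~~ (a <= c <= b) -> ~~ (Num.min (g a) (g b) <= g c <= Num.max (g a) (g b)).
  move=> ae be ce ab ca cb cab; apply/negP => h.
  have [x] := IVT ab (gw a b ae be) h; rewrite in_itv /= => /andP[ax xb] gx.
  have xe : `|x| <= e.
    by move: ae be; rewrite !ler_norml => /andP[? ?] /andP[? ?]; apply/andP; split; lra.
  by have := gI _ _ xe ce gx => xc; move: cab; rewrite -xc ax xb.
have h1 : ~~ (Num.min (g (- e)) (g 0) <= g e <= Num.max (g (- e)) (g 0)).
  by apply: mid => //; rewrite ?oppr_le0 ?(ltW e0) //; try (by apply/eqP; lra); apply/negP => /andP[_]; lra.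
have h2 : ~~ (Num.min (g 0) (g e) <= g (- e) <= Num.max (g 0) (g e)).
  by apply: mid => //; rewrite ?(ltW e0) //; try (by apply/eqP; lra); apply/negP => /andP[+ _]; lra.
have h3 : Num.min (g (- e)) (g e) < g 0 < Num.max (g (- e)) (g e).
  have d1 : g (- e) <> g 0 by move=> /(gI _ _ ne n0); lra.
  have d2 : g e <> g 0 by move=> /(gI _ _ pe n0); lra.
  have d3 : g e <> g (- e) by move=> /(gI _ _ pe ne); lra.
  move: h1 h2.
  by case: (ltP (g (- e)) (g 0)); case: (ltP (g 0) (g e)); case: (ltP (g (- e)) (g e));
    move=> ? ? ? /negP k1 /negP k2; apply/andP; split; rewrite ltNge; apply/negP => ?;
    first [lra|apply: k1; apply/andP; split; lra|apply: k2; apply/andP; split; lra].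
have hc : {for (0 : R), continuous (fun t : R => f (0, t))}.
  have h : {for (0 : R), continuous (fun t : R => (0 : R, t))}.
    by apply: pair_cts; [exact: const_cts|exact: id_cts].
  exact: (continuous_comp h (fc (0, 0) n0 n0)).
have nb : nbhs (f (0, 0)) [set x | Num.min (g (- e)) (g e) < x < Num.max (g (- e)) (g e)].
  have -> : [set x | Num.min (g (- e)) (g e) < x < Num.max (g (- e)) (g e)] =
    `]Num.min (g (- e)) (g e), Num.max (g (- e)) (g e)[%classic.
    by apply/seteqP; split=> x /=; rewrite in_itv.
  apply: open_nbhs_nbhs; split; first exact: interval_open.
  by rewrite /= in_itv.
have /nbhs_ballP[r /= r0 rP] := nbhs_preim hc nb.
pose t := Num.min (r / 2) e.
have t0 : 0 < t by rewrite lt_min e0 divr_gt0.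
have te : `|t| <= e by rewrite gtr0_norm // ge_min lexx orbT.
have : ball (0 : R) r t.
  rewrite -ball_normE /= sub0r normrN gtr0_norm //.
  apply: (@le_lt_trans _ _ (r / 2)); first by rewrite ge_min lexx.
  by rewrite ltr_pdivrMr // mulr_natr mulr2n ltrDl.
move=> /rP /= /andP[/ltW m1 /ltW m2].
have [|x] := IVT ee (gw _ _ ne pe) (v := f (0, t)); first by rewrite m1.
rewrite in_itv /= -ler_norml => xe /(fI (x, 0) (0, t) xe n0 n0 te) [_ t00].
by move: t0; rewrite -t00 ltxx.
Qed.

End NoPlanarInjection.

Section AffineAction.
Variables (R : realType) (L : lattice R) (B : 'M[R]_2).
Local Notation V := 'cV[R]_2.
Hypothesis uB : B \in unitmx.
Hypothesis LB : lattice_set L = [set B *m map_mx intr z | z in [set: 'cV[int]_2]].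
Local Notation q := (tq L B).
Local Notation q_eq := (tq_eq uB LB).

Definition aff (f : torus L -> torus L) (Z : 'M[R]_2) (c : V) :=
  [/\ Z \in unitmx, forall y, intv y -> intv (Z *m y) &
      forall y, f (q y) = q (Z *m y + c)].

Lemma aff_ex f : Aff L f -> exists Z c, aff f Z c.
Proof.
move=> [A [c [uA AL fE]]]; exists (invmx B *m A *m B), (invmx B *m c); split.
- by rewrite !unitmx_mul unitmx_inv uB uA.
- move=> y /intvP[z ->]; rewrite -!mulmxA.
  have : lattice_set L (A *m (B *m map_mx intr z)).
    by rewrite -AL; exists (B *m map_mx intr z) => //; rewrite LB; exists z.
  by rewrite LB => -[z' _ <-]; rewrite mulKmx //; exact: intv_map.
- by move=> y; rewrite /tq fE mulmxDr -!mulmxA !mulKVmx.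
Qed.

Lemma half_not_int : (2^-1 : R) \isn't a Num.int.
Proof.
apply/negP => /intrP[n /eqP]; rewrite eq_sym -(inj_eq (mulIf (_ : (2 : R) != 0))) ?pnatr_eq0 //.
rewrite mulVf ?pnatr_eq0 // -[2]/((2 : int)%:~R) -intrM -[1]/((1 : int)%:~R) eqr_int.
by move=> /eqP; lia.
Qed.

Lemma intv_line (u : V) : (forall t, intv (t *: u)) -> u = 0.
Proof.
move=> h; apply/matrixP => i j; rewrite (ord1 j) mxE; apply/eqP/negPn/negP => ui.
have := h (2^-1 / u i 0) i; rewrite mxE divfK //.
exact/negP/half_not_int.
Qed.

Lemma matrix_cols (Z Z' : 'M[R]_2) : (forall y : V, Z *m y = Z' *m y) -> Z = Z'.
Proof.
by move=> h; apply/matrixP => i j; have := h (delta_mx j 0); rewrite -!colE => /colP/(_ i); rewrite !mxE.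
Qed.

(** The difference of two lifts is integral at every point. Applied to all real multiples of [y],
    this kills the linear part of the difference and leaves an integral constant. *)
Lemma aff_uniq f Z c Z' c' : aff f Z c -> aff f Z' c' -> Z = Z' /\ intv (c - c').
Proof.
move=> [_ _ h] [_ _ h'].
have E y : intv ((Z *m y + c) - (Z' *m y + c')) by apply/q_eq; rewrite -h -h'.
have cc : intv (c - c') by have := E 0; rewrite !mulmx0 !add0r.
split=> //; apply: matrix_cols => y; apply/eqP; rewrite -subr_eq0; apply/eqP/intv_line => t.
have := intvB (E (t *: y)) cc; rewrite -!scalemxAr opprD addrACA addrK.
by rewrite -scalerBr.
Qed.

Lemma aff_comp f g Z c Z' c' : aff f Z c -> aff g Z' c' ->
  aff (fun x => f (g x)) (Z *m Z') (Z *m c' + c).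
Proof.
move=> [u i h] [u' i' h']; split; first by rewrite unitmx_mul u.
- by move=> y /i' /i; rewrite mulmxA.
- by move=> y; rewrite h' h mulmxDr mulmxA addrA.
Qed.

Lemma aff_shift f Z c c' : aff f Z c -> intv (c - c') -> aff f Z c'.
Proof.
move=> [u i h] cc; split=> // y; rewrite h; apply/q_eq.
by rewrite opprD addrACA subrr add0r.
Qed.

Lemma aff_eq f g Z c : (forall x, f x = g x) -> aff f Z c -> aff g Z c.
Proof. by move=> fg [u i h]; split=> // y; rewrite -fg. Qed.

Lemma aff1_ext f g c : aff f 1%:M c -> aff g 1%:M c -> f = g.
Proof.
move=> [_ _ h] [_ _ h']; apply/funext => x; have [y <-] := tq_surj uB x.
by rewrite h h'.
Qed.

Lemma aff_id : aff id 1%:M 0.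
Proof.
split; first exact: unitmx1.
- by move=> y; rewrite mul1mx.
- by move=> y; rewrite mul1mx addr0.
Qed.

Lemma small_near (y : V) e : 0 < e -> \forall y' \near y, small e (y' - y).
Proof.
move=> e0; apply/nbhs_ballP; exists e => //= y' yy' i; rewrite !mxE distrC.
by have [_ /(_ i 0)] := yy'; rewrite -ball_normE.
Qed.

Lemma near_small_image (y : V) e : 0 < e ->
  \forall x \near q y, exists2 y', q y' = x & small e (y' - y).
Proof.
move=> e0; have := tq_open uB LB (small_near y e0).
by apply: filterS => _ [y' yy' <-]; exists y'.
Qed.

Section NearIdentity.
Variables (G : topGroupType) (rho : gaction G (torus L)).
Hypothesis rho_aff : forall g, Aff L (rho g).

(** The tube lemma makes the displacement small along the whole segment at once; [near_identity]
    applies it to the coordinate vectors. *)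
Lemma near_identity_segment (u : V) e : 0 < e ->
  \forall g \near (1%g : G), forall t, `[0, (1 : R)]%classic t ->
    exists2 y, q y = rho g (q (t *: u)) & small e (y - t *: u).
Proof.
move=> e0; have e2 : 0 < e / 2 by rewrite divr_gt0.
pose P (g : G) (t : R) := exists2 y, q y = rho g (q (t *: u)) & small e (y - t *: u).
apply: (@near_forall_compact G R `[0, 1]%classic 1%g P); first exact: segment_compact.
move=> t _; have uc : continuous (fun t : R => t *: u) by move=> s; exact: scalel_continuous.
have c : continuous (fun p : G * R => rho p.1 (q (p.2 *: u))).
  apply: gact_cts2; first exact: fst_cts.
  exact: (comp_cts (comp_cts (@snd_cts _ _) uc) (@tq_cts _ L B)).
have n1 : nbhs (rho (1%g : G) (q (t *: u))) [set x | exists2 y', q y' = x & small (e / 2) (y' - t *: u)].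
  by rewrite gact1; exact: near_small_image.
have h1 := nbhs_preim (c (1%g, t)) n1.
have h2 := nbhs_preim (comp_cts (@snd_cts G R) uc (x := (1%g, t))) (small_near (t *: u) e2).
apply: (filterS _ (nbhsI h1 h2)) => -[g s] [[y yE sy] /= st].
exists y => // i; have := sy i; have := st i; rewrite !mxE.
rewrite !ltr_norml => /andP[? ?] /andP[? ?]; apply/andP; split; lra.
Qed.

(* If [u = (Z - 1) e_i] were a nonzero integer vector, then [t u] would be at
   distance 1/2 from the integers for some [t] in [0, 1]. *)
Lemma near_identity e : 0 < e ->
  \forall g \near (1%g : G), exists2 c, small e c & aff (rho g) 1%:M c.
Proof.
(* Two displacements smaller than 1/4 add up to less than 1/2, the distance from the integers that
   the contradiction needs. *)
move=> e0; pose d := Num.min e 4^-1.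
have d0 : 0 < d by rewrite lt_min e0 invr_gt0 ltr0n.
have n0 := near_identity_segment (delta_mx 0 0) d0.
have n1 := near_identity_segment (delta_mx 1 0) d0.
apply: (filterS _ (nbhsI n0 n1)) => g [h0 h1].
have [Z [c' Zc']] := aff_ex (rho_aff g).
have I0 : `[0, (1 : R)]%classic 0 by rewrite /= in_itv /= lexx ler01.
have [c cE sc] := h0 0 I0; rewrite scale0r subr0 in sc.
have Zc : aff (rho g) Z c.
  apply: (aff_shift Zc'); have [_ _ E] := Zc'.
  have E0 : q c = q c' by rewrite cE scale0r E mulmx0 add0r.
  by apply/q_eq; exact: esym E0.
have hu (i : 'I_2) : forall t, `[0, (1 : R)]%classic t ->
    exists2 y, q y = rho g (q (t *: delta_mx i 0)) & small d (y - t *: delta_mx i 0).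
  by case: (ord2_cases i) => ->.
suff Z1 : Z = 1%:M.
  exists c; last by rewrite -Z1.
  by move=> i; apply: lt_le_trans (sc i) _; rewrite ge_min lexx.
have [_ iZ ZE] := Zc.
have col i : Z *m delta_mx i 0 = delta_mx i 0 :> V.
  apply/eqP; rewrite -subr_eq0; set u := _ - _; apply/eqP.
  have iu : intv u by apply: intvB; [apply: iZ|]; exact: intv_delta.
  apply/matrixP => k j; rewrite (ord1 j) [RHS]mxE; apply/eqP/negPn/negP => uk.
  have uk1 : 1 <= `|u k 0| by exact: (norm_intr_ge1 (iu k) uk).
  pose t := (2 * `|u k 0|)^-1.
  have uk0 : 0 < `|u k 0| by rewrite normr_gt0.
  have It : `[0, (1 : R)]%classic t.
    rewrite /= in_itv /= invr_ge0 mulr_ge0 //= invf_le1 ?mulr_gt0 //.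
    by apply: (le_trans uk1); rewrite ler_peMl // ler1n.
  have [y yE sy] := hu i t It.
  have : intv ((Z *m (t *: delta_mx i 0) + c) - y) by apply/q_eq; rewrite yE ZE.
  move=> /(_ k) /intrP[n nE].
  have tu : `|t * u k 0 - n%:~R| < 2^-1.
    rewrite -nE; have -> : t * u k 0 - ((Z *m (t *: delta_mx i 0) + c) - y) k 0 =
      (y - t *: delta_mx i 0) k 0 - c k 0.
      by rewrite -scalemxAr /u !mxE; ring.
    apply: le_lt_trans (ler_normB _ _) _.
    have := sy k; have := sc k; have : d <= 4^-1 by rewrite ge_min lexx orbT.
    by move=> ? ? ?; lra.
  have : `|t * u k 0| = 2^-1.
    by rewrite normrM /t ger0_norm ?invr_ge0 ?mulr_ge0 // invfM -mulrA mulVf ?mulr1 // gt_eqF.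
  move: tu; have [->|n0'] := eqVneq n 0; first by rewrite subr0 => + E; rewrite E ltxx.
  have n1' : 1 <= `|n%:~R : R| by apply: norm_intr_ge1; rewrite ?intr_int ?intr_eq0.
  move=> tu tE; have := ler_normD (n%:~R - t * u k 0) (t * u k 0).
  by rewrite subrK distrC tE; lra.
apply: matrix_cols => y; rewrite mul1mx (matrix_sum_delta y) mulmx_sumr; apply: eq_bigr => i _.
by rewrite mulmx_sumr; apply: eq_bigr => j _; rewrite -scalemxAr (ord1 j) col.
Qed.

End NearIdentity.

End AffineAction.

Lemma open_rV1_infinite (R : realType) (A : set 'rV[R]_1) (s : seq 'rV[R]_1) v :
  open A -> A v -> ~ (forall u, A u -> u \in s).
Proof.
move=> oA Av As; have /nbhs_ballP[r /= r0 rA] : nbhs v A by apply: open_nbhs_nbhs.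
pose f (i : nat) : 'rV[R]_1 := v + const_mx (r / i.+2%:R).
have fI : injective f.
  move=> i j /addrI /matrixP/(_ 0 0); rewrite !mxE => /(mulfI (lt0r_neq0 r0)) /invr_inj /eqP.
  by rewrite eqr_nat => /eqP [].
have fs i : f i \in s.
  apply/As/rA; split=> // k l; rewrite -ball_normE /= !mxE opprD addrA subrr sub0r normrN.
  by rewrite gtr0_norm ?divr_gt0 // ltr_pdivrMr // ltr_pMr // ltr1n.
pose t := [seq f i | i <- iota 0 (size s).+1].
have ut : uniq t by rewrite map_inj_uniq // iota_uniq.
have ts : {subset t <= s} by move=> _ /mapP[i _ ->].
by have := uniq_leq_size ut ts; rewrite size_map size_iota ltnn.
Qed.

Section AffineGroup.
Variables (R : realType) (L : lattice R) (B : 'M[R]_2).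
Local Notation V := 'cV[R]_2.
Hypothesis uB : B \in unitmx.
Hypothesis LB : lattice_set L = [set B *m map_mx intr z | z in [set: 'cV[int]_2]].
Local Notation q := (tq L B).
Local Notation q_eq := (tq_eq uB LB).
Local Notation aff := (aff B).
Variables (G : topGroupType) (rho : gaction G (torus L)) (Gam : subgrp G).
Hypothesis rho_aff : forall g, Aff L (rho g).
Hypothesis cG : compact [set: G].
Hypothesis clGam : closed Gam.

Definition translations (c : V) := exists2 g, subgrp_set Gam g & aff (rho g) 1%:M c.

Lemma aff_transl f c : (forall y, f (q y) = q (y + c)) -> aff f 1%:M c.
Proof.
move=> h; split; first exact: unitmx1.
- by move=> y; rewrite mul1mx.
- by move=> y; rewrite mul1mx.
Qed.

Lemma translE g c y : aff (rho g) 1%:M c -> rho g (q y) = q (y + c).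
Proof. by move=> [_ _ ->]; rewrite mul1mx. Qed.

Lemma transl_int c : intv c -> translations c.
Proof.
move=> ic; exists 1%g; first exact: subgrp1.
by apply: aff_transl => y; rewrite gact1 (tq_shift uB LB).
Qed.

Lemma transl0 : translations 0.
Proof. by apply: transl_int => i; rewrite mxE rpred0. Qed.

Lemma aff_inv g c : aff (rho g) 1%:M c -> aff (rho g^-1%g) 1%:M (- c).
Proof.
move=> h; apply: aff_transl => y.
by rewrite -{1}(subrK c y) -(translE _ h) gactK.
Qed.

Lemma translB x y : translations x -> translations y -> translations (x - y).
Proof.
move=> [g Gg hx] [h Gh /aff_inv hy]; exists (g * h^-1)%g.
  by apply: subgrpM => //; exact: subgrpV.
by apply: aff_transl => z; rewrite gactM (translE _ hy) (translE _ hx) -addrA [- y + x]addrC.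
Qed.

(** If no element of [Gam] translates by [x], each one differs from that translation at some point,
    and this persists for nearby elements and vectors. By compactness of [Gam] it persists for all
    elements at once. *)
Lemma transl_closed x : (forall e, 0 < e -> exists2 a, translations a & small e (x - a)) ->
  translations x.
Proof.
move=> h; apply: contrapT => nx.
pose P (x : V) (g : G) := exists y, rho g (q y) <> q (y + x).
have /nbhs_ballP[e /= e0 eP] : \forall x' \near x, forall g, subgrp_set Gam g -> P x' g.
  apply: (@near_forall_compact V G (subgrp_set Gam) x P).
    exact: (subclosed_compact clGam cG (@subsetT _ _)).
  move=> g Gg; have [y ny] : P x g.
    apply: contrapT => nP; apply: nx; exists g => //; apply: aff_transl => y.
    by apply: contrapT => ny; apply: nP; exists y.
  have cl : closed [set p : V * G | rho p.2 (q y) = q (y + p.1)].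
    apply: closed_eq_fun; first exact: (torus_hausdorff uB LB).
      by apply: gact_cts2; [exact: snd_cts|exact: const_cts].
    apply: (@comp_cts _ V _ (fun p : V * G => y + p.1) q); last exact: tq_cts.
    by apply: addV_cts; [exact: const_cts|exact: fst_cts].
  have nn : nbhs (x, g) (~` [set p : V * G | rho p.2 (q y) = q (y + p.1)]).
    by apply: open_nbhs_nbhs; split; [exact: closed_openC|].
  by apply: (filterS _ nn) => -[x' g'] n'; exists y.
have [a [g Gg ha] sa] := h e e0.
have [|y] := eP a _ g Gg; last by rewrite (translE _ ha).
split=> // i j; rewrite -ball_normE /= (ord1 j); have := sa i; by rewrite !mxE.
Qed.

Definition linear_part (M : 'M[R]_2) := exists2 g, subgrp_set Gam g & exists c, aff (rho g) M c.

(** Elements near 1 have linear part 1, so the linear part is constant on each translate of a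
    neighbourhood of 1, and finitely many translates cover [Gam]. *)
Lemma linear_part_finite : exists s : seq 'M[R]_2, forall M, linear_part M -> M \in s.
Proof.
pose N := [set g : G | exists2 c, small 1 c & aff (rho g) 1%:M c].
have N1 : nbhs 1%g N := near_identity uB LB rho_aff ltr01.
have [s _ sP] := subgroup_finite_cover cG clGam N1.
have [Z ZP] := choice (fun g => aff_ex uB LB (rho_aff g)).
exists [seq Z (\val h) | h <- s] => M [g Gg [c gM]].
have [h hs [c' _ hg]] := sP (set_elt Gg); have [ch hh] := ZP (\val h).
have := aff_comp hh hg; rewrite mulmx1 => /aff_eq E.
have [|-> _] := aff_uniq uB LB gM (E (rho g) _); last by apply/mapP; exists h.
by move=> x; rewrite -gactM mulVKg.
Qed.

Lemma linear_part_mul M N : linear_part M -> linear_part N -> linear_part (M *m N).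
Proof.
move=> [g Gg [c gM]] [h Gh [d hN]]; exists (g * h)%g; first exact: subgrpM.
exists (M *m d + c); apply: (aff_eq _ (aff_comp gM hN)) => x.
by rewrite gactM.
Qed.

(** Conjugation by an element with linear part [M] turns the translation by [c] into that by
    [M *m c]. *)
Lemma transl_linear M c : linear_part M -> translations c -> translations (M *m c).
Proof.
move=> [g Gg [d [uM iM gM]]] [h Gh hc]; exists (g * h * g^-1)%g.
  by apply: subgrpM; [exact: subgrpM|exact: subgrpV].
apply: aff_transl => y; pose y' := invmx M *m (y - d).
have yE : y = M *m y' + d by rewrite /y' mulKVmx // subrK.
have gy : rho g (q y') = q y by rewrite gM -yE.
rewrite !gactM -gy gactK (translE _ hc) gM; congr q.
by rewrite mulmxDr yE -!addrA [d + _]addrC.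
Qed.

Hypothesis dim1 : one_dimensional R rho Gam.

Lemma image_elt (g : Gam) : action_image rho Gam (rho (\val g)).
Proof. by exists (\val g) => //; exact: sgP. Qed.

(** A chart of the image has a nonempty open subset of the line as its range, which is infinite. *)
Lemma action_image_infinite (s : seq Gam) :
  ~ forall g : Gam, exists2 h, h \in s & rho (\val g) = rho (\val h).
Proof.
move=> sP; have [ch d1] := dim1 (set_elt (image_elt (sg_one Gam))).
have vI : (chart_map ch @` chart_dom ch) (chart_map ch (set_elt (image_elt (sg_one Gam)))).
  by exists (set_elt (image_elt (sg_one Gam))).
refine (open_rV1_infinite (s := [seq chart_map ch (set_elt (image_elt h)) | h <- s])
  (@chart_img_open _ _ _ ch) vI _).
move=> _ [x _ <-]; have [g Gg gx] := set_mem (valP x).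
have [h hs gh] := sP (set_elt Gg); apply/mapP; exists h => //.
by congr (chart_map ch _); apply: val_inj; rewrite /= -gx gh.
Qed.

(** Otherwise the elements of [Gam] near 1 act trivially, and finitely many cosets exhaust the
    image. *)
Lemma transl_nondiscrete e : 0 < e -> exists a, [/\ translations a, small e a & a != 0].
Proof.
move=> e0; apply: contrapT => no.
pose N := [set g : G | exists2 c, small e c & aff (rho g) 1%:M c].
have N1 : nbhs 1%g N := near_identity uB LB rho_aff e0.
have [s _ sP] := subgroup_finite_cover cG clGam N1.
apply: (@action_image_infinite s) => g; have [h hs [c sc hc]] := sP g.
exists h => //; have c0 : c = 0.
  apply: contrapT => /eqP c0; apply: no; exists c; split=> //.
  exists ((\val h)^-1 * \val g)%g => //.
  by apply: subgrpM; [apply: subgrpV|]; exact: sgP.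
rewrite c0 in hc; have E := aff1_ext uB hc (aff_id L B).
by apply/funext => x; rewrite -(mulVKg (\val h) (\val g)) gactM E.
Qed.

(* Otherwise a chart would inject a square of translations into the line. *)
Lemma transl_proper : exists x, ~ translations x.
Proof.
apply: contrapT => no; have all x : translations x by apply: contrapT => ?; apply: no; exists x.
pose pt (p : R * R) : V := \col_i if i == 0 then p.1 else p.2.
have ptc : continuous pt.
  apply: mx_cts => i j; under [X in continuous X]eq_fun do rewrite mxE.
  by case: (i == 0); [exact: fst_cts|exact: snd_cts].
have gP (p : R * R) : exists g : Gam, aff (rho (\val g)) 1%:M (pt p).
  by have [g Gg h] := all (pt p); exists (set_elt Gg).
have [g gE] := choice gP.
pose a (p : R * R) : action_image rho Gam := set_elt (image_elt (g p)).
have ac : continuous a.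
  apply: continuous_to_set_type.
  (* Continuity into the compact-open topology follows by currying from joint continuity, which is
     checked on lifts to the plane. *)
  apply: (@continuous_curry_fun _ _ _ (fun z : (R * R) * torus L => rho (\val (g z.1)) z.2)).
  move=> [p x]; have [y <-] := tq_surj uB x.
  pose j (z : (R * R) * V) : (R * R) * torus L := (z.1, q z.2).
  have jo : open_map j := @open_map_prod _ _ _ _ id q (@open_map_id _) (tq_open uB LB).
  apply: (@open_map_descend _ _ _ j (fun z => rho (\val (g z.1)) z.2) (p, y) jo).
  rewrite (_ : (fun _ => _) = fun z : (R * R) * V => q (z.2 + pt z.1)).
    apply: (@comp_cts _ V _ (fun z : (R * R) * V => z.2 + pt z.1) q); last exact: tq_cts.
    by apply: addV_cts; [exact: snd_cts|exact: (comp_cts (@fst_cts _ _) ptc)].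
  by apply/funext => -[p' y']; rewrite /= (translE _ (gE p')).
have [ch da] := dim1 (a (0, 0)).
have nd : nbhs (a (0, 0)) (chart_dom ch) by apply: open_nbhs_nbhs; split=> //; exact: (@chart_dom_open _ _ _ ch).
have /nbhs_ballP[r /= r0 rP] := nbhs_preim (ac (0, 0)) nd.
(* Within 1/4, parameters differ by at most 1/2 in each coordinate, so distinct ones give
   translations that differ modulo the lattice. *)
pose e := Num.min (r / 2) 4^-1.
have e0 : 0 < e by rewrite lt_min divr_gt0 // invr_gt0 ltr0n.
have er : e < r.
  apply: (@le_lt_trans _ _ (r / 2)); first by rewrite ge_min lexx.
  by rewrite ltr_pdivrMr // mulr_natr mulr2n ltrDl.
have e4 : e <= 4^-1 by rewrite ge_min lexx orbT.
have dom (p : R * R) : `|p.1| <= e -> `|p.2| <= e -> chart_dom ch (a p).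
  move=> p1 p2; apply: rP; split; rewrite -ball_normE /= sub0r normrN; exact: le_lt_trans er.
apply: (@no_planar_injection R (fun p => chart_map ch (a p) 0 0) e e0).
- move=> p p1 p2.
  have h : {for a p, continuous (chart_map ch)}.
    have := @chart_map_cts _ _ _ ch; rewrite continuous_open_subspace; last exact: (@chart_dom_open _ _ _ ch).
    by apply; rewrite inE; exact: dom.
  have h2 := continuous_comp (ac p) h.
  exact: (continuous_comp h2 (@coord_continuous _ _ _ 0 0 _)).
- move=> p p' p1 p2 p1' p2' E.
  have aE : a p = a p'.
    rewrite -(chart_mapK (dom p p1 p2)) -(chart_mapK (dom p' p1' p2')); congr chart_inv.
    by apply/matrixP => i j; rewrite (ord1 i) (ord1 j).
  have := congr1 (fun f => \val f (q 0)) aE; rewrite /= (translE _ (gE p)) (translE _ (gE p')).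
  move=> /q_eq; rewrite !add0r => ip.
  have z (x y : R) : `|x| <= e -> `|y| <= e -> x - y \is a Num.int -> x = y.
    move=> xe ye xy; apply/eqP; rewrite -subr_eq0; apply/negPn/negP => /(norm_intr_ge1 xy).
    by have := ler_normB x y; lra.
  rewrite [p]surjective_pairing [p']surjective_pairing.
  by congr pair; apply: z => //; [have := ip 0|have := ip 1]; rewrite !mxE.
Qed.

End AffineGroup.

(** * A circle that is a slice *)

Section SliceCircle.
Variables (R : realType) (L : lattice R).
Local Notation V := 'cV[R]_2.
Variables (G : topGroupType) (rho : gaction G (torus L)) (Gam : subgrp G).
Hypothesis rho_aff : forall g, Aff L (rho g).
Hypothesis cG : compact [set: G].
Hypothesis clGam : closed Gam.
Hypothesis dim1 : one_dimensional R rho Gam.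

Lemma slice_circle : exists (C : set (torus L)) (N : set G),
  [/\ is_circle R C, closed C,
      forall x, exists g : Gam, exists c : C, rho (\val g) (\val c) = x,
      forall g x, subgrp_set Gam g -> C x -> C (rho g x) -> rho g @` C = C &
      nbhs 1%g N /\
      forall g, N g -> subgrp_set (set_stab rho Gam C) g -> gker rho g].
Proof.
have [B uB LB] := latticeP L.
pose q := tq L B; have q_eq := tq_eq uB LB; rewrite -/q in q_eq.
pose Tr := translations B rho Gam.
have Tr0 : Tr 0 := transl0 uB LB rho Gam.
have TrB x y : Tr x -> Tr y -> Tr (x - y) := @translB _ _ _ _ _ _ x y.
have clTr x : (forall e, 0 < e -> exists2 a, Tr a & small e (x - a)) -> Tr x.
  exact: (transl_closed uB LB cG clGam).
have ndTr e : 0 < e -> exists a, [/\ Tr a, small e a & a != 0].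
  exact: (transl_nondiscrete uB LB rho_aff cG clGam dim1).
have prTr : exists x, ~ Tr x := transl_proper uB LB dim1.
have [v v0 vTr] := subgroup_line Tr0 TrB clTr ndTr.
have [d d0 gap] := subgroup_gap Tr0 TrB clTr v0 vTr prTr.
pose Lin := linear_part B rho Gam.
have [s sP] := linear_part_finite uB LB rho_aff cG clGam.
have Lin_v M : Lin M -> det2 v (M *m v) = 0.
  move=> LM; apply: contrapT => /eqP nz.
  (* Scales the transversal coordinate of the image of [t *: v] to [d / 2], nonzero but below the
     gap. *)
  pose t := d / 2 / det2 v (M *m v).
  have h : Tr (M *m (t *: v)) by exact: (transl_linear LM (vTr t)).
  have E : det2 v (M *m (t *: v)) = d / 2 by rewrite -scalemxAr det2Z /t divfK.
  have := gap _ h; rewrite E gtr0_norm ?divr_gt0 // => /(_ _) H.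
  have : d / 2 = 0 by apply: H; rewrite ltr_pdivrMr // mulr_natr mulr2n ltrDl.
  by apply/eqP; rewrite gt_eqF // divr_gt0.
have [w1 [iw1 vw1 Mw1]] : exists w, [/\ intv w, det2 v w != 0 &
    forall M, Lin M -> exists2 r, r != 0 & M *m w = r *: w].
  apply: (@invariant_complement R v Lin s v0).
  - by move=> M N; exact: linear_part_mul.
  - by move=> M [g _ [c [? _ _]]].
  - by move=> M y [g _ [c [_ iM _]]]; exact: iM.
  - exact: Lin_v.
  - exact: sP.
have w10 : w1 != 0 by apply: contraNneq vw1 => ->; rewrite /det2 !mxE !mulr0 subrr.
have [w [a [b [k [iw ia ib abw [k0 wk]]]]]] := primitive_vector iw1 w10.
have vw : det2 v w != 0 by move: vw1; rewrite wk det2Z mulf_eq0 negb_or k0.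
have Mw M : Lin M -> exists2 r, r != 0 & M *m w = r *: w.
  move=> /Mw1[r r0]; rewrite wk -scalemxAr scalerA mulrC -scalerA => /(scalerI k0) ?.
  by exists r.
pose C : set (torus L) := line B w.
(* For [c] of size [e], the first term gives [|det2 v c| < d] and the second [|det2 w c| < 1]; the
   gap and integrality then make both zero. *)
pose e := Num.min (d / (`|v 0 0| + `|v 1 0| + 1)) (1 / (`|w 0 0| + `|w 1 0| + 1)).
have pv : 0 < `|v 0 0| + `|v 1 0| + 1 by rewrite ltr_wpDl // addr_ge0.
have pw : 0 < `|w 0 0| + `|w 1 0| + 1 by rewrite ltr_wpDl // addr_ge0.
have e0 : 0 < e by rewrite lt_min !divr_gt0.
exists C, [set g | exists2 c, small e c & aff B (rho g) 1%:M c]; split.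
- exact: (line_circle uB LB iw ia ib abw).
- exact: (line_closed uB LB iw ia ib abw).
- move=> x; have [y <-] := tq_surj uB x.
  rewrite (det2_dec y vw); set s1 := _ / _; set t1 := _ / _.
  have [g Gg hg] := vTr s1.
  have Cw : C (q (t1 *: w)) by exists t1.
  exists (set_elt Gg), (set_elt Cw) => /=.
  by rewrite (translE _ hg) addrC.
- move=> g x Gg [t _ <-] [t' _ E].
  have [M [c gM]] := aff_ex uB LB (rho_aff g).
  have LM : Lin M by exists g => //; exists c.
  have [r r0 Mwr] := Mw M LM; have [_ _ gE] := gM.
  (* One point of [C] that stays in [C] forces [c] to be [u *: w] modulo integer vectors, so [g]
     acts on [C] by [t] to [r t + u], which is onto since [r] is nonzero. *)
  pose u := t' - t * r.
  have gC t2 : rho g (q (t2 *: w)) = q ((t2 * r + u) *: w).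
    rewrite gE; apply/q_eq.
    have /q_eq := etrans (esym (gE (t *: w))) (esym E).
    rewrite -!scalemxAr !Mwr !scalerA.
    rewrite (_ : _ - _ = t2 * r *: w + c - (t2 * r + u) *: w) //.
    by apply/matrixP => i j; rewrite !mxE /u; ring.
  apply/seteqP; split=> [_ [_ [t2 _ <-] <-]|_ [t2 _ <-]].
    by exists (t2 * r + u).
  exists (q (((t2 - u) / r) *: w)); first by exists ((t2 - u) / r).
  by rewrite gC divfK // subrK.
split; first exact: (near_identity uB LB rho_aff).
move=> g [c sc gc] [Gg gC].
have Trc : Tr c by exists g.
have smallD (x : V) (A : R) : e <= A / (`|x 0 0| + `|x 1 0| + 1) -> `|det2 x c| < A.
  move=> eA; apply: le_lt_trans (det2_small x sc e0) _.
  have px : 0 < `|x 0 0| + `|x 1 0| + 1 by rewrite ltr_wpDl // addr_ge0.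
  move: eA; rewrite ler_pdivlMr // => eA; apply: lt_le_trans eA.
  by rewrite mulrC ltr_pM2l // ltrDl.
have vc : det2 v c = 0 by apply: gap Trc _; apply: smallD; rewrite ge_min lexx.
(* The image of the point 0 stays in [C], so [c] differs from a multiple of [w] by an integer
   vector, and [det2 w c] is an integer. *)
have wc : det2 w c = 0.
  have C0 : C (q 0) by exists 0 => //; rewrite scale0r.
  have : C (rho g (q 0)) by rewrite -gC; exists (q 0).
  rewrite (translE _ gc) add0r => -[t _ /esym /q_eq ict].
  have : det2 w c \is a Num.int.
    have -> : det2 w c = det2 w (c - t *: w) by rewrite det2B det2Z det2xx mulr0 subr0.
    by rewrite /det2 rpredB // rpredM.
  move=> id; apply: contrapT => /eqP /(norm_intr_ge1 id).
  by rewrite leNgt smallD // ge_min lexx orbT.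
have c0 : c = 0.
  by rewrite (det2_dec c vw) vc [det2 c w]det2C wc oppr0 !mul0r !scale0r addr0.
move=> x; rewrite c0 in gc.
by rewrite (aff1_ext uB gc (aff_id L B)).
Qed.

End SliceCircle.

(** * The isotropy group of an irreducible character *)

Section Isotropy.
Variables (R : realType) (G : topGroupType) (M : topologicalType) (rho : gaction G M).
Variable chi : G -> Cplx R.
Hypothesis chi_irr : Irr R (gker rho) chi.

Lemma gker_isotropy : gker rho `<=` isotropy_set rho chi.
Proof.
have [d [r [[[r1 rM _] _ _] rchi]]] := chi_irr.
move=> g Hg h Hh; rewrite !rchi //; last exact: gkerJ.
have Hg' := gkerV Hg; have Hgh := gkerM Hg' Hh.
rewrite (rM _ _ Hgh Hg) (rM _ _ Hg' Hh) mxtrace_mulC mulmxA -(rM _ _ Hg Hg').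
by rewrite mulgV r1 mul1mx.
Qed.

(** The character is continuous on the kernel, being a trace, so each equation that defines the
    isotropy group is a closed condition. *)
Lemma isotropy_closed : hausdorff_space M -> closed (isotropy rho chi).
Proof.
move=> hM; have [d [r [[[r1 rM rc] _ _] rchi]]] := chi_irr.
have cc : continuous (fun h : gker rho => chi (\val h)).
  rewrite (_ : (fun h => _) = fun h : gker rho => \sum_i r (\val h) i i).
    by apply: (@sum_cts _ _ (Cplx R)^o _ (fun i (h : gker rho) => r (\val h) i i)) => i; exact: mx_entry_cts.
  by apply/funext => h; rewrite rchi //; exact: set_mem (valP h).
rewrite -[X in closed X]/(isotropy_set rho chi).
have -> : isotropy_set rho chi = \bigcap_(h in gker rho) [set g | chi (g^-1 * h * g)%g = chi h].
  by apply/seteqP; split=> g ig h; exact: ig.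
apply: closed_bigI => h Hh.
apply: closed_eq_fun; [exact: (@norm_hausdorff (Cplx R) (Cplx R)^o)| |exact: const_cts].
pose a (g : G) : gker rho := set_elt (gkerJ g Hh).
apply: (@comp_cts _ _ _ a (fun h => chi (\val h))) => //.
apply: continuous_to_set_type => /=.
apply: mulg_cts; last exact: id_cts.
by apply: mulg_cts; [apply: invg_cts; exact: id_cts|exact: const_cts].
Qed.

End Isotropy.

Theorem theorem4 (R : realType) (G : topGroupType) (L : lattice R)
    (rho : gaction G (torus L)) (chi : G -> Cplx R)
    (G_Lie : compact_lie_group R G)
    (rho_aff : forall g, Aff L (rho g))
    (chi_irr : Irr R (gker rho) chi)
    (dim1 : one_dimensional R rho (isotropy rho chi)) :
  exists C : set (torus L),
    let G_chi := isotropy rho chi in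
    let G_chi_C := set_stab rho G_chi C in
    [/\ is_circle R C,
        homeomorphism (twist_map rho G_chi G_chi_C C),
        forall (g : G_chi) (q : twist rho G_chi G_chi_C C),
          twist_map rho G_chi G_chi_C C (twist_act g q) =
          rho (\val g) (twist_map rho G_chi G_chi_C C q) &
        Vect_isomorphism (restrict_to rho chi G_chi C)].
Proof.
have [cG [n [hG _ _]]] := G_Lie.
have [B uB LB] := latticeP L.
have hM := torus_hausdorff uB LB; have cM := torus_compact uB LB.
have clGam := isotropy_closed chi_irr hM.
have [C [N [circle clC cover slice [N1 NK]]]] := slice_circle rho_aff cG clGam dim1.
exists C; cbv zeta; split.
- exact: circle.
- exact: twist_map_homeo.
- by move=> g q; rewrite -(twist_repK q) twist_actE !twist_mapE gactM.
- apply: (Vect_isomorphism_slice cG hG clGam cM hM clC cover slice _ N1 NK).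
    move=> g Hg; split; first exact: gker_isotropy.
    by rewrite -[RHS]image_id; apply: eq_imagel => x _; exact: Hg.
  by move=> g h ig Hh; exact: ig.
Qed.
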